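(* Let $n,s,p,q\in\mathbb N$, $d:=n+2s$, $d_i:=n+2(i-1)$ for $i\in\{1,\dots,s\}$, and let $k\in\mathbb N\cup\{\infty\}$, $k\ge 1$. Assume $k\ge n-q$. Then the set $$\mathcal G:=\Big\{(c_1,\dots,c_s,g,h)\;:\;\text{for all }(x,z)\in\mathcal F(c,g,h)\text{, LIKQ holds at }(x,z)\Big\},$$ where $c$ denotes the switching function defined by $(c_1,\dots,c_s)$, is an open and dense subset of $$C^k(\mathbb R^{d_1})\times\dots\times C^k(\mathbb R^{d_s})\times C^k(\mathbb R^{d};\mathbb R^{p})\times C^k(\mathbb R^{d};\mathbb R^{q})$$ with respect to the strong Whitney $C^k$-topology (the product of the strong Whitney $C^k$-topologies of the factors).
   Context: Switching function: a tuple $(c_1,\dots,c_s)$ with $c_i\in C^k(\mathbb R^{d_i})$ (real-valued) defines $c:\mathbb R^d\cong\mathbb R^n\times\mathbb R^s\times\mathbb R^s\to\mathbb R^s$ by $$c(x,y,z)=\big(c_1(x),\,c_2(x,y_1,z_1),\,\dots,\,c_s(x,(y_1,\dots,y_{s-1}),(z_1,\dots,z_{s-1}))\big).$$ For $z\in\mathbb R^s$, $|z|\in\mathbb R^s$ is the componentwise absolute value and $\operatorname{sign}(z)\in\{-1,0,1\}^s$ the componentwise sign. Feasible set: for $g\in C^k(\mathbb R^d;\mathbb R^p)$, $h\in C^k(\mathbb R^d;\mathbb R^q)$, $$\mathcal F(c,g,h)=\{(x,z)\in\mathbb R^n\times\mathbb R^s: z=c(x,|z|,z),\ g(x,|z|,z)\ge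 0,\ h(x,|z|,z)=0\},$$ with $\ge$ componentwise. Jacobians: $\mathrm D_1,\mathrm D_2,\mathrm D_3$ denote the Jacobians with respect to the first ($x\in\mathbb R^n$), second ($y\in\mathbb R^s$) and third ($z\in\mathbb R^s$) argument, and $\Sigma(z)=\operatorname{diag}(\operatorname{sign}(z))$. With all derivatives evaluated at $(x,|z|,z)$, set $$J_z(x,z)=(I_s-\mathrm D_2c\,\Sigma(z)-\mathrm D_3c)^{-1}\mathrm D_1c,$$ $$J_g(x,z)=\mathrm D_1g+(\mathrm D_2g\,\Sigma(z)+\mathrm D_3g)J_z(x,z),\qquad J_h(x,z)=\mathrm D_1h+(\mathrm D_2h\,\Sigma(z)+\mathrm D_3h)J_z(x,z).$$ (The inverse exists because $\mathrm D_2c$ and $\mathrm D_3c$ are strictly lower triangular.) LIKQ (linear independence kink qualification): let $\alpha(z)=\{i\in\{1,\dots,s\}:z_i=0\}$ and $\beta(x,z)=\{i\in\{1,\dots,p\}: g(x,|z|,z)_i=0\}$; let $P_{\alpha(z)}=(e_i^T)_{i\in\alpha(z)}\in\mathbb R^{|\alpha(z)|\times s}$ and $P_{\beta(x,z)}=(e_i^T)_{i\in\beta(x,z)}\in\mathbb R^{|\beta(x,z)|\times p}$ be the matrices selecting the rows with indices in $\alpha(z)$, respectively $\beta(x,z)$. LIKQ holds at $(x,z)\in\mathcal F(c,g,h)$ if $$\operatorname{rank}\begin{bmatrix}P_{\alpha(z)}J_z(x,z)\\ P_{\beta(x,z)}J_g(x,z)\\ J_h(x,z)\end{bmatrix}=|\alpha(z)|+|\beta(x,z)|+q$$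 (an empty matrix has rank $0$). Strong Whitney topology: for finite $\ell\le k$, the strong Whitney $C^\ell$-topology on $C^k(\mathbb R^{a};\mathbb R^{b})$ has as basis the sets $$U_{\phi,\varepsilon}=\{\psi\in C^k(\mathbb R^a;\mathbb R^b): \|\partial_\mu\phi(w)-\partial_\mu\psi(w)\|<\varepsilon(w)\ \text{for all } w\in\mathbb R^a \text{ and all partial derivatives } \partial_\mu \text{ of order}\le\ell\},$$ where $\phi\in C^k(\mathbb R^a;\mathbb R^b)$ and $\varepsilon:\mathbb R^a\to(0,\infty)$ is continuous. For $k=\infty$, the strong Whitney $C^\infty$-topology is the one generated by the union of the strong Whitney $C^\ell$-topologies over all finite $\ell$. *)

(* Defs.v *)
(* MathComp / MathComp-Analysis. *)
From HB Require Import structures.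
From mathcomp Require Import all_boot all_order all_algebra.
From mathcomp Require Import all_classical all_reals all_analysis.

Set Implicit Arguments.
Unset Strict Implicit.
Unset Printing Implicit Defensive.

Import Order.TTheory GRing.Theory Num.Theory.
Import numFieldNormedType.Exports.

Local Open Scope classical_set_scope.
Local Open Scope ring_scope.

(* Smoothness orders are elements of [option nat], [None] standing for
   infinity. *)
Definition leq_order (l : nat) (k : option nat) : bool :=
  if k is Some m then (l <= m)%N else true.

Section Ck.
Context {R : realType}.

(* A partial derivative of order [size mu] is given by the list [mu] of the
   directions of differentiation (the last one being applied first). *)
Definition partial (a : nat) (W : normedModType R) (mu : seq 'I_a)
    (f : 'rV[R]_a -> W) : 'rV[R]_a -> W :=
  foldr (fun i (g : 'rV[R]_a -> W) => fun w => 'D_(delta_mx 0 i) g w) f mu.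

(* ['D_v g] is a total operator, so the existence of the partial derivatives
   has to be required separately. *)
Definition Ck (k : option nat) (a : nat) (W : normedModType R)
    (f : 'rV[R]_a -> W) : Prop :=
  (forall mu : seq 'I_a, leq_order (size mu) k -> continuous (partial mu f)) /\
  (forall (mu : seq 'I_a) (i : 'I_a), leq_order (size mu).+1 k ->
     forall w, derivable (partial mu f) w (delta_mx 0 i)).

Record Ck_fun (k : option nat) (a : nat) (W : normedModType R) := CkFun {
  Ck_val :> 'rV[R]_a -> W ;
  Ck_valP : Ck k Ck_val }.

Definition whitney_nbhd (k : option nat) (a : nat) (W : normedModType R)
    (l : nat) (phi : Ck_fun k a W) (eps : 'rV[R]_a -> R) : set (Ck_fun k a W) :=
  [set psi | forall (w : 'rV[R]_a) (mu : seq 'I_a), (size mu <= l)%N ->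
     `|partial mu phi w - partial mu psi w| < eps w].

(* For finite [k] only the order [l = k] is used, and these sets form a basis
   of the strong Whitney C^k-topology; for [k = None] every finite order [l] is
   used, and these sets generate the join of the strong Whitney
   C^l-topologies. *)
Definition whitney_subbase (k : option nat) (a : nat) (W : normedModType R) :
    set (set (Ck_fun k a W)) :=
  [set U | exists (l : nat) (phi : Ck_fun k a W) (eps : 'rV[R]_a -> R),
     [/\ (if k is Some m then l = m else True),
         continuous eps,
         (forall w, 0 < eps w) &
         U = whitney_nbhd l phi eps]].

HB.instance Definition _ (k : option nat) (a : nat) (W : normedModType R) :=
  gen_eqMixin (Ck_fun k a W).
HB.instance Definition _ (k : option nat) (a : nat) (W : normedModType R) :=
  gen_choiceMixin (Ck_fun k a W).
HB.instance Definition _ (k : option nat) (a : nat) (W : normedModType R) :=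
  isSubBaseTopological.Build (Ck_fun k a W) (@whitney_subbase k a W) id.

End Ck.

Arguments Ck_fun R k a W : clear implicits.

Section LIKQ.
Context {R : realType}.

(* R^n x R^s x R^s is identified with 'rV_(n + s + s). *)
Definition join3 (n s1 s2 : nat) (x : 'rV[R]_n) (y : 'rV[R]_s1)
    (z : 'rV[R]_s2) : 'rV[R]_(n + s1 + s2) :=
  row_mx (row_mx x y) z.

Definition first_coords (s : nat) (i : 'I_s) (y : 'rV[R]_s) : 'rV[R]_i :=
  \row_(j < i) y 0 (widen_ord (ltnW (ltn_ord i)) j).

(* With indices starting at 0, the component [c i] depends on [x] and on the
   first [i] entries of [y] and [z]. *)
Definition switching (n s : nat) (c : forall i : 'I_s, 'rV[R]_(n + i + i) -> R)
    (w : 'rV[R]_(n + s + s)) : 'rV[R]_s :=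
  \row_(i < s) c i (join3 (lsubmx (lsubmx w))
                          (first_coords i (rsubmx (lsubmx w)))
                          (first_coords i (rsubmx w))).

Definition absv (s : nat) (z : 'rV[R]_s) : 'rV[R]_s := map_mx Num.norm z.

Definition Sigma (s : nat) (z : 'rV[R]_s) : 'M[R]_s :=
  diag_mx (map_mx Num.sg z).

(* The transpose turns the library's row-vector convention into the usual one:
   entry (i, j) is the derivative of the i-th component in direction j. *)
Definition Jac (a b : nat) (f : 'rV[R]_a -> 'rV[R]_b) (w : 'rV[R]_a) :
    'M[R]_(b, a) := (jacobian f w)^T.

Section Partials.
Variables (n s b : nat) (f : 'rV[R]_(n + s + s) -> 'rV[R]_b)
  (w : 'rV[R]_(n + s + s)).
Definition D1 : 'M[R]_(b, n) := lsubmx (lsubmx (Jac f w)).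
Definition D2 : 'M[R]_(b, s) := rsubmx (lsubmx (Jac f w)).
Definition D3 : 'M[R]_(b, s) := rsubmx (Jac f w).
End Partials.

Section Kink.
Variables (n s p q : nat).
Variables (c : 'rV[R]_(n + s + s) -> 'rV[R]_s).
Variables (g : 'rV[R]_(n + s + s) -> 'rV[R]_p).
Variables (h : 'rV[R]_(n + s + s) -> 'rV[R]_q).

Definition feasible : set ('rV[R]_n * 'rV[R]_s) :=
  [set xz | let w := join3 xz.1 (absv xz.2) xz.2 in
    [/\ xz.2 = c w, forall i, 0 <= g w 0 i & h w = 0]].

Definition Jz (x : 'rV[R]_n) (z : 'rV[R]_s) : 'M[R]_(s, n) :=
  let w := join3 x (absv z) z in
  invmx (1%:M - D2 c w *m Sigma z - D3 c w) *m D1 c w.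

Definition Jred (b : nat) (f : 'rV[R]_(n + s + s) -> 'rV[R]_b)
    (x : 'rV[R]_n) (z : 'rV[R]_s) : 'M[R]_(b, n) :=
  let w := join3 x (absv z) z in
  D1 f w + (D2 f w *m Sigma z + D3 f w) *m Jz x z.

Definition alpha (z : 'rV[R]_s) : {set 'I_s} := [set i | z 0 i == 0].

Definition beta (x : 'rV[R]_n) (z : 'rV[R]_s) : {set 'I_p} :=
  [set i | g (join3 x (absv z) z) 0 i == 0].

Definition select_mx (m : nat) (A : {set 'I_m}) : 'M[R]_(#|A|, m) :=
  \matrix_(i < #|A|) delta_mx 0 (enum_val i).

Definition LIKQ (x : 'rV[R]_n) (z : 'rV[R]_s) : Prop :=
  \rank (col_mx (col_mx (select_mx (alpha z) *m Jz x z)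
                        (select_mx (beta x z) *m Jred g x z))
                (Jred h x z))
  = (#|alpha z| + #|beta x z| + q)%N.

End Kink.
End LIKQ.

(* Main.v *)
(* LIKQ fails at a feasible point iff there is a nonzero multiplier (one number per component of
   c, g and h) that is complementary to g, annihilates the x-derivatives, and satisfies the adjoint
   of the triangular system defining J_z at the indices where z does not vanish.

   Openness: on a shell r <= |x| <= r + 1 the triangular structure of z = c(x, |z|, z) bounds z, so
   the points (x, z, normalised multiplier) range over a compact set and the absence of such a
   defect survives C^1-small perturbations. Continuous error functions collect these bounds over
   all shells.

   Density: perturb every component by an affine function of x, with coefficients M. Once the kinks,
   signs, active constraints and the largest free multiplier (scaled to 1) are fixed, the M that
   produce a defect are a Lipschitz image of a set of codes of dimension dim M - 1, hence some
   arbitrarily small M avoids them all: counting grid points replaces Sard's theorem, at the price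
   of Lipschitz first derivatives. For k = 1 these are obtained by first replacing the functions by
   nearby splines. Cutoffs confine the perturbations to well separated shells; the shells of all
   radii fall into eight such classes, and eight open dense sets are intersected. *)
Require Import Defs.
From HB Require Import structures.
From mathcomp Require Import all_boot all_order all_algebra.
From mathcomp Require Import all_classical all_reals all_analysis.
From mathcomp Require Import ring lra zify.
Set Implicit Arguments.
Unset Strict Implicit.
Unset Printing Implicit Defensive.
Import Order.TTheory GRing.Theory Num.Theory.
Import numFieldNormedType.Exports.
Local Open Scope classical_set_scope.
Local Open Scope ring_scope.

(** * Partial derivatives of functions of row vectors *)

(** In the strong topology the tolerance may decay at infinity, which forces work on shells. They
    are shells in [x] alone: [x] is the one argument shared by all components, each [c i] living on
    its own domain, and it controls the feasible [z]. The dimension count for a fixed kink pattern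
    is this. Each component has one constant coefficient and [n] slopes. Where the value of a
    component is prescribed, its constant can be computed and makes room for one unknown: an entry
    of [z] off the kinks, a multiplier otherwise. An inactive component of [g] keeps its constant
    and has multiplier 0. The [n] stationarity equations give the slopes of the component whose
    multiplier is 1, which makes room for [x]; the other slopes are kept. Coefficients and unknowns
    thus match in number, but one unknown is the constant 1: this is the lost dimension. The
    multipliers not listed follow from the triangular adjoint system. Everything is solved
    explicitly, with values and first derivatives of the functions as coefficients, hence the demand
    for Lipschitz derivatives: a merely continuous image of a set of lower dimension can fill an
    open set. *)

Section RowVectors.
Context {R : realType}.

Lemma norm_rV_le a (v : 'rV[R]_a) (b : R) :
  0 <= b -> (forall j, `|v 0 j| <= b) -> `|v| <= b.
Proof.
move=> b0 vb; rewrite [`|v|]mx_normrE; apply/bigmax_leP; split=> // -[i j] _ /=.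
by rewrite ord1.
Qed.

Lemma norm_entry_le a (v : 'rV[R]_a) j : `|v 0 j| <= `|v|.
Proof. by rewrite [`|v|]mx_normrE (le_bigmax _ _ (0, j)). Qed.

Lemma norm_rV_lt a (v : 'rV[R]_a) (b : R) :
  0 < b -> (forall j, `|v 0 j| < b) -> `|v| < b.
Proof.
move=> b0 vb; rewrite [`|v|]mx_normrE; apply/bigmax_ltP; split=> // -[i j] _ /=.
by rewrite ord1.
Qed.

Definition between (x y c : R) := Order.min x y <= c <= Order.max x y.

Lemma between_norm (x y c b : R) :
  between x y c -> `|x| <= b -> `|y| <= b -> `|c| <= b.
Proof.
rewrite /between !ler_norml ge_min le_max.
by case/andP=> /orP[] h1 /orP[] h2 /andP[h3 h4] /andP[h5 h6]; apply/andP; split; lra.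
Qed.

Lemma between_dist (x y c b : R) : between x y c -> `|c - x| <= `|y - x|.
Proof.
rewrite /between ge_min le_max => H.
case: (leP x y) => xy; [rewrite (ger0_norm (x := y - x)) | rewrite (ltr0_norm (x := y - x))];
  rewrite ?ler_norml; try lra; case/andP: H => /orP[] h1 /orP[] h2; apply/andP; split; lra.
Qed.

Definition upd a (w : 'rV[R]_a) (i : 'I_a) (t : R) : 'rV[R]_a :=
  \row_j (if j == i then t else w 0 j).

Lemma upd_upd a (w : 'rV[R]_a) i s t : upd (upd w i s) i t = upd w i t.
Proof. by apply/rowP => j; rewrite !mxE; case: eqVneq. Qed.

Lemma upd_same a (w : 'rV[R]_a) i t : upd w i t 0 i = t.
Proof. by rewrite mxE eqxx. Qed.

Lemma upd_other a (w : 'rV[R]_a) i j t : j != i -> upd w i t 0 j = w 0 j.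
Proof. by rewrite mxE => /negbTE ->. Qed.

Lemma norm_upd_le a (w : 'rV[R]_a) i t b :
  `|w| <= b -> `|t| <= b -> `|upd w i t| <= b.
Proof.
move=> wb tb; apply: norm_rV_le => [|j]; first exact: le_trans (normr_ge0 _) tb.
by rewrite mxE; case: eqP => // _; exact: le_trans (norm_entry_le _ _) wb.
Qed.

End RowVectors.

Notation pd i f := ('D_(delta_mx 0 i) f).

Section PartialDerivatives.
Context {R : realType}.

Lemma is_derive_line (V W : normedModType R) (f : V -> W) x v (t : R) :
  derivable f (t *: v + x) v ->
  is_derive t 1 (fun h : R => f (h *: v + x)) ('D_v f (t *: v + x)).
Proof.
have E : (fun h : R => h^-1 *: (((fun h : R => f (h *: v + x)) \o shift t) (h *: 1)
           - f (t *: v + x))) =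
         (fun h => h^-1 *: ((f \o shift (t *: v + x)) (h *: v) - f (t *: v + x))).
  by apply/funext => h /=; rewrite [h *: 1]mulr1 scalerDl addrA.
move=> df; apply: DeriveDef; first by rewrite /derivable E.
by rewrite /derive E.
Qed.

Lemma is_derive_upd a (W : normedModType R) (f : 'rV[R]_a -> W) w i t :
  derivable f (upd w i t) (delta_mx 0 i) ->
  is_derive t 1 (fun t => f (upd w i t)) (pd i f (upd w i t)).
Proof.
move=> df.
have E s : upd w i s = s *: delta_mx 0 i + upd w i 0.
  by apply/rowP => j; rewrite !mxE eqxx /=; case: eqVneq => _; rewrite ?mulr1 ?addr0// mulr0 add0r.
rewrite (_ : (fun t => _) = fun t => f (t *: delta_mx 0 i + upd w i 0)); last first.
  by apply/funext => s; rewrite -E.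
by rewrite E in df *; exact: is_derive_line.
Qed.

Lemma mvt_upd a (f : 'rV[R]_a -> R) (w : 'rV[R]_a) i (s t : R) :
  (forall v, derivable f v (delta_mx 0 i)) ->
  exists2 c, between s t c & f (upd w i t) - f (upd w i s) = pd i f (upd w i c) * (t - s).
Proof.
move=> df.
have main x y : x <= y -> exists2 c, between x y c &
    f (upd w i y) - f (upd w i x) = pd i f (upd w i c) * (y - x).
  move=> xy.
  have [] := @MVT_segment R (fun t => f (upd w i t)) (fun t => pd i f (upd w i t)) x y xy.
  - by move=> z _; exact: is_derive_upd.
  - apply: derivable_within_continuous => z _.
    by have [] := is_derive_upd (df (upd w i z)).
  move=> c; rewrite in_itv /= => cab E; exists c => //.
  by rewrite /between min_l// max_r.
have [/main//|/ltW /main[c cts E]] := leP s t.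
exists c; first by rewrite /between minC maxC.
by rewrite -opprB E -mulrN opprB.
Qed.

(** An axis-parallel staircase from [w] to [w']: each of its edges involves a single partial
    derivative, so total differentiability is not presupposed. *)
Definition splice a (w w' : 'rV[R]_a) (k : nat) : 'rV[R]_a :=
  \row_j (if (j < k)%N then w' 0 j else w 0 j).

Lemma splice0 a (w w' : 'rV[R]_a) : splice w w' 0 = w.
Proof. by apply/rowP => j; rewrite mxE. Qed.

Lemma splice_full a (w w' : 'rV[R]_a) : splice w w' a = w'.
Proof. by apply/rowP => j; rewrite mxE ltn_ord. Qed.

Lemma spliceS a (w w' : 'rV[R]_a) (k : 'I_a) :
  splice w w' k.+1 = upd (splice w w' k) k (w' 0 k).
Proof.
apply/rowP => j; rewrite !mxE ltnS leq_eqVlt.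
by have [->|jk] := eqVneq j k; rewrite ?eqxx //= (_ : (j == k :> nat) = false) //; apply/eqP => /val_inj/eqP; apply/negP.
Qed.

Lemma splice_k a (w w' : 'rV[R]_a) (k : 'I_a) :
  splice w w' k = upd (splice w w' k) k (w 0 k).
Proof. by apply/rowP => j; rewrite !mxE; case: eqVneq => [->|//]; rewrite ltnn. Qed.

(** Telescoping along the staircase, with the one-dimensional mean value theorem on each edge.
    [L = 0] yields Lipschitz bounds; [L] the gradient at [w] yields differentiability. *)
Lemma mean_value_bound a (f : 'rV[R]_a -> R) (w w' : 'rV[R]_a) (L : 'I_a -> R) (K : R) :
  (forall v i, derivable f v (delta_mx 0 i)) ->
  (forall (v : 'rV[R]_a) i, (forall j, between (w 0 j) (w' 0 j) (v 0 j)) -> `|pd i f v - L i| <= K) ->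
  `|f w' - f w - \sum_i L i * (w' 0 i - w 0 i)| <= K * \sum_i `|w' 0 i - w 0 i|.
Proof.
move=> df dK.
have -> : f w' - f w = \sum_(i < a) (f (splice w w' i.+1) - f (splice w w' i)).
  rewrite -(big_mkord xpredT (fun i => f (splice w w' i.+1) - f (splice w w' i))).
  by rewrite telescope_sumr// splice_full splice0.
rewrite -sumrB mulr_sumr (le_trans (ler_norm_sum _ _ _))// ler_sum// => i _.
rewrite spliceS [X in _ - f X]splice_k.
have [c cb ->] := mvt_upd (splice w w' i) (w 0 i) (w' 0 i) (fun v => df v i).
rewrite -mulrBl normrM ler_wpM2r//; apply: dK => j; rewrite !mxE.
have [->|_] := eqVneq j i; first exact: cb.
by rewrite /between; case: ifP; rewrite ge_min le_max !lexx ?orbT.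
Qed.

Lemma lipschitz_box a (f : 'rV[R]_a -> R) (b K : R) (w w' : 'rV[R]_a) :
  (forall v i, derivable f v (delta_mx 0 i)) ->
  (forall v i, `|v| <= b -> `|pd i f v| <= K) ->
  `|w| <= b -> `|w'| <= b ->
  `|f w' - f w| <= K * \sum_i `|w' 0 i - w 0 i|.
Proof.
move=> df dK wb w'b.
have := @mean_value_bound a f w w' (fun=> 0) K df.
rewrite big1 => [|i _]; last by rewrite mul0r.
rewrite subr0; apply => v i vb; rewrite subr0; apply: dK.
apply: norm_rV_le => [|j]; first exact: le_trans (normr_ge0 _) wb.
by apply: between_norm (vb j) _ _; apply: le_trans (norm_entry_le _ _) _.
Qed.

Lemma continuous_bigsum (T : topologicalType) (W : normedModType R) (I : Type) (r : seq I)
    (P : pred I) (F : I -> T -> W) :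
  (forall i, continuous (F i)) -> continuous (fun x => \sum_(i <- r | P i) F i x).
Proof.
move=> cF; elim: r => [|i r IH].
  rewrite (_ : (fun x => _) = cst 0); first by move=> x; exact: cvg_cst.
  by apply/funext => x; rewrite big_nil.
rewrite (_ : (fun x => _) = (fun x => (if P i then F i x else 0) + \sum_(i <- r | P i) F i x)).
  by move=> x; apply: cvgD; [case: ifP => _; [exact: cF|exact: cvg_cst]|exact: IH].
by apply/funext => x; rewrite big_cons; case: ifP; rewrite ?add0r.
Qed.

(** The bridge from [Ck], which speaks of partial derivatives, to [jacobian], which is meaningful
    for differentiable functions. *)
Lemma differentiable_partials a (f : 'rV[R]_a -> R) (w : 'rV[R]_a) :
  (forall v i, derivable f v (delta_mx 0 i)) ->
  (forall i, continuous (pd i f)) ->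
  differentiable f w.
Proof.
move=> df cf.
pose L0 (h : 'rV[R]_a) : R^o := \sum_i pd i f w * h 0 i.
have Llin : linear L0.
  move=> k u v; rewrite /L0 scaler_sumr -big_split /=; apply: eq_bigr => i _.
  by rewrite !mxE mulrDr mulrCA.
pose L : {linear 'rV[R]_a -> R^o} := HB.pack L0 (GRing.isLinear.Build _ _ _ _ _ Llin).
have cL : continuous L.
  apply: continuous_bigsum => i x.
  apply: (@cvgM R _ (nbhs x) _ (fun=> pd i f w) (fun h : 'rV[R]_a => h 0 i)).
    exact: cvg_cst.
  exact: coord_continuous.
have E : (f : 'rV[R]_a -> R^o) \o shift w = cst (f w : R^o) + L +o_ (0 : 'rV[R]_a) id.
  apply/eqaddoP => e0 e0_gt0; pose e := PosNum e0_gt0; rewrite -[e0]/(e%:num).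
  (* The absolute increments sum to at most [a] times the norm of [h]; [a.+1] also covers dimension
     0. *)
  have e' : 0 < e%:num / a.+1%:R :> R by rewrite divr_gt0.
  near=> h.
  have -> : ((f \o shift w) - (cst (f w) + L)) h = f (h + w) - f w - \sum_i pd i f w * ((h + w) 0 i - w 0 i).
    rewrite !fctE /= opprD addrA; congr (_ - _).
    by apply: eq_bigr => i _; rewrite !mxE addrK.
  rewrite (le_trans (mean_value_bound (K := e%:num / a.+1%:R) df _))//; last first.
    apply: (@le_trans _ _ (e%:num / a.+1%:R * \sum_(i < a) `|h|)).
      rewrite ler_wpM2l ?(ltW e')//.
      by apply: ler_sum => i _; rewrite !mxE addrK norm_entry_le.
    rewrite sumr_const card_ord -[_ *+ a]mulr_natl mulrA ler_wpM2r// mulrAC.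
    by rewrite ler_pdivrMr// ler_pM2l// ler_nat.
  move=> v i vb.
  have : `|v - w| <= `|h|.
    apply: norm_rV_le => // j; rewrite !mxE.
    have := between_dist 0 (vb j); rewrite !mxE addrK => /le_trans; apply.
    exact: norm_entry_le.
  move: v {vb} i; near: h.
  have : \forall v \near w, forall i, `|pd i f v - pd i f w| <= e%:num / a.+1%:R.
    apply: (@filter_forall _ 'I_a (fun i => [set v | `|pd i f v - pd i f w| <= e%:num / a.+1%:R]) (nbhs w)) => i.
    have /cvgrPdist_le/(_ _ e') := cf i w.
    by apply: filterS => v; rewrite distrC.
  move=> /nbhs_ballP[r /= r0 H].
  apply/nbhs_ballP; exists r => //= h; rewrite -ball_normE /= sub0r normrN => hr v i vh.
  apply: H; rewrite -ball_normE /= distrC; exact: le_lt_trans hr.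
have dL : 'd f w = L :> (_ -> _) by apply: diff_unique.
by apply/diff_locallyP; rewrite dL; split.
Unshelve. all: by end_near. Qed.

End PartialDerivatives.

(** * Functions of class C^m *)

Lemma leq_order_trans m m' k : (m <= m')%N -> leq_order m' k -> leq_order m k.
Proof. by case: k => //= k; exact: leq_trans. Qed.

Lemma continuous_at_near (T U : topologicalType) (f g : T -> U) (x : T) :
  (\near x, f x = g x) -> continuous_at x g -> continuous_at x f.
Proof.
move=> fg cg; rewrite /continuous_at (nbhs_singleton fg).
by apply: cvg_trans cg; apply: near_eq_cvg; apply: filterS fg => v ->.
Qed.

Section Continuity.
Context {R : realType} {T : topologicalType}.

Lemma continuous_add (W : normedModType R) (f g : T -> W) :
  continuous f -> continuous g -> continuous (fun x => f x + g x).
Proof. by move=> cf cg x; apply: cvgD; [exact: cf|exact: cg]. Qed.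

Lemma continuous_scale (W : normedModType R) (f : T -> R) (g : T -> W) :
  continuous f -> continuous g -> continuous (fun x => f x *: g x).
Proof. by move=> cf cg x; apply: cvgZ; [exact: cf|exact: cg]. Qed.

Lemma continuous_mul (f g : T -> R) :
  continuous f -> continuous g -> continuous (fun x => f x * g x).
Proof. exact: continuous_scale. Qed.

Lemma continuous_composite (U V : topologicalType) (f : T -> U) (g : U -> V) :
  continuous f -> continuous g -> continuous (fun x => g (f x)).
Proof. by move=> cf cg x; apply: continuous_comp; [exact: cf|exact: cg]. Qed.

Lemma continuous_opp (W : normedModType R) (f : T -> W) :
  continuous f -> continuous (fun x => - f x).
Proof. by move=> cf x; apply: cvgN; exact: cf. Qed.

Lemma continuous_norm (W : normedModType R) (f : T -> W) :
  continuous f -> continuous (fun x => `|f x|).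
Proof. by move=> cf x; apply: cvg_norm; exact: cf. Qed.

End Continuity.

Lemma continuous_rowP (R : realType) (T : topologicalType) p (G : T -> 'rV[R]_p) :
  continuous G <-> forall j, continuous (fun w => G w 0 j).
Proof.
split=> [cG j|cG w].
  by apply: (continuous_composite (g := fun u : 'rV[R]_p => u 0 j) cG); exact: coord_continuous.
apply/cvgrPdist_lt => e e0.
have : \forall v \near w, forall j : 'I_p, `|G w 0 j - G v 0 j| < e.
  apply: (@filter_forall _ 'I_p (fun j => [set v | `|G w 0 j - G v 0 j| < e]) (nbhs w)) => j.
  by have /cvgrPdist_lt/(_ _ e0) := cG j w.
by apply: filterS => v H; apply: norm_rV_lt => // j; rewrite !mxE.
Qed.

Section Cn.
Context {R : realType}.

(* Class C^m, by recursion on the first derivatives: the induction-friendly form of [Ck]. *)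
Fixpoint Cn (m : nat) a (W : normedModType R) (f : 'rV[R]_a -> W) : Prop :=
  if m is m'.+1 then
    [/\ continuous f, forall w i, derivable f w (delta_mx 0 i) & forall i, Cn m' (pd i f)]
  else continuous f.

Lemma CnS m a (W : normedModType R) (f : 'rV[R]_a -> W) :
  Cn m.+1 f <-> [/\ continuous f, forall w i, derivable f w (delta_mx 0 i) & forall i, Cn m (pd i f)].
Proof. by []. Qed.

Lemma CnSI m a (W : normedModType R) (f : 'rV[R]_a -> W) :
  continuous f -> (forall w i, derivable f w (delta_mx 0 i)) -> (forall i, Cn m (pd i f)) ->
  Cn m.+1 f.
Proof. by []. Qed.

(** The last direction of a list is differentiated first, so lists are peeled from the right to
    follow the recursion of [Cn]; hence [lastP] in the inductions below. *)
Lemma partial_rcons a (W : normedModType R) (f : 'rV[R]_a -> W) mu i :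
  partial (rcons mu i) f = partial mu (pd i f).
Proof. by rewrite /partial foldr_rcons. Qed.

Lemma Ck_Some a (W : normedModType R) m (f : 'rV[R]_a -> W) : Ck (Some m) f <-> Cn m f.
Proof.
elim: m f => [|m IH] f; first split.
- by case=> /(_ [::] isT).
- by move=> cf; split=> [[|//] _|//].
split.
- move=> [cf df]; split.
  + exact: (cf [::]).
  + by move=> w i; exact: (df [::]).
  + move=> i; apply/IH; split=> [mu smu|mu j smu w].
      by rewrite -partial_rcons; apply: cf; rewrite /= size_rcons.
    by rewrite -partial_rcons; apply: df; rewrite /= size_rcons.
- move=> [cf df /(_ _)/IH cnf]; split=> [mu|mu j]; case: (lastP mu) => [//|mu' i];
    rewrite /= ?size_rcons partial_rcons => smu.
    exact: (cnf i).1.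
  exact: (cnf i).2.
Qed.

Lemma CkP a (W : normedModType R) k (f : 'rV[R]_a -> W) :
  Ck k f <-> forall m, leq_order m k -> Cn m f.
Proof.
split.
- move=> [cf df] m mk; apply/Ck_Some; split=> [mu|mu i] smu; [apply: cf|apply: df];
    exact: leq_order_trans smu mk.
- move=> H; split=> [mu smu|mu i smu].
    have /Ck_Some[cf _] := H _ smu; exact: cf (leqnn _).
  have /Ck_Some[_ df] := H _ smu; exact: df (leqnn _).
Qed.

Lemma Cn_eq m a (W : normedModType R) (f g : 'rV[R]_a -> W) : f =1 g -> Cn m f -> Cn m g.
Proof. by move=> /funext ->. Qed.

Lemma Cn_pred m a (W : normedModType R) (f : 'rV[R]_a -> W) : Cn m.+1 f -> Cn m f.
Proof.
elim: m f => [|m IH] f; first by case.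
by move=> [cf df H]; split=> // i; apply: IH.
Qed.

Lemma Cn_continuous m a (W : normedModType R) (f : 'rV[R]_a -> W) : Cn m f -> continuous f.
Proof. by case: m => [//|m []]. Qed.

Lemma pd_near a (W : normedModType R) (f g : 'rV[R]_a -> W) (w0 : 'rV[R]_a) i :
  (\near w0, f w0 = g w0) -> (\near w0, pd i f w0 = pd i g w0).
Proof.
move=> /nbhs_interior; apply: filterS => w; exact: near_eq_derive.
Qed.

Lemma partial_near a (W : normedModType R) (f g : 'rV[R]_a -> W) (w0 : 'rV[R]_a) mu :
  (\near w0, f w0 = g w0) -> partial mu f w0 = partial mu g w0.
Proof.
move=> fg; suff : \near w0, partial mu f w0 = partial mu g w0 by exact: nbhs_singleton.
by elim: mu => //= i mu; exact: pd_near.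
Qed.

(** Smoothness is local: this is what makes a system glued from infinitely many pieces smooth. *)
Lemma Cn_near m a (W : normedModType R) (f : 'rV[R]_a -> W) :
  (forall w0 : 'rV[R]_a, exists2 g, Cn m g & \near w0, f w0 = g w0) -> Cn m f.
Proof.
elim: m f => [|m IH] f H.
- by move=> w; have [g cg fg] := H w; apply: continuous_at_near fg (cg w).
- split.
  + by move=> w; have [g [cg _ _] fg] := H w; apply: continuous_at_near fg (cg w).
  + move=> w i; have [g [_ dg _] fg] := H w.
    have gf : {near w, g =1 f} by apply: filterS fg => v ->.
    exact: near_eq_derivable gf (dg w i).
  + move=> i; apply: IH => w; have [g /CnS[_ _ cg] fg] := H w.
    by exists (pd i g); [exact: cg|exact: pd_near].
Qed.

Lemma Cn_cst m a (W : normedModType R) (c : W) : Cn m (fun _ : 'rV[R]_a => c).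
Proof.
elim: m c => [|m IH] c.
  exact: cst_continuous.
apply: CnSI => [|w i|i].
- exact: cst_continuous.
- exact: derivable_cst.
- rewrite (_ : pd i _ = fun=> 0); first by apply: IH.
  by apply/funext => w; exact: derive_cst.
Qed.

Lemma CnD m a (W : normedModType R) (f g : 'rV[R]_a -> W) :
  Cn m f -> Cn m g -> Cn m (fun w => f w + g w).
Proof.
elim: m f g => [|m IH] f g.
  by exact: continuous_add.
move=> Cf1 Cg1; have /CnS[cf df Cf] := Cf1; have /CnS[cg dg Cg] := Cg1; apply: CnSI => [|w i|i].
- exact: continuous_add.
- exact: derivableD.
- rewrite (_ : pd i _ = fun w => pd i f w + pd i g w); first by apply: IH.
  by apply/funext => w; exact: deriveD.
Qed.

(** With derivability in the single direction [v], continuity of [g] is known along the line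
    [h *: v + w] only, which is where the usual splitting of the difference quotient uses it. *)
Lemma pdZ a (W : normedModType R) (f : 'rV[R]_a -> R) (g : 'rV[R]_a -> W) w v :
  derivable f w v -> derivable g w v -> 
  is_derive w v (fun w => f w *: g w) ('D_v f w *: g w + f w *: 'D_v g w).
Proof.
move=> df dg.
have /derivable1P dg1 := dg.
have cg : {for 0, continuous (fun h : R => g (h *: v + w))}.
  exact/differentiable_continuous/derivable1_diffP.
suff H : h^-1 *: (((fun w => f w *: g w) \o shift w) (h *: v) - f w *: g w) @[h --> 0^'] -->
   'D_v f w *: g w + f w *: 'D_v g w.
  by apply: DeriveDef; [apply/cvg_ex; eexists; exact: H | exact: cvg_lim H].
have -> : (fun h : R => h^-1 *: (((fun w => f w *: g w) \o shift w) (h *: v) - f w *: g w)) =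
   (fun h => (h^-1 *: ((f \o shift w) (h *: v) - f w) : R) *: g (h *: v + w)) +
   (fun h => f w *: (h^-1 *: ((g \o shift w) (h *: v) - g w))).
  apply/funext => h; rewrite !fctE /=.
  set A := f _; set G := g _; rewrite -[h^-1 *: (A - _)]/(h^-1 * (A - _)) -scalerA.
  rewrite [f w *: (_ *: _)]scalerA [f w * _]mulrC -scalerA -scalerDr.
  by congr (_ *: _); rewrite scalerBl [f w *: (_ - _)]scalerBr addrA subrK.
apply: cvgD.
- apply: cvgZ; first exact: df.
  rewrite -[X in _ --> X](_ : g (0 *: v + w) = g w); last by rewrite scale0r add0r.
  apply: cvg_trans cg; apply: cvg_app; exact: nbhs_dnbhs.
- by apply: cvgZ; [exact: cvg_cst|exact: dg].
Qed.

Lemma CnZ m a (W : normedModType R) (f : 'rV[R]_a -> R) (g : 'rV[R]_a -> W) :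
  Cn m f -> Cn m g -> Cn m (fun w => f w *: g w).
Proof.
elim: m f g => [|m IH] f g.
  by exact: continuous_scale.
move=> Cf1 Cg1; have /CnS[cf df Cf] := Cf1; have /CnS[cg dg Cg] := Cg1; apply: CnSI => [|w i|i].
- exact: continuous_scale.
- by have [] := pdZ (df w i) (dg w i).
- rewrite (_ : pd i _ = fun w => pd i f w *: g w + f w *: pd i g w).
    by apply: CnD; apply: IH => //; exact: Cn_pred.
  by apply/funext => w; have [] := pdZ (df w i) (dg w i).
Qed.

Lemma CnM m a (f g : 'rV[R]_a -> R) :
  Cn m f -> Cn m g -> Cn m (fun w => f w * g w).
Proof. exact: CnZ. Qed.

Lemma CnN m a (f : 'rV[R]_a -> R) : Cn m f -> Cn m (fun w => - f w).
Proof.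
move=> Cf; rewrite (_ : (fun w => _) = fun w => (-1) * f w); last first.
  by apply/funext => w; rewrite mulN1r.
by apply: CnM => //; exact: Cn_cst.
Qed.

Lemma Cn_sum m a (W : normedModType R) (I : Type) (r : seq I) (P : pred I)
    (F : I -> 'rV[R]_a -> W) :
  (forall i, Cn m (F i)) -> Cn m (fun w => \sum_(i <- r | P i) F i w).
Proof.
move=> CF; elim: r => [|i r IH].
  by apply: (Cn_eq (f := fun=> 0)) => [w|]; [rewrite big_nil|exact: Cn_cst].
apply: (Cn_eq (f := fun w => (if P i then F i w else 0) + \sum_(i <- r | P i) F i w)) => [w|].
  by rewrite big_cons; case: ifP; rewrite ?add0r.
by apply: CnD => //; case: (P i); [exact: CF|exact: Cn_cst].
Qed.

Lemma Cn_prod m a (I : Type) (r : seq I) (P : pred I) (F : I -> 'rV[R]_a -> R) :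
  (forall i, Cn m (F i)) -> Cn m (fun w => \prod_(i <- r | P i) F i w).
Proof.
move=> CF; elim: r => [|i r IH].
  by apply: (Cn_eq (f := fun=> (1 : R))) => [w|]; [rewrite big_nil|exact: Cn_cst].
apply: (Cn_eq (f := fun w => (if P i then F i w else 1) * \prod_(i <- r | P i) F i w)) => [w|].
  by rewrite big_cons; case: ifP; rewrite ?mul1r.
by apply: CnM => //; case: (P i); [exact: CF|exact: Cn_cst].
Qed.

Lemma pd_coord a (j i : 'I_a) (w : 'rV[R]_a) :
  is_derive w (delta_mx 0 i) (fun w : 'rV[R]_a => w 0 j) (i == j)%:R.
Proof.
suff H : h^-1 *: (((fun w : 'rV[R]_a => w 0 j) \o shift w) (h *: delta_mx 0 i) - w 0 j)
     @[h --> 0^'] --> ((i == j)%:R : R).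
  by apply: DeriveDef; [apply/cvg_ex; eexists; exact: H | exact: cvg_lim H].
set G := fun h : R => _.
have E : {near 0^', cst ((i == j)%:R : R) =1 G}.
  near=> h; rewrite /G /= !mxE eqxx /= addrK eq_sym.
  rewrite [_ *: _]mulrA mulVf ?mul1r//; near: h; exact: nbhs_dnbhs_neq.
by apply: cvg_trans (near_eq_cvg E) _; exact: cvg_cst.
Unshelve. all: by end_near. Qed.

Lemma Cn_coord m a (j : 'I_a) : Cn m (fun w : 'rV[R]_a => w 0 j).
Proof.
case: m => [|m]; first exact: coord_continuous.
apply: CnSI; first exact: coord_continuous.
- by move=> w i; have [] := pd_coord j i w.
- move=> i; apply: (Cn_eq (f := fun=> ((i == j)%:R : R))) => [w|]; last exact: Cn_cst.
  by have [] := pd_coord j i w.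
Qed.

Lemma pd_comp a (phi : R -> R) (f : 'rV[R]_a -> R) w v :
  derivable f w v -> derivable phi (f w) 1 ->
  is_derive w v (fun w => phi (f w)) (derive1 phi (f w) * 'D_v f w).
Proof.
move=> df dphi.
have /derivable1P df1 := df.
have E0 : 0 *: v + w = w by rewrite scale0r add0r.
have [d1 d2] : is_derive (0 : R) 1 (fun h : R => f (h *: v + w)) ('D_v f w).
  by rewrite -{2}E0; apply: is_derive_line; rewrite E0.
have D2 : is_derive (f (0 *: v + w)) 1 phi (derive1 phi (f w)).
  by rewrite E0; apply: DeriveDef => //; rewrite derive1E.
have [D1 D1E] := is_derive1_comp D2 (DeriveDef d1 d2).
have dd : derivable (fun w => phi (f w)) w v by apply/derivable1P; exact: D1.
apply: DeriveDef => //; rewrite -D1E.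
have [_ <- //] : is_derive (0 : R) 1 (fun h : R => phi (f (h *: v + w))) ('D_v (fun w => phi (f w)) w).
by rewrite -{2}E0; apply: (is_derive_line (f := fun w => phi (f w))); rewrite E0.
Qed.

Lemma Cn_rowP m a p (F : 'rV[R]_a -> 'rV[R]_p) :
  Cn m F <-> forall j, Cn m (fun w => F w 0 j).
Proof.
elim: m F => [|m IH] F; first exact: continuous_rowP.
have derP : (forall w i, derivable F w (delta_mx 0 i)) <->
    forall j w i, derivable (fun w => F w 0 j) w (delta_mx 0 i).
  split=> [dF j w i|dF w i]; first exact: (derivable_mxP _ _ _).1 (dF w i) 0 j.
  by apply/derivable_mxP => i' j; rewrite ord1; exact: dF.
split.
- move=> /CnS[/continuous_rowP cF dF CF] j; apply: CnSI => //; first exact: derP.1.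
  move=> i; have /IH/(_ j) := CF i.
  by congr (Cn _ _); apply/funext => w; rewrite derive_mx// mxE.
- move=> H; have dF : forall w i, derivable F w (delta_mx 0 i).
    by apply/derP => j; have [] := H j.
  apply: CnSI => //; first by apply/continuous_rowP => j; have [] := H j.
  move=> i; apply/IH => j; have /CnS[_ _ /(_ i)] := H j.
  by congr (Cn _ _); apply/funext => w; rewrite derive_mx// mxE.
Qed.

Lemma partial_row m a p (F : 'rV[R]_a -> 'rV[R]_p) mu w j :
  Cn m F -> (size mu <= m)%N -> partial mu F w 0 j = partial mu (fun w => F w 0 j) w.
Proof.
elim: m mu F => [|m IH] mu F; case: (lastP mu) => [|mu' i]; rewrite ?size_rcons //.
rewrite !partial_rcons ltnS => /CnS[_ dF CF] smu; rewrite IH//.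
by congr (partial _ _ _); apply/funext => v; rewrite derive_mx// mxE.
Qed.

Lemma partialD m a (W : normedModType R) (f g : 'rV[R]_a -> W) mu w :
  Cn m f -> Cn m g -> (size mu <= m)%N ->
  partial mu (fun w => f w + g w) w = partial mu f w + partial mu g w.
Proof.
elim: m mu f g => [|m IH] mu f g; case: (lastP mu) => [|mu' i]; rewrite ?size_rcons //.
rewrite !partial_rcons ltnS => /CnS[_ df Cf] /CnS[_ dg Cg] smu; rewrite -IH//.
by congr (partial _ _ _); apply/funext => v; exact: deriveD.
Qed.

End Cn.

(** * Uniform bounds on boxes *)

Section Boxes.
Context {R : realType}.

(** Merges finitely many constants into one. Where a common positive lower bound is wanted, it is
    applied to the inverses; this explains the recurring [K^-1]. *)
Lemma finite_upper_bound (I : finType) (P : I -> R -> Prop) :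
  (forall i x y, x <= y -> P i x -> P i y) -> (forall i, exists x, P i x) ->
  exists2 x, 0 < x & forall i, P i x.
Proof.
move=> Pmono /choice[f Pf]; exists (1 + \sum_i `|f i|).
  by rewrite ltr_pwDl// sumr_ge0.
move=> i; apply: Pmono (Pf i).
rewrite (le_trans (ler_norm _))// (bigD1 i)//= addrCA lerDl.
by rewrite addr_ge0// sumr_ge0.
Qed.

Lemma compact_box a (b : R) : compact [set v : 'rV[R]_a | `|v| <= b].
Proof.
apply: bounded_closed_compact.
  exists b; split; first exact: num_real.
  by move=> x bx v /= vb; apply: le_trans vb (ltW bx).
rewrite (_ : [set _ | _] = (fun v : 'rV[R]_a => `|v|) @^-1` [set x | x <= b])//.
apply: closed_comp => [v _|]; last exact: closed_le.
exact: norm_continuous.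
Qed.

Lemma continuous_box_bound a (W : normedModType R) (f : 'rV[R]_a -> W) (b : R) :
  continuous f -> exists2 K, 0 < K & forall v, `|v| <= b -> `|f v| <= K.
Proof.
move=> cf.
have : compact (f @` [set v : 'rV[R]_a | `|v| <= b]).
  by apply: continuous_compact; [exact: continuous_subspaceT|exact: compact_box].
move=> /compact_bounded/ex_strict_bound_gt0[K K0 H].
by exists K => // v vb; apply/ltW/H; exists v.
Qed.

Lemma continuous_box_min a (f : 'rV[R]_a -> R) (b : R) :
  continuous f -> (forall v, 0 < f v) -> exists2 t, 0 < t & forall v, `|v| <= b -> t <= f v.
Proof.
move=> cf f0; have [b0|b0] := ltP b 0.
  by exists 1 => // v /(le_trans (normr_ge0 _)); rewrite leNgt b0.
have [|||c _ H] := @EVT_min_rV R a f [set v | `|v| <= b].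
- by exists 0; rewrite /= normr0.
- exact: compact_box.
- exact: continuous_subspaceT.
by exists (f c) => // v vb; apply: H; rewrite inE.
Qed.

Lemma Cn_box_bound m a (W : normedModType R) (f : 'rV[R]_a -> W) (b : R) :
  Cn m f -> exists2 K, 0 < K & forall mu v, (size mu <= m)%N -> `|v| <= b -> `|partial mu f v| <= K.
Proof.
elim: m f => [|m IH] f Cf.
  have [K K0 H] := continuous_box_bound b Cf.
  by exists K => // -[|//] v _; exact: H.
have [K0 K00 H0] := continuous_box_bound b (Cn_continuous Cf).
have /CnS[_ _ Cdf] := Cf.
have [|i|K1 K10 H1] := @finite_upper_bound 'I_a (fun i K => forall mu v,
    (size mu <= m)%N -> `|v| <= b -> `|partial mu (pd i f) v| <= K).
- by move=> i x y xy H mu v smu vb; apply: le_trans xy; exact: H.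
- by have [K _ H] := IH _ (Cdf i); exists K.
exists (K0 + K1) => [|mu v]; first exact: addr_gt0.
case: (lastP mu) => [|mu' i]; rewrite ?size_rcons ?partial_rcons => smu vb.
  by apply: le_trans (H0 _ vb) _; rewrite lerDl ltW.
by apply: le_trans (H1 i mu' v smu vb) _; rewrite lerDr ltW.
Qed.

Lemma Cn1_box_lipschitz a (f : 'rV[R]_a -> R) (b : R) :
  Cn 1 f -> exists2 K, 0 < K & forall w w', `|w| <= b -> `|w'| <= b ->
    `|f w' - f w| <= K * `|w' - w|.
Proof.
move=> Cf; have /CnS[_ df _] := Cf.
have [K K0 H] := Cn_box_bound b Cf.
exists (K * a.+1%:R) => [|w w' wb w'b]; first by rewrite mulr_gt0.
have dfb v i : `|v| <= b -> `|pd i f v| <= K by move=> vb; exact: (H [:: i]).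
apply: le_trans (lipschitz_box df dfb wb w'b) _.
rewrite -mulrA ler_wpM2l ?(ltW K0)// (@le_trans _ _ (\sum_(i < a) `|w' - w|))//.
  by apply: ler_sum => i _; have := norm_entry_le (w' - w) i; rewrite !mxE.
by rewrite sumr_const card_ord -[_ *+ a]mulr_natl ler_wpM2r// ler_nat.
Qed.

(** A quantitative Leibniz rule, by induction on the order: the first derivative falls on [chi] or
    on [v]. [K] is fixed before [v] and [eta], so that the size of a perturbation can be chosen
    after its cutoff. *)
Lemma partialM_box_bound m a (chi : 'rV[R]_a -> R) (b : R) :
  Cn m chi -> exists2 K, 0 < K & forall (W : normedModType R) (v : 'rV[R]_a -> W) eta, Cn m v ->
    (forall mu w, (size mu <= m)%N -> `|w| <= b -> `|partial mu v w| <= eta) ->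
    forall mu w, (size mu <= m)%N -> `|w| <= b -> `|partial mu (fun w => chi w *: v w) w| <= K * eta.
Proof.
elim: m chi => [|m IH] chi Cchi.
  have [K K0 H] := continuous_box_bound b Cchi; exists K => // W v eta Cv vb [|//] w _ wb.
  rewrite /= normrZ ler_pM//; first exact: H.
  exact: (vb [::]).
have [K0 K00 H0] := continuous_box_bound b (Cn_continuous Cchi).
have [K1 K10 H1] := IH _ (Cn_pred Cchi).
have /CnS[_ dchi Cdchi] := Cchi.
have [|i|K2 K20 H2] := @finite_upper_bound 'I_a (fun i K => forall (W : normedModType R)
    (v : 'rV[R]_a -> W) eta, Cn m v ->
    (forall mu w, (size mu <= m)%N -> `|w| <= b -> `|partial mu v w| <= eta) ->
    forall mu w, (size mu <= m)%N -> `|w| <= b ->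
      `|partial mu (fun w => pd i chi w *: v w) w| <= K * eta).
- move=> i x y xy H W v eta Cv vb mu w smu wb.
  apply: le_trans (H W v eta Cv vb mu w smu wb) _; rewrite ler_wpM2r//.
  exact: le_trans (normr_ge0 _) (vb [::] w isT wb).
- by have [K _ H] := IH _ (Cdchi i); exists K.
exists (K0 + K1 + K2) => [|W v eta Cv vb mu w]; first by rewrite !addr_gt0.
have /CnS[_ dv Cdv] := Cv.
case: (lastP mu) => [|mu' i]; rewrite ?size_rcons ?partial_rcons => smu wb.
  have eta0 : 0 <= eta by exact: le_trans (normr_ge0 _) (vb [::] w isT wb).
  rewrite /= normrZ (@le_trans _ _ (K0 * eta))// ?ler_wpM2r//.
    by rewrite ler_pM//; [exact: H0|exact: (vb [::])].
  by rewrite -addrA lerDl addr_ge0// ltW.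
have -> : pd i (fun w => chi w *: v w) = fun w => pd i chi w *: v w + chi w *: pd i v w.
  by apply/funext => x; have [] := pdZ (dchi x i) (dv x i).
rewrite (partialD w _ _ smu); first last.
- by apply: CnZ; [exact: Cn_pred|exact: Cdv].
- by apply: CnZ; [exact: Cdchi|exact: Cn_pred].
have eta0 : 0 <= eta by exact: le_trans (normr_ge0 _) (vb [::] w isT wb).
rewrite (le_trans (ler_normD _ _))// (@le_trans _ _ (K2 * eta + K1 * eta))//.
  rewrite lerD//.
    by apply: H2 => //; [exact: Cn_pred|move=> nu x /leqW; exact: vb].
  apply: H1 => // nu x snu xb; rewrite -partial_rcons; apply: vb => //.
  by rewrite size_rcons.
by rewrite -mulrDl ler_wpM2r// addrC -addrA lerDr ltW.
Qed.

End Boxes.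

(** * Cutoff functions *)

Section Bumps.
Context {R : realType}.

(** The classical flat function times the power [t ^- n]: with these factors the family is closed
    under differentiation up to linear combinations, as an induction along [Cn] requires. *)
Definition flat_exp (n : nat) (t : R) : R :=
  if 0 < t then t^-1 ^+ n * expR (- t^-1) else 0.

Lemma flat_exp_le0 n t : t <= 0 -> flat_exp n t = 0.
Proof. by rewrite /flat_exp ltNge => ->. Qed.

Lemma flat_exp_ge0 n t : 0 <= flat_exp n t.
Proof.
rewrite /flat_exp; case: ifP => // t0.
by rewrite mulr_ge0 ?expR_ge0// exprn_ge0// invr_ge0 ltW.
Qed.

Lemma flat_exp_bound n t : flat_exp n t <= n.+1`!%:R * `|t|.
Proof.
rewrite /flat_exp; case: ifPn => [t0|_]; last by rewrite mulr_ge0.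
rewrite gtr0_norm// expRN ler_pdivrMr ?expR_gt0//.
have it0 : 0 < t^-1 by rewrite invr_gt0.
have f0 : 0 < n.+1`!%:R :> R by rewrite ltr0n fact_gt0.
have := expR_ge1Dxn n (ltW it0).
rewrite -(@ler_pM2l _ (n.+1`!%:R * t)) ?mulr_gt0//; apply: le_trans.
rewrite mulrDr mulr1 exprS ler_wpDl ?mulr_ge0 ?(ltW t0)//.
rewrite le_eqVlt; apply/orP; left; apply/eqP; field.
by rewrite !gt_eqF.
Qed.

Lemma is_derive_flat_exp n (t : R) :
  is_derive t 1 (flat_exp n) (flat_exp n.+2 t - n%:R * flat_exp n.+1 t).
Proof.
have [t0|t0|->] := ltgtP t 0.
- rewrite !flat_exp_le0 ?ltW// mulr0 subr0.
  apply: (near_eq_is_derive (f := cst (0 : R))).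
  near=> s; rewrite flat_exp_le0//; apply: ltW; near: s; exact: lt_nbhsl.
- apply: (near_eq_is_derive (f := (fun t : R => t^-1) ^+ n * (expR \o - (fun t : R => t^-1)))).
    near=> s; rewrite /flat_exp ifT; first by rewrite !fctE.
    near: s; exact: lt_nbhsr.
  have t1 : t != 0 by rewrite gt_eqF.
  have dinv : is_derive t 1 (fun t : R => t^-1) (- t ^- 2).
    have [d1 d2] : is_derive t 1 (id : R -> R) 1 by exact: is_derive_id.
    by apply: DeriveDef; [exact: derivableV|rewrite deriveV// d2 [_ *: _]mulr1].
  have dexp := @is_derive1_comp R expR (- (fun t : R => t^-1)) t _ _ (is_derive_expR _) (is_deriveN dinv).
  apply: is_derive_eq (is_deriveM (is_deriveX n dinv) dexp) _.
  rewrite /flat_exp t0 fctE /= !fctE /=; set E := expR _.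
  have -> (x y : R) : x *: y = x * y by [].
  have -> (x y : R) : x *: y = x * y by [].
  have -> (x y : R) : x *: y = x * y by [].
  rewrite opprK -exprVn; case: n => [|n] /=; rewrite ?exprS; ring.
- rewrite !flat_exp_le0// mulr0 subr0.
  suff H : h^-1 *: ((flat_exp n \o shift 0) (h *: 1) - flat_exp n 0) @[h --> 0^'] --> (0 : R).
    by apply: DeriveDef; [apply/cvg_ex; eexists; exact: H | exact: cvg_lim H].
  apply/cvgr0Pnorm_le => e e0; near=> h.
  rewrite /= addr0 (flat_exp_le0 n (lexx 0)) subr0.
  (* At 0 the difference quotient is the next member of the family, to which the linear bound
     applies again. *)
  have -> : h^-1 *: flat_exp n (h *: 1) = flat_exp n.+1 h.
    rewrite [h *: 1]mulr1 /flat_exp; case: ifP => _; last by rewrite scaler0.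
    by rewrite exprS [_ *: _]mulrA.
  rewrite ger0_norm ?flat_exp_ge0// (le_trans (flat_exp_bound _ _))//.
  have f0 : 0 < n.+2`!%:R :> R by rewrite ltr0n fact_gt0.
  rewrite mulrC -ler_pdivlMr//; near: h; apply: dnbhs0_le.
  by rewrite divr_gt0.
Unshelve. all: by end_near. Qed.

Lemma Cn_flat_exp m n a (f : 'rV[R]_a -> R) : Cn m f -> Cn m (fun w => flat_exp n (f w)).
Proof.
have cont k : continuous (flat_exp k).
  move=> t; apply/differentiable_continuous/derivable1_diffP.
  by have [] := is_derive_flat_exp k t.
elim: m n f => [|m IH] n f Cf; first exact: continuous_composite.
have /CnS[cf df Cdf] := Cf.
have dfe w i := pd_comp (df w i) (@ex_derive _ _ _ _ _ _ _ (is_derive_flat_exp n (f w))).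
apply: CnSI.
- exact: continuous_composite.
- by move=> w i; have [] := dfe w i.
- move=> i; apply: (Cn_eq (f := fun w => (flat_exp n.+2 (f w) + - (n%:R * flat_exp n.+1 (f w))) * pd i f w)).
    move=> w; have [_ ->] := dfe w i.
    by rewrite derive1E (@derive_val _ _ _ _ _ _ _ (is_derive_flat_exp n (f w))).
  apply: CnM (Cdf i); apply: CnD; first by apply: IH; exact: Cn_pred.
  by apply/CnN/CnM; [exact: Cn_cst|apply: IH; exact: Cn_pred].
Qed.

(** The inner argument is a positive constant for [t <= 0] and nonpositive for [t >= 1], so the
    outer flat function switches off smoothly. Nesting keeps the denominator constant. *)
Definition step (t : R) : R := flat_exp 0 (flat_exp 0 1 - flat_exp 0 t) / flat_exp 0 (flat_exp 0 1).

Lemma flat_exp0_gt0 t : 0 < t -> 0 < flat_exp 0 t.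
Proof. by rewrite /flat_exp => ->; rewrite expr0 mul1r expR_gt0. Qed.

Lemma step_le0 t : t <= 0 -> step t = 1.
Proof.
move=> t0; rewrite /step (flat_exp_le0 _ t0) subr0 divff// gt_eqF//.
by rewrite !flat_exp0_gt0.
Qed.

Lemma step_ge1 t : 1 <= t -> step t = 0.
Proof.
move=> t1; rewrite /step [flat_exp 0 _](_ : _ = 0) ?mul0r// flat_exp_le0// subr_le0.
have t0 : 0 < t by apply: lt_le_trans t1.
rewrite /flat_exp t0 ltr01 !expr0 !mul1r ler_expR lerN2 invr1.
by rewrite invf_le1.
Qed.

Lemma Cn_step m a (f : 'rV[R]_a -> R) : Cn m f -> Cn m (fun w => step (f w)).
Proof.
move=> Cf; rewrite /step; apply: CnM; last exact: Cn_cst.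
apply: Cn_flat_exp; apply: CnD; first exact: Cn_cst.
by apply/CnN/Cn_flat_exp.
Qed.

(** A product over coordinates because the norm is the max norm. [Q] selects the coordinates that
    count: the [x] part for shells, all of them for a bounded support. *)
Definition box_bump a (Q : pred 'I_a) (r : R) (w : 'rV[R]_a) : R :=
  \prod_(j | Q j) (step (w 0 j - r) * step (- w 0 j - r)).

Lemma Cn_box_bump m a (Q : pred 'I_a) r : Cn m (box_bump Q r).
Proof.
apply: Cn_prod => j; apply: CnM; apply: Cn_step; apply: CnD; try exact: Cn_cst.
- exact: Cn_coord.
- exact/CnN/Cn_coord.
Qed.

Lemma box_bump1 a (Q : pred 'I_a) r (w : 'rV[R]_a) :
  (forall j, Q j -> `|w 0 j| <= r) -> box_bump Q r w = 1.
Proof.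
move=> H; rewrite /box_bump big1// => j /H; rewrite ler_norml => /andP[h1 h2].
by rewrite !step_le0 ?mulr1//; lra.
Qed.

Lemma box_bump0 a (Q : pred 'I_a) r (w : 'rV[R]_a) j :
  Q j -> r + 1 <= `|w 0 j| -> box_bump Q r w = 0.
Proof.
move=> Qj H; rewrite /box_bump (bigD1 j)//=.
suff -> : step (w 0 j - r) * step (- w 0 j - r) = 0 by rewrite mul0r.
have [wj|wj] := leP 0 (w 0 j).
  by rewrite ger0_norm// in H; rewrite step_ge1 ?mul0r//; lra.
by rewrite ltr0_norm// in H; rewrite [X in _ * X]step_ge1 ?mulr0//; lra.
Qed.

End Bumps.

(** * Generic affine perturbations *)

Section Pigeonhole.
Context {R : realType}.

Lemma truncn_close (y y' d : R) : 0 < d -> 0 <= y -> 0 <= y' ->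
  Num.truncn (y / d) = Num.truncn (y' / d) -> `|y - y'| <= d.
Proof.
move=> d0 y0 y'0 E.
have /andP[] := truncn_itv (divr_ge0 y0 (ltW d0)); have /andP[] := truncn_itv (divr_ge0 y'0 (ltW d0)).
rewrite -E !ler_pdivlMr// !ltr_pdivrMr// -natr1 mulrDl mul1r => h1 h2 h3 h4.
by rewrite ler_norml; apply/andP; split; lra.
Qed.

(* A code has as many coordinates as [M] and one of them is constant, so among the [N ^ #|J|]
   points of a grid of mesh [rho / N] only [O(N ^ (#|J| - 1))] can be solved. *)
Lemma pigeonhole_parameter (J F : finType) (j0 : F -> J)
    (C : F -> (J -> R) -> (J -> R) -> Prop) (b K rho : R) : 0 < rho ->
  (forall f Y Y' M M' d, 0 <= d -> C f Y M -> C f Y' M' ->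
     (forall j, `|Y j - Y' j| <= d) -> forall j, `|M j - M' j| <= K * d) ->
  (forall f Y M, C f Y M -> Y (j0 f) = 1 /\ forall j, `|Y j| <= b) ->
  exists M, (forall j, `|M j| <= rho) /\ forall f Y, ~ C f Y M.
Proof.
move=> rho0 CK Cb; apply: contrapT => /forallNP H.
have {}H M : (forall j, `|M j| <= rho) -> exists f, exists Y, C f Y M.
  move=> Mrho; apply: contrapT => /forallNP H'; apply: (H M); split => // f Y CY.
  by apply: (H' f); exists Y.
pose K1 := 1 + `|K|; pose b1 := 1 + `|b|.
have K1_gt0 : 0 < K1 by rewrite ltr_pwDl.
have b1_gt0 : 0 < b1 by rewrite ltr_pwDl.
(* Codes, shifted by [b1], range over a length [2 * b1], which is [4 * K1 * b1 / rho * N] cells of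
   length [d], fewer than [A * N]. *)
pose A := (Num.truncn (4 * K1 * b1 / rho)).+1.
have A_gt : 4 * K1 * b1 / rho < A%:R by exact: truncnS_gt.
pose N := (#|F| * A.+1 ^ #|J|).+1.
pose m := (A.+1 * N)%N.
have N0 : 0 < N%:R :> R by rewrite ltr0n.
(* Small enough that codes within [d] force parameters closer than the mesh [rho / N], hence equal
   grid points. *)
pose d := rho / (2 * K1 * N%:R).
have d0 : 0 < d by rewrite divr_gt0// !mulr_gt0.
have Kd : K1 * d < rho / N%:R.
  rewrite /d mulrA ltr_pdivlMr// mulrAC ltr_pdivrMr ?mulr_gt0//.
  rewrite -subr_gt0 (_ : _ - _ = rho * K1 * N%:R); last by ring.
  by rewrite !mulr_gt0.
pose grid (k : {ffun J -> 'I_N}) (j : J) : R := rho * (k j)%:R / N%:R.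
have grid_rho k j : `|grid k j| <= rho.
  rewrite ger0_norm ?divr_ge0 ?mulr_ge0 ?(ltW rho0)//.
  by rewrite ler_pdivrMr// ler_pM2l// ler_nat ltnW.
have /choice[tag /choice[code Hcode]] := fun k => H (grid k) (grid_rho k).
have code_b k j : 0 <= code k j + b1 <= 2 * b1.
  have [_ /(_ j)] := Cb _ _ _ (Hcode k); rewrite ler_norml => /andP[h1 h2].
  by have := ler_norm b; have := ler_norm (- b); rewrite normrN /b1 => h3 h4; apply/andP; split; lra.
have cell_lt k j : (Num.truncn ((code k j + b1) / d) < m)%N.
  have /andP[h1 h2] := code_b k j.
  rewrite -(ltr_nat R); have /andP[h3 _] := truncn_itv (divr_ge0 h1 (ltW d0)).
  apply: le_lt_trans h3 _; rewrite ltr_pdivrMr// (le_lt_trans h2)// /m natrM /d.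
  have : 4 * K1 * b1 < A%:R * rho by rewrite -ltr_pdivrMr.
  have -> : A.+1%:R * N%:R * (rho / (2 * K1 * N%:R)) = A.+1%:R * rho / (2 * K1).
    by field; rewrite !gt_eqF.
  rewrite ltr_pdivlMr ?mulr_gt0// -[A.+1]addn1 natrD; nra.
(* The constant coordinate of the code is overwritten by a free index. The count then compares
   [N ^ #|J| * m] with [#|F| * m ^ #|J|], and no exponent [#|J| - 1] has to be handled. *)
pose cell (ki : {ffun J -> 'I_N} * 'I_m) : F * {ffun J -> 'I_m} :=
  (tag ki.1, [ffun j => if j == j0 (tag ki.1) then ki.2 else Ordinal (cell_lt ki.1 j)]).
have cell_inj : injective cell.
  move=> [k i] [k' i'] [Etag /ffunP E].
  have Ei : i = i' by have := E (j0 (tag k)); rewrite !ffunE eqxx Etag eqxx.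
  rewrite Ei; congr (_, _); apply/ffunP => j.
  have Hk := Hcode k; have Hk' := Hcode k'; rewrite -Etag in Hk'.
  have close l : `|code k l - code k' l| <= d.
    have [->|lj] := eqVneq l (j0 (tag k)).
      by have [-> _] := Cb _ _ _ Hk; have [-> _] := Cb _ _ _ Hk'; rewrite subrr normr0 ltW.
    have := E l; rewrite !ffunE -Etag (negbTE lj) => -[] Ec.
    have /andP[h1 _] := code_b k l; have /andP[h2 _] := code_b k' l.
    by have := truncn_close d0 h1 h2 Ec; rewrite opprD addrACA subrr addr0.
  have := CK _ _ _ _ _ _ (ltW d0) Hk Hk' close j.
  rewrite /grid -mulrBl -mulrBr normrM normfV (gtr0_norm N0) normrM (gtr0_norm rho0) => h.
  have : rho * `|(k j)%:R - (k' j)%:R| / N%:R < rho / N%:R.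
    apply: le_lt_trans h _; apply: le_lt_trans Kd; rewrite ler_wpM2r ?(ltW d0)//.
    by rewrite /K1 (le_trans (ler_norm _))// lerDr.
  rewrite ltr_pM2r ?invr_gt0// gtr_pMr// => {}h.
  apply/val_inj/eqP => /=; rewrite eqn_leq; move: h; rewrite ltr_norml => /andP[h1 h2].
  by apply/andP; split; rewrite -ltnS -(ltr_nat R) -natr1; lra.
have := leq_card cell cell_inj.
rewrite !card_prod !card_ffun !card_ord => le1.
have : (N ^ #|J| * m <= N ^ #|J| * (#|F| * A.+1 ^ #|J|))%N.
  by apply: leq_trans le1 _; rewrite /m expnMn mulnA mulnC.
rewrite leq_pmul2l ?expn_gt0// leqNgt => /negP; apply.
by have : (N <= m)%N by rewrite /m leq_pmull.
Qed.

End Pigeonhole.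

(* An index selects a component of c, of g or of h. *)
Definition idx (s p q : nat) := ('I_s + 'I_p + 'I_q)%type.
Definition cI {s p q : nat} (i : 'I_s) : idx s p q := inl (inl i).
Definition gI {s p q : nat} (i : 'I_p) : idx s p q := inl (inr i).
Definition hI {s p q : nat} (i : 'I_q) : idx s p q := inr i.

(** * Singular points of an affinely perturbed system and their codes *)

Section GenericParameters.
Context {R : realType} {n s p q : nat}.
Local Notation idx := (idx s p q).

Definition kink (x : 'rV[R]_n) (z : 'rV[R]_s) := join3 x (absv z) z.

Definition lipschitz_on_box a (b : R) (f : 'rV[R]_a -> R) :=
  exists2 K : R, 0 <= K & forall w w', `|w| <= b -> `|w'| <= b ->
    `|f w| <= K /\ `|f w - f w'| <= K * `|w - w'|.

Lemma norm_join3_le (x : 'rV[R]_n) (y z : 'rV[R]_s) b :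
  `|x| <= b -> `|y| <= b -> `|z| <= b -> `|join3 x y z| <= b.
Proof.
move=> xb yb zb; apply: norm_rV_le => [|j]; first exact: le_trans (normr_ge0 _) xb.
rewrite /join3 mxE; case: splitP => k _; last exact: le_trans (norm_entry_le _ _) zb.
by rewrite mxE; case: splitP => l _; apply: le_trans (norm_entry_le _ _) _.
Qed.

Lemma norm_absv_le (z : 'rV[R]_s) b : `|z| <= b -> `|absv z| <= b.
Proof.
move=> zb; apply: norm_rV_le => [|j]; first exact: le_trans (normr_ge0 _) zb.
by rewrite mxE normr_id; exact: le_trans (norm_entry_le _ _) zb.
Qed.

Lemma norm_kink_le x z b : `|x| <= b -> `|z| <= b -> `|kink x z| <= b.
Proof. by move=> xb zb; apply: norm_join3_le => //; exact: norm_absv_le. Qed.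

Lemma norm_kinkB_le x z x' z' d : `|x - x'| <= d -> `|z - z'| <= d ->
  `|kink x z - kink x' z'| <= d.
Proof.
move=> xd zd.
rewrite (_ : _ - _ = join3 (x - x') (absv z - absv z') (z - z')).
  apply: norm_join3_le => //; apply: norm_rV_le => [|j]; first exact: le_trans (normr_ge0 _) xd.
  rewrite !mxE (le_trans (ler_dist_dist _ _))//.
  by have := norm_entry_le (z - z') j; rewrite !mxE => /le_trans; apply.
by rewrite /kink /join3 !opp_row_mx !add_row_mx.
Qed.

Context (U : idx -> 'rV[R]_(n + s + s) -> R).
Context (DX : idx -> 'I_n -> 'rV[R]_(n + s + s) -> R).
Context (DY DZ : idx -> 'I_s -> 'rV[R]_(n + s + s) -> R).
Context (b rho : R).
Hypothesis lipU : forall l, lipschitz_on_box b (U l).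
Hypothesis lipDX : forall l j, lipschitz_on_box b (DX l j).
Hypothesis lipDY : forall l i, lipschitz_on_box b (DY l i).
Hypothesis lipDZ : forall l i, lipschitz_on_box b (DZ l i).
Hypothesis triY : forall (i' i : 'I_s) w, ~~ (i < i')%N -> DY (cI i') i w = 0.
Hypothesis triZ : forall (i' i : 'I_s) w, ~~ (i < i')%N -> DZ (cI i') i w = 0.

Let parameter := idx * option 'I_n -> R.

Definition shifted (M : parameter) l (x : 'rV[R]_n) z :=
  U l (kink x z) + (M (l, None) + \sum_j M (l, Some j) * x 0 j).

(** Equations satisfied at a defect of the perturbed system. Affine functions of [x] shift values
    and [x]-derivatives and leave [DY] and [DZ] alone. [DX], [DY], [DZ] are abstract here: Lipschitz
    bounds and triangularity are all that the counting sees of them. *)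
Definition singular_at (x : 'rV[R]_n) (z : 'rV[R]_s) (mu : idx -> R) (M : parameter) :=
  [/\ (forall i, z 0 i = shifted M (cI i) x z) /\
      (forall i, shifted M (hI i) x z = 0),
      forall i, shifted M (gI i) x z * mu (gI i) = 0,
      exists l, mu l != 0,
      forall j, \sum_l mu l * (DX l j (kink x z) + M (l, Some j)) = 0 &
      forall i, z 0 i * mu (cI i) =
        \sum_l (`|z 0 i| * DY l i (kink x z) + z 0 i * DZ l i (kink x z)) * mu l].

(* The zero set of [z], the set where [z] is nonnegative, the active constraints, and the index
   of the multiplier normalised to 1. *)
Let tagT := ({set 'I_s} * {set 'I_s} * {set 'I_p} * idx)%type.

(** The remaining multipliers are determined: those of [c] off the kinks by the adjoint equation,
    those of inactive constraints by complementarity. *)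
Definition free_mult (t : tagT) (l : idx) : bool :=
  match l with
  | inl (inl i) => i \in t.1.1.1
  | inl (inr i) => i \in t.1.2
  | inr _ => true
  end.

Let sgn (t : tagT) i : R := if i \in t.1.1.2 then 1 else -1.

(* [code] lists data that determine [M]: each coefficient that the equations of a singular point
   allow to be computed is traded for an unknown among [x], [z] and [mu]. *)
Definition code (t : tagT) (x : 'rV[R]_n) (z : 'rV[R]_s) (mu : idx -> R) (M : parameter) : parameter :=
  fun j => match j with
  | (l, Some j) => if l == t.2 then x 0 j else M (l, Some j)
  | (inl (inl i), None) => if i \in t.1.1.1 then mu (cI i) else z 0 i
  | (inl (inr i), None) => if i \in t.1.2 then mu (gI i) else M (gI i, None)
  | (inr i, None) => mu (hI i)
  end.

(** A singular point with its combinatorial data frozen in [t]: products that vanish have been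
    decided, and the adjoint equation is divided by [z i], the quotient of [|z i|] by [z i] being
    the fixed sign [sgn t i]. What remains are equations that can be solved in a Lipschitz way. *)
Record witness (t : tagT) (x : 'rV[R]_n) (z : 'rV[R]_s) (mu : idx -> R) (M : parameter) : Prop := Witness {
  wit_x : `|x| <= b;
  wit_z : `|z| <= b;
  wit_M : forall j, `|M j| <= rho;
  wit_pivot : free_mult t t.2;
  wit_pivot1 : mu t.2 = 1;
  wit_le1 : forall l, free_mult t l -> `|mu l| <= 1;
  wit_z0 : forall i, i \in t.1.1.1 -> z 0 i = 0;
  wit_mu : forall i, i \notin t.1.1.1 ->
    mu (cI i) = \sum_l (sgn t i * DY l i (kink x z) + DZ l i (kink x z)) * mu l;
  wit_g0 : forall i, i \notin t.1.2 -> mu (gI i) = 0;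
  wit_c : forall i, z 0 i = shifted M (cI i) x z;
  wit_g : forall i, i \in t.1.2 -> shifted M (gI i) x z = 0;
  wit_h : forall i, shifted M (hI i) x z = 0;
  wit_D : forall j, \sum_l mu l * (DX l j (kink x z) + M (l, Some j)) = 0 }.

Lemma code_Some t x z mu M l j :
  code t x z mu M (l, Some j) = if l == t.2 then x 0 j else M (l, Some j).
Proof. by case: l => [[]|]. Qed.

Lemma code_bound t x z mu M j : witness t x z mu M -> `|code t x z mu M j| <= `|b| + 1 + `|rho|.
Proof.
set K := (X in _ <= X).
have Kb y : `|y| <= b -> `|y| <= K.
  move=> /le_trans; apply; apply: le_trans (ler_norm _) _.
  by rewrite /K -addrA lerDl addr_ge0.
have K1 (y : R) : `|y| <= 1 -> `|y| <= K.
  by move=> /le_trans; apply; rewrite /K addrAC lerDr addr_ge0.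
have Krho y : `|y| <= rho -> `|y| <= K.
  move=> /le_trans; apply; apply: le_trans (ler_norm _) _.
  by rewrite /K lerDr addr_ge0.
have Kx a (y : 'rV[R]_a) i : `|y| <= b -> `|y 0 i| <= K.
  by move=> yb; apply: Kb; exact: le_trans (norm_entry_le _ _) yb.
case=> xb zb Mrho _ _ le1 _ _ _ _ _ _ _; rewrite /code.
case: j => -[[i|i]|i] [k|].
- by case: ifP => _; [exact: Kx|exact: Krho].
- by case: ifP => H; [apply: K1; exact: le1|exact: Kx].
- by case: ifP => _; [exact: Kx|exact: Krho].
- by case: ifP => H; [apply: K1; exact: le1|exact: Krho].
- by case: ifP => _; [exact: Kx|exact: Krho].
- by apply: K1; exact: le1.
Qed.

Section Lipschitz.
Context (t : tagT).

Let config := ('rV[R]_n * 'rV[R]_s * (idx -> R) * parameter)%type.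
Let wit (e : config) := witness t e.1.1.1 e.1.1.2 e.1.2 e.2.
Let cod (e : config) := code t e.1.1.1 e.1.1.2 e.1.2 e.2.
Let near_config (e e' : config) (d : R) :=
  [/\ 0 <= d, wit e, wit e' & forall j, `|cod e j - cod e' j| <= d].

(** Says that [u] is a bounded Lipschitz function of the code, in relational form, since a code is
    not known beforehand to determine its configuration. Such [u] form an algebra, so it is enough
    to express each unknown through those already recovered. *)
Let lip (u : config -> R) := exists2 K : R, 0 <= K &
  forall e e' d, near_config e e' d -> [/\ `|u e| <= K, `|u e'| <= K & `|u e - u e'| <= K * d].

Let lip_eq u v : (forall e, wit e -> u e = v e) -> lip u -> lip v.
Proof.
move=> uv [K K0 H]; exists K => // e e' d eed; have [_ we we' _] := eed.
by rewrite -!uv//; exact: H.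
Qed.

Let lip_cst k : lip (fun=> k).
Proof. by exists `|k| => // e e' d [d0 _ _ _]; rewrite subrr normr0 mulr_ge0. Qed.

Let lip_add u v : lip u -> lip v -> lip (fun e => u e + v e).
Proof.
move=> [K K0 H] [K' K'0 H']; exists (K + K') => [|e e' d eed]; first exact: addr_ge0.
have [h1 h2 h3] := H _ _ _ eed; have [h1' h2' h3'] := H' _ _ _ eed; split.
- by rewrite (le_trans (ler_normD _ _))// lerD.
- by rewrite (le_trans (ler_normD _ _))// lerD.
- by rewrite opprD addrACA mulrDl (le_trans (ler_normD _ _))// lerD.
Qed.

Let lip_mul u v : lip u -> lip v -> lip (fun e => u e * v e).
Proof.
move=> [K K0 H] [K' K'0 H']; exists (K * K' + K * K') => [|e e' d eed].
  by rewrite addr_ge0// mulr_ge0.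
have [h1 h2 h3] := H _ _ _ eed; have [h1' h2' h3'] := H' _ _ _ eed.
have KK : 0 <= K * K' by exact: mulr_ge0.
split.
- by rewrite normrM (@le_trans _ _ (K * K')) ?lerDl// ler_pM.
- by rewrite normrM (@le_trans _ _ (K * K')) ?lerDl// ler_pM.
- have -> : u e * v e - u e' * v e' = u e * (v e - v e') + (u e - u e') * v e' by ring.
  rewrite (le_trans (ler_normD _ _))// [leRHS]mulrDl lerD// normrM.
    by rewrite -mulrA ler_pM.
  by rewrite [K * K' * d]mulrAC ler_pM.
Qed.

Let lip_opp u : lip u -> lip (fun e => - u e).
Proof.
move=> lu; apply: lip_eq (lip_mul (lip_cst (-1)) lu) => e _; exact: mulN1r.
Qed.

Let lip_sum (I : finType) (P : pred I) (u : I -> config -> R) :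
  (forall i, P i -> lip (u i)) -> lip (fun e => \sum_(i | P i) u i e).
Proof.
move=> Lu; rewrite (_ : (fun e => _) = fun e => \sum_(i <- index_enum I) (if P i then u i e else 0)).
  elim: (index_enum I) => [|i r IH].
    by apply: lip_eq (lip_cst 0) => e _; rewrite big_nil.
  apply: (lip_eq (u := fun e => (if P i then u i e else 0) + \sum_(i <- r) (if P i then u i e else 0))).
    by move=> e _; rewrite big_cons.
  apply: lip_add IH; case Pi : (P i); first exact: Lu.
  exact: lip_cst.
by apply/funext => e; rewrite big_mkcond.
Qed.

Let lip_cod j : lip (fun e => cod e j).
Proof.
pose K := `|b| + 1 + `|rho|.
have K0 : 0 <= K by rewrite !addr_ge0.
have bnd e (we : wit e) : `|cod e j| <= K := code_bound j we.
exists (K + 1) => [|e e' d [d0 we we' H]]; first exact: addr_ge0.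
split; try by rewrite (le_trans (bnd _ _))// lerDl.
by apply: le_trans (H j) _; rewrite mulrDl mul1r lerDr mulr_ge0.
Qed.

Let lip_x j : lip (fun e => e.1.1.1 0 j).
Proof. by apply: lip_eq (lip_cod (t.2, Some j)) => e _; rewrite /cod code_Some eqxx. Qed.

Let lip_z i : lip (fun e => e.1.1.2 0 i).
Proof.
case it : (i \in t.1.1.1).
  by apply: lip_eq (lip_cst 0) => e /wit_z0 ->.
by apply: lip_eq (lip_cod (cI i, None)) => e _; rewrite /cod /code /= it.
Qed.

Let lip_kink f : lipschitz_on_box b f -> lip (fun e => f (kink e.1.1.1 e.1.1.2)).
Proof.
move=> [K K0 Hf].
have [Kx Kx0 Hx] := finite_upper_bound (P := fun j K => forall e e' d, near_config e e' d ->
  `|e.1.1.1 0 j - e'.1.1.1 0 j| <= K * d)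
  (fun j x y xy H e e' d eed => le_trans (H e e' d eed)
     (ler_wpM2r (let: And4 d0 _ _ _ := eed in d0) xy))
  (fun j => let: ex_intro2 K _ H := lip_x j in
     ex_intro _ K (fun e e' d eed => let: And3 _ _ h := H e e' d eed in h)).
have [Kz Kz0 Hz] := finite_upper_bound (P := fun j K => forall e e' d, near_config e e' d ->
  `|e.1.1.2 0 j - e'.1.1.2 0 j| <= K * d)
  (fun j x y xy H e e' d eed => le_trans (H e e' d eed)
     (ler_wpM2r (let: And4 d0 _ _ _ := eed in d0) xy))
  (fun j => let: ex_intro2 K _ H := lip_z j in
     ex_intro _ K (fun e e' d eed => let: And3 _ _ h := H e e' d eed in h)).
exists (K + K * (Kx + Kz)) => [|e e' d eed].
  by rewrite addr_ge0// mulr_ge0// addr_ge0// ltW.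
have [d0 we we' _] := eed.
have kb e0 : wit e0 -> `|kink e0.1.1.1 e0.1.1.2| <= b.
  by move=> w0; apply: norm_kink_le; [exact: wit_x w0|exact: wit_z w0].
have KK : 0 <= K * (Kx + Kz) by rewrite mulr_ge0// addr_ge0// ltW.
have [h1 h3] := Hf _ _ (kb _ we) (kb _ we').
have [h2 _] := Hf _ _ (kb _ we') (kb _ we).
split; try by apply: le_trans (_ : K <= _) => //; rewrite lerDl.
apply: le_trans h3 _; rewrite mulrDl ler_wpDl ?mulr_ge0// -mulrA ler_wpM2l//.
apply: norm_kinkB_le; apply: norm_rV_le; rewrite ?mulr_ge0 ?addr_ge0 ?(ltW Kx0) ?(ltW Kz0)//.
- move=> j; rewrite !mxE (le_trans (Hx j _ _ _ eed))// ler_wpM2r// lerDl ltW//.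
- move=> j; rewrite !mxE (le_trans (Hz j _ _ _ eed))// ler_wpM2r// lerDr ltW//.
Qed.

(** Free multipliers are read off the code. Off the kinks the adjoint equation for index [i]
    involves, among the components of [c], only those with larger index, by [triY] and [triZ]; hence
    an induction on [s - i]. *)
Let lip_mu l : lip (fun e => e.1.2 l).
Proof.
have [m] := ubnP (if l is inl (inl i) then (s - i)%N else 0%N).
elim: m l => // m IH [[i|i]|i]; last 2 first.
- move=> _; case it : (i \in t.1.2).
    by apply: lip_eq (lip_cod (gI i, None)) => e _; rewrite /cod /code /= it.
  by apply: lip_eq (lip_cst 0) => e /wit_g0 ->; rewrite ?it.
- by move=> _; apply: lip_eq (lip_cod (hI i, None)).
rewrite ltnS => im; case it : (i \in t.1.1.1).
  by apply: lip_eq (lip_cod (cI i, None)) => e _; rewrite /cod /code /= it.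
pose later (l : idx) := if l is inl (inl i') then (i < i')%N else true.
apply: (lip_eq (u := fun e => \sum_(l | later l)
    (sgn t i * DY l i (kink e.1.1.1 e.1.1.2) + DZ l i (kink e.1.1.1 e.1.1.2)) * e.1.2 l)).
  move=> e /wit_mu ->; last by rewrite it.
  rewrite [RHS](bigID later)/= [X in _ + X]big1 ?addr0// => -[[i'|i']|i'] //= ii'.
  by rewrite triY// triZ// mulr0 addr0 mul0r.
apply: lip_sum => l lat; apply: lip_mul.
  apply: lip_add; first by apply: lip_mul; [exact: lip_cst|exact: lip_kink].
  exact: lip_kink.
apply: IH; case: l lat => [[i'|i']|i'] /= lat; rewrite ?(leq_trans _ im)//;
  try by rewrite subn_gt0.
by apply: ltn_sub2l.
Qed.

Let lip_M_other l j : l != t.2 -> lip (fun e => e.2 (l, Some j)).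
Proof.
by move=> /negbTE lt; apply: lip_eq (lip_cod (l, Some j)) => e _; rewrite /cod code_Some lt.
Qed.

(** The code stores [x] in place of the slopes of the pivot component. Since its multiplier is 1,
    stationarity gives these slopes without a division. *)
Let lip_M_Some l j : lip (fun e => e.2 (l, Some j)).
Proof.
have [->|] := eqVneq l t.2; last exact: lip_M_other.
apply: (lip_eq (u := fun e => - (DX t.2 j (kink e.1.1.1 e.1.1.2) +
   \sum_(l | l != t.2) e.1.2 l * (DX l j (kink e.1.1.1 e.1.1.2) + e.2 (l, Some j))))).
  move=> e we; have := wit_D we j; rewrite (bigD1 t.2)//= (wit_pivot1 we) mul1r.
  by move=> /eqP; rewrite addrAC addr_eq0 => /eqP ->; rewrite opprK.
apply: lip_opp; apply: lip_add; first exact: lip_kink.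
apply: lip_sum => l' lt; apply: lip_mul; first exact: lip_mu.
by apply: lip_add; [exact: lip_kink|exact: lip_M_other].
Qed.

Let lip_linear l : lip (fun e => \sum_j e.2 (l, Some j) * e.1.1.1 0 j).
Proof.
by apply: lip_sum => j _; apply: lip_mul; [exact: lip_M_Some|exact: lip_x].
Qed.

(** The constant coefficients come last: each is a prescribed value ([z i] for [c], 0 for [h] and
    for active constraints) minus terms already recovered. *)
Let lip_M j : lip (fun e => e.2 j).
Proof.
case: j => l [j|]; first exact: lip_M_Some.
have main v : lip v -> (forall e, wit e -> v e = shifted e.2 l e.1.1.1 e.1.1.2) ->
    lip (fun e => e.2 (l, None)).
  move=> Lv Hv.
  apply: (lip_eq (u := fun e => v e + (- U l (kink e.1.1.1 e.1.1.2) + - \sum_j e.2 (l, Some j) * e.1.1.1 0 j))).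
    by move=> e we; rewrite Hv// /shifted; ring.
  apply: lip_add => //; apply: lip_add; apply: lip_opp; first exact: lip_kink.
  exact: lip_linear.
case: l main => [[i|i]|i] main.
- by apply: main (lip_z i) _ => e we; exact: wit_c we i.
- case it : (i \in t.1.2).
    by apply: main (lip_cst 0) _ => e we; rewrite (wit_g we).
  by apply: lip_eq (lip_cod (gI i, None)) => e _; rewrite /cod /code /= it.
- by apply: main (lip_cst 0) _ => e we; rewrite (wit_h we).
Qed.

Lemma witness_lipschitz : exists2 K : R, 0 < K & forall x z mu M x' z' mu' M' d, 0 <= d ->
  witness t x z mu M -> witness t x' z' mu' M' ->
  (forall j, `|code t x z mu M j - code t x' z' mu' M' j| <= d) ->
  forall j, `|M j - M' j| <= K * d.
Proof.
have [K K0 H] := finite_upper_bound (P := fun j K => forall e e' d, near_config e e' d ->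
  `|e.2 j - e'.2 j| <= K * d)
  (fun j x y xy H e e' d eed => le_trans (H e e' d eed)
     (ler_wpM2r (let: And4 d0 _ _ _ := eed in d0) xy))
  (fun j => let: ex_intro2 K _ H := lip_M j in
     ex_intro _ K (fun e e' d eed => let: And3 _ _ h := H e e' d eed in h)).
exists K => // x z mu M x' z' mu' M' d d0 w1 w2 Hd j.
exact: (H j (x, z, mu, M) (x', z', mu', M')).
Qed.

End Lipschitz.

(** If all free multipliers vanished, descending through the adjoint system would make every
    multiplier vanish. So some free one is nonzero, and dividing by the largest of them gives the
    normalisation. *)
Lemma singular_witness x z mu M : `|x| <= b -> `|z| <= b -> (forall j, `|M j| <= rho) ->
  singular_at x z mu M -> exists t mu', witness t x z mu' M.
Proof.
move=> xb zb Mrho [[zc h0] g0 [l0 mul0] D0 K0].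
pose al := [set i | z 0 i == 0]%SET.
pose sg := [set i | 0 <= z 0 i]%SET.
pose be := [set i | shifted M (gI i) x z == 0]%SET.
pose t0 l : tagT := (al, sg, be, l).
have mu_c (i : 'I_s) : i \notin al -> mu (cI i) =
    \sum_l (sgn (t0 l0) i * DY l i (kink x z) + DZ l i (kink x z)) * mu l.
  rewrite inE => zi; apply: (mulfI zi); rewrite K0 mulr_sumr; apply: eq_bigr => l _.
  rewrite mulrA; congr (_ * _); rewrite mulrDr mulrA; congr (_ * _ + _).
  rewrite /sgn /= inE; case: ifPn => [z0|]; first by rewrite ger0_norm// mulr1.
  by rewrite -ltNge => /ltr0_norm ->; rewrite mulrN1.
have g_0 i : i \notin be -> mu (gI i) = 0.
  by rewrite inE => gi; apply/eqP; have /eqP := g0 i; rewrite mulf_eq0 (negbTE gi).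
have [l1 free1 mul1] : exists2 l, free_mult (t0 l0) l & mu l != 0.
  apply: contrapT => H.
  have mu0 l : free_mult (t0 l0) l -> mu l = 0.
    by move=> fl; apply/eqP/negPn/negP => ml; apply: H; exists l.
  move/eqP: mul0; apply.
  have [m] := ubnP (if l0 is inl (inl i) then (s - i)%N else 0%N).
  suff main (l : idx) : ((if l is inl (inl i) then s - i else 0) < m)%N -> mu l = 0 by exact: main.
  elim: m l => // m IH [[i|i]|i] im.
  - case it : (i \in al); first by apply: mu0; rewrite /= it.
    rewrite [LHS]mu_c ?it// big1// => -[[i'|i']|i'] _.
    + rewrite ltnS in im; have [ii'|ii'] := ltnP i i'; last by rewrite triY ?triZ -?leqNgt// mulr0 addr0 mul0r.
      by rewrite (IH (cI i')) ?mulr0// (leq_trans _ im)// ltn_sub2l.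
    + case it' : (i' \in be); last by rewrite g_0 ?it'// mulr0.
      by rewrite mu0 ?mulr0//= it'.
    + by rewrite mu0 ?mulr0.
  - case it' : (i \in be); last by rewrite g_0 ?it'.
    by rewrite mu0//= it'.
  - by rewrite mu0.
have [l2 free2 max2] := @arg_maxP _ R idx l1 (free_mult (t0 l0)) (fun l => `|mu l|) free1.
have mul2 : mu l2 != 0.
  by rewrite -normr_gt0; apply: lt_le_trans (max2 _ free1); rewrite normr_gt0.
exists (t0 l2), (fun l => mu l / mu l2); split => //=.
- by rewrite divff.
- move=> l fl; rewrite normrM normfV ler_pdivrMr ?normr_gt0// mul1r; exact: max2.
- by move=> i; rewrite inE => /eqP.
- move=> i ial; rewrite mu_c// mulr_suml; apply: eq_bigr => l _.
  by rewrite mulrA.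
- by move=> i /g_0 ->; rewrite mul0r.
- by move=> i; rewrite inE => /eqP.
- move=> j; have := congr1 ( *%R^~ (mu l2)^-1) (D0 j).
  rewrite /= mul0r mulr_suml => E; rewrite -[RHS]E; apply: eq_bigr => l _.
  by rewrite mulrAC.
Qed.

Lemma generic_parameter : 0 < rho ->
  exists2 M : parameter, forall j, `|M j| <= rho &
    forall x z mu, `|x| <= b -> `|z| <= b -> ~ singular_at x z mu M.
Proof.
move=> rho0.
have [K K0 HK] := finite_upper_bound (P := fun t K => forall x z mu M x' z' mu' M' d, 0 <= d ->
  witness t x z mu M -> witness t x' z' mu' M' ->
  (forall j, `|code t x z mu M j - code t x' z' mu' M' j| <= d) ->
  forall j, `|M j - M' j| <= K * d)
  (fun t K K' KK' H x z mu M x' z' mu' M' d d0 w1 w2 Hd j =>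
    le_trans (H x z mu M x' z' mu' M' d d0 w1 w2 Hd j) (ler_wpM2r d0 KK'))
  (fun t => let: ex_intro2 K _ H := witness_lipschitz t in ex_intro _ K H).
pose C (t : tagT) (Y M : parameter) := exists x z mu, witness t x z mu M /\ Y = code t x z mu M.
(* The constant coordinate of a code is [(t.2, None)]: as the pivot is free, the code stores its
   multiplier there, which is 1. *)
have [||M [Mrho HM]] :=
  @pigeonhole_parameter R _ _ (fun t : tagT => (t.2, None)) C (`|b| + 1 + `|rho|) K rho rho0.
- move=> t _ _ M M' d d0 [x [z [mu [w ->]]]] [x' [z' [mu' [w' ->]]]]; exact: (HK t).
- move=> t _ M [x [z [mu [w ->]]]]; split=> [|j]; last exact: code_bound.
  have := wit_pivot w; have := wit_pivot1 w; rewrite /code.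
  by case: t.2 => [[i|i]|i] /= -> // ->.
exists M => // x z mu xb zb sing.
have [t [mu' w]] := singular_witness xb zb Mrho sing.
by apply: (HM t (code t x z mu' M)); exists x, z, mu'.
Qed.

End GenericParameters.

(** * Composition with maps that respect the coordinate axes *)

Section Precomposition.
Context {R : realType}.

Lemma is_derive_affine_comp a b (W : normedModType R) (f : 'rV[R]_b -> W) (pi : 'rV[R]_a -> 'rV[R]_b)
    (w v : 'rV[R]_a) (v' : 'rV[R]_b) :
  (forall h, pi (h *: v + w) = h *: v' + pi w) -> derivable f (pi w) v' ->
  is_derive w v (fun w => f (pi w)) ('D_v' f (pi w)).
Proof.
move=> piE df.
have E : (fun h : R => h^-1 *: (((fun w => f (pi w)) \o shift w) (h *: v) - f (pi w))) =
    (fun h => h^-1 *: ((f \o shift (pi w)) (h *: v') - f (pi w))).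
  by apply/funext => h /=; rewrite piE.
by apply: DeriveDef; rewrite /derivable /derive E.
Qed.

Lemma is_derive_cst_comp a b (W : normedModType R) (f : 'rV[R]_b -> W) (pi : 'rV[R]_a -> 'rV[R]_b)
    (w v : 'rV[R]_a) :
  (forall h, pi (h *: v + w) = pi w) -> is_derive w v (fun w => f (pi w)) 0.
Proof.
move=> piE.
have E : (fun h : R => h^-1 *: (((fun w => f (pi w)) \o shift w) (h *: v) - f (pi w))) = cst 0.
  by apply/funext => h /=; rewrite piE subrr scaler0.
apply: DeriveDef; rewrite /derivable /derive E; first exact: is_cvg_cst.
exact: lim_cst.
Qed.

(** Covers the coordinate projections behind switching functions and the freezing of a coordinate in
    splines. Each axis goes to an axis or to a point, so partial derivatives compose without a total
    derivative. *)
Definition axis_map a b (sg : 'I_a -> option 'I_b) (pi : 'rV[R]_a -> 'rV[R]_b) :=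
  continuous pi /\ forall l w h,
    pi (h *: delta_mx 0 l + w) = (if sg l is Some l' then h *: delta_mx 0 l' else 0) + pi w.

Lemma pd_axis_comp a b (W : normedModType R) (f : 'rV[R]_b -> W) sg pi (w : 'rV[R]_a) l :
  axis_map sg pi -> (forall v i, derivable f v (delta_mx 0 i)) ->
  is_derive w (delta_mx 0 l) (fun w => f (pi w)) (if sg l is Some l' then pd l' f (pi w) else 0).
Proof.
move=> [_ piE] df; have := piE l w; case: (sg l) => [l'|] E.
  exact: is_derive_affine_comp.
by apply: is_derive_cst_comp => h; rewrite E add0r.
Qed.

Lemma Cn_axis_comp m a b (W : normedModType R) (f : 'rV[R]_b -> W) sg (pi : 'rV[R]_a -> 'rV[R]_b) :
  axis_map sg pi -> Cn m f -> Cn m (fun w => f (pi w)).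
Proof.
move=> ax; have [cpi _] := ax; elim: m f => [|m IH] f; first exact: continuous_composite.
move=> /CnS[cf df Cf]; apply: CnSI.
- exact: continuous_composite.
- by move=> w l; have [] := pd_axis_comp w l ax df.
- move=> l; apply: (Cn_eq (f := fun w => if sg l is Some l' then pd l' f (pi w) else 0)).
    by move=> w; have [] := pd_axis_comp w l ax df.
  case: (sg l) => [l'|]; first exact: (IH (pd l' f)).
  exact: Cn_cst.
Qed.

Lemma continuous_upd a (i : 'I_a) (t : R) : continuous (fun w : 'rV[R]_a => upd w i t).
Proof.
apply/continuous_rowP => j; have [->|ji] := eqVneq j i.
  rewrite (_ : (fun w => _) = cst t); first exact: cst_continuous.
  by apply/funext => w; rewrite upd_same.
rewrite (_ : (fun w => _) = fun w : 'rV[R]_a => w 0 j); first exact: coord_continuous.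
by apply/funext => w; rewrite upd_other.
Qed.

Lemma axis_map_upd a (i : 'I_a) (t : R) :
  axis_map (fun l => if l == i then None else Some l) (fun w : 'rV[R]_a => upd w i t).
Proof.
split; first exact: continuous_upd.
move=> l w h; apply/rowP => j; have [->|li] := eqVneq l i.
  rewrite !mxE eqxx /=; case: (eqVneq j i) => [_|ji]; first by rewrite add0r.
  by rewrite mulr0.
rewrite !mxE eqxx /=; case: eqVneq => [->|//].
by rewrite eq_sym (negbTE li) mulr0 add0r.
Qed.

(** Only [v] is confined to the box; [v'] may leave it, as the nodes of a spline do. *)
Lemma continuous_box_unif a (f : 'rV[R]_a -> R) (b e : R) : continuous f -> 0 < e ->
  exists2 d, 0 < d & forall v v', `|v| <= b -> `|v' - v| <= d -> `|f v' - f v| <= e.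
Proof.
move=> cf e0; have /compact_near_coveringP cov := @compact_box R a b.
have [|d /= d0 H] := cov R (nbhs (0 : R)) (fun d v => forall v', `|v' - v| <= `|d| -> `|f v' - f v| <= e) _ _.
  move=> x xb.
  have e20 : 0 < e / 2 by rewrite divr_gt0.
  have /cvgrPdist_le/(_ _ e20)/nbhs_ballP[r /= r0 Hr] := cf x.
  have r20 : 0 < r / 2 by rewrite divr_gt0.
  exists (ball x (r / 2), ball (0 : R) (r / 2)) => /=.
    by split; [exact: nbhsx_ballx|exact: nbhsx_ballx].
  move=> [v d] /= []; rewrite -!ball_normE /= sub0r normrN => xv dr v' v'v.
  have h1 : `|f x - f v| <= e / 2.
    by apply: Hr; rewrite -ball_normE /= (lt_trans xv)// ltr_pdivrMr// ltr_pMr// ltr1n.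
  have h2 : `|f x - f v'| <= e / 2.
    apply: Hr; rewrite -ball_normE /= (splitr r) (le_lt_trans (ler_distD v _ _))// ltrD//.
    by rewrite distrC (le_lt_trans v'v).
  by rewrite (le_trans (ler_distD (f x) _ _))// (splitr e) lerD// distrC.
exists (d / 2); first by rewrite divr_gt0.
move=> v v' vb vv; apply: (H (d / 2)) => //=; last by rewrite ger0_norm// divr_ge0// ltW.
rewrite sub0r normrN gtr0_norm ?divr_gt0// ltr_pdivrMr// ltr_pMr// ltr1n//.
Qed.

End Precomposition.

(** * Approximation by functions with Lipschitz derivatives *)

Section Splines.
Context {R : realType}.

Definition pos_part (t : R) : R := if 0 <= t then t else 0.

(* [hat] is the derivative of [smooth_ramp], which is quadratic on [-1, 0] and on [0, 1]. *)
Definition smooth_ramp (t : R) : R :=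
  (pos_part (t + 1) ^+ 2 - 2 * pos_part t ^+ 2 + pos_part (t - 1) ^+ 2) / 2.
Definition hat (t : R) : R := pos_part (t + 1) - 2 * pos_part t + pos_part (t - 1).

Lemma is_derive_pos_part2 (t : R) : is_derive t 1 (fun t => pos_part t ^+ 2) (2 * pos_part t).
Proof.
have [t0|t0|->] := ltgtP t 0.
- rewrite /pos_part leNgt t0 /= mulr0.
  apply: (near_eq_is_derive (f := cst (0 : R))).
  near=> s; rewrite ifF ?expr0n//; apply/negbTE; rewrite -ltNge; near: s; exact: lt_nbhsl.
- apply: (near_eq_is_derive (f := (id : R -> R) ^+ 2)).
    near=> s; rewrite /pos_part ifT; first by rewrite !fctE.
    by apply: ltW; near: s; exact: lt_nbhsr.
  apply: is_derive_eq; rewrite /pos_part ltW// expr1 [_ *: _]mulr1; ring.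
- rewrite {2}/pos_part lexx mulr0.
  suff H : h^-1 *: (((fun t => pos_part t ^+ 2) \o shift 0) (h *: 1) - pos_part 0 ^+ 2) @[h --> 0^'] --> (0 : R).
    by apply: DeriveDef; [apply/cvg_ex; eexists; exact: H | exact: cvg_lim H].
  apply/cvgr0Pnorm_le => e e0; near=> h.
  rewrite /= addr0 {2}/pos_part lexx expr0n subr0 [h *: 1]mulr1.
  have he : `|h| <= e by near: h; exact: dnbhs0_le.
  have h0 : h != 0 by near: h; exact: nbhs_dnbhs_neq.
  rewrite /pos_part; case: ifP => _; last by rewrite expr0n scaler0 normr0 ltW.
  by rewrite [_ *: _]mulrA mulVf// mul1r.
Unshelve. all: by end_near. Qed.

Lemma is_derive_ramp (t : R) : is_derive t 1 smooth_ramp (hat t).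
Proof.
have sh (k : R) : is_derive t 1 (fun t : R => pos_part (t + k) ^+ 2) (2 * pos_part (t + k)).
  have d1 : is_derive t 1 (fun t : R => t + k) 1 by exact: is_derive_shift.
  have := @is_derive1_comp R _ _ t _ _ (is_derive_pos_part2 (t + k)) d1.
  by rewrite mulr1.
have d : is_derive t 1 (((fun t : R => pos_part (t + 1) ^+ 2) - (2 \*: (fun t => pos_part t ^+ 2))
      + (fun t : R => pos_part (t + -1) ^+ 2)) * cst (2^-1 : R)) (hat t).
  apply: is_derive_eq (is_deriveM (is_deriveD (is_deriveB (sh 1) (is_deriveZ 2 (is_derive_pos_part2 t))) (sh (-1))) (is_derive_cst _ _ _)) _.
  rewrite /hat /= [_ *: 0]mulr0 add0r.
  have -> (x y : R) : x *: y = x * y by [].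
  have -> (x y : R) : x *: y = x * y by [].
  by field.
exact: d.
Qed.

Lemma continuous_ramp : continuous smooth_ramp.
Proof.
move=> t; apply/differentiable_continuous/derivable1_diffP.
by have [] := is_derive_ramp t.
Qed.

Lemma ramp_le t : t <= -1 -> smooth_ramp t = 0.
Proof.
by move=> t1; rewrite /smooth_ramp /pos_part; do ![case: leP => ?]; nra.
Qed.

Lemma ramp_ge t : 1 <= t -> smooth_ramp t = 1.
Proof.
by move=> t1; rewrite /smooth_ramp /pos_part; do ![case: leP => ?]; nra.
Qed.

Lemma ramp_itv t : 0 <= smooth_ramp t <= 1.
Proof.
have [t1|t1] := leP t (-1); first by rewrite ramp_le// lexx ler01.
have [t2|t2] := leP 1 t; first by rewrite ramp_ge// lexx ler01.
rewrite /smooth_ramp /pos_part.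
rewrite [if 0 <= t + 1 then _ else _]ifT; last by lra.
rewrite [if 0 <= t - 1 then _ else _]ifF; last by apply/negbTE; rewrite -ltNge; lra.
have sq1 := sqr_ge0 (t + 1); have sq2 := sqr_ge0 (1 - t); have p1 : 0 <= (t + 1) * (1 - t) by apply: mulr_ge0; lra.
by case: (leP 0 t) => t0; apply/andP; split; nra.
Qed.

Lemma hat_le t : t <= -1 -> hat t = 0.
Proof. by move=> t1; rewrite /hat /pos_part; do ![case: leP => ?]; lra. Qed.

Lemma hat_ge t : 1 <= t -> hat t = 0.
Proof. by move=> t1; rewrite /hat /pos_part; do ![case: leP => ?]; lra. Qed.

Lemma hat_itv t : 0 <= hat t <= 1.
Proof.
rewrite /hat /pos_part; case: (leP 0 (t + 1)) => ?; case: (leP 0 t) => ?;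
  case: (leP 0 (t - 1)) => ?; by apply/andP; split; lra.
Qed.

Lemma hat_sum t : 0 <= t <= 1 -> hat t + hat (t - 1) = 1.
Proof. by move=> /andP[h1 h2]; rewrite /hat /pos_part; do ![case: leP => ?]; lra. Qed.

Lemma hat_lipschitz s t : `|hat s - hat t| <= 4 * `|s - t|.
Proof.
have pl (x y : R) : `|pos_part x - pos_part y| <= `|x - y|.
  rewrite /pos_part; have [h|h] := leP y x.
    by rewrite [leRHS]ger0_norm ?subr_ge0//; case: (leP 0 x) => ?; case: (leP 0 y) => ?; rewrite ler_norml; apply/andP; split; lra.
  by rewrite [leRHS]ltr0_norm ?subr_lt0//; case: (leP 0 x) => ?; case: (leP 0 y) => ?; rewrite ler_norml; apply/andP; split; lra.
have := pl (s + 1) (t + 1); have := pl s t; have := pl (s - 1) (t - 1).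
rewrite [s + 1 - _](_ : _ = s - t); last by ring.
rewrite [s - 1 - _](_ : _ = s - t); last by ring.
rewrite /hat; move: (pos_part _) (pos_part _) (pos_part _) (pos_part _) (pos_part _) (pos_part _) (`|s - t|).
move=> x1 x2 x3 x4 x5 x6 y; rewrite !ler_norml => /andP[? ?] /andP[? ?] /andP[? ?].
by apply/andP; split; lra.
Qed.

Lemma continuous_hat : continuous hat.
Proof.
move=> t; apply/cvgrPdist_lt => e e0; apply/nbhs_ballP.
exists (e / 4) => [|s]; first by rewrite /= divr_gt0.
rewrite /ball /= ltr_pdivlMr// mulrC => ts.
exact: le_lt_trans (hat_lipschitz _ _) ts.
Qed.

Lemma ramp_lipschitz s t : `|smooth_ramp s - smooth_ramp t| <= `|s - t|.
Proof.
wlog st : s t / s <= t.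
  by move=> H; have [/H//|/ltW/H] := leP s t; rewrite distrC [leRHS]distrC.
have [||c _] := @MVT_segment R smooth_ramp hat s t st.
- by move=> x _; exact: is_derive_ramp.
- apply: derivable_within_continuous => x _.
  by have [] := is_derive_ramp x.
rewrite distrC [leRHS]distrC => ->; rewrite normrM ler_piMl//.
by have /andP[h1 h2] := hat_itv c; rewrite ger0_norm.
Qed.

(** At a given point only two consecutive ramps or hats are in transition. Used with [e = 1] for
    ramps, which have saturated before the window, and with [e = 0] for hats. *)
Lemma window_sum (N k : nat) (c h : nat -> R) (e : R) : (k.+1 < N)%N ->
  (forall j, (j < k)%N -> h j = e) -> (forall j, (k.+1 < j)%N -> h j = 0) ->
  \sum_(j < N) c j * h j = e * (\sum_(j < k) c j) + c k * h k + c k.+1 * h k.+1.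
Proof.
move=> kN hlt hgt.
rewrite -(big_mkord xpredT (fun j => c j * h j)) (big_cat_nat (n := k.+2))//=.
rewrite [X in _ + X]big_nat_cond [X in _ + X]big1 ?addr0; last first.
  by move=> j /andP[/andP[kj _] _]; rewrite hgt// mulr0.
rewrite !big_nat_recr//= big_mkord mulr_sumr; congr (_ + _ + _).
by apply: eq_bigr => j _; rewrite hlt// mulrC.
Qed.

End Splines.

(** * Spline approximation, one coordinate at a time *)

Section Smoothing.
Context {R : realType}.

Lemma norm_updB_le a (w : 'rV[R]_a) i t d : `|t - w 0 i| <= d -> `|upd w i t - w| <= d.
Proof.
move=> td; apply: norm_rV_le => [|j]; first exact: le_trans (normr_ge0 _) td.
rewrite !mxE; case: eqVneq => [->//|_].
by rewrite subrr normr0; exact: le_trans (normr_ge0 _) td.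
Qed.

(** Kept separate for each coordinate because one spline step gains this property in one coordinate
    and must preserve it in the others. The bound on [f] is included for the sake of products. *)
Definition lip_coord a (j : 'I_a) (f : 'rV[R]_a -> R) := forall b, exists2 K : R, 0 <= K &
  forall w s t, `|w| <= b -> `|s| <= b -> `|t| <= b ->
    `|f (upd w j s)| <= K /\ `|f (upd w j s) - f (upd w j t)| <= K * `|s - t|.

Lemma lip_coord_add a (j : 'I_a) f g : lip_coord j f -> lip_coord j g ->
  lip_coord j (fun w => f w + g w).
Proof.
move=> Lf Lg b; have [K K0 H] := Lf b; have [K' K'0 H'] := Lg b.
exists (K + K') => [|w s t wb sb tb]; first exact: addr_ge0.
have [h1 h2] := H w s t wb sb tb; have [h1' h2'] := H' w s t wb sb tb; split.
  by rewrite (le_trans (ler_normD _ _))// lerD.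
by rewrite opprD addrACA mulrDl (le_trans (ler_normD _ _))// lerD.
Qed.

Lemma lip_coord_mul a (j : 'I_a) f g : lip_coord j f -> lip_coord j g ->
  lip_coord j (fun w => f w * g w).
Proof.
move=> Lf Lg b; have [K K0 H] := Lf b; have [K' K'0 H'] := Lg b.
exists (K * K' + K * K') => [|w s t wb sb tb]; first by rewrite addr_ge0// mulr_ge0.
have [h1 h2] := H w s t wb sb tb; have [h1' h2'] := H' w s t wb sb tb.
have [h3 _] := H' w t t wb tb tb.
have KK : 0 <= K * K' by exact: mulr_ge0.
split; first by rewrite normrM (@le_trans _ _ (K * K')) ?lerDl// ler_pM.
have -> : f (upd w j s) * g (upd w j s) - f (upd w j t) * g (upd w j t) =
  f (upd w j s) * (g (upd w j s) - g (upd w j t)) +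
  (f (upd w j s) - f (upd w j t)) * g (upd w j t) by ring.
rewrite (le_trans (ler_normD _ _))// [leRHS]mulrDl lerD// normrM.
  by rewrite -mulrA ler_pM.
by rewrite [K * K' * _]mulrAC ler_pM.
Qed.

Lemma lip_coord_cst a (j : 'I_a) k : lip_coord j (fun=> k).
Proof. by move=> b; exists `|k| => // w s t _ _ _; rewrite subrr normr0 mulr_ge0. Qed.

Lemma lip_coord_sum a (j : 'I_a) (I : Type) (r : seq I) (f : I -> 'rV[R]_a -> R) :
  (forall k, lip_coord j (f k)) -> lip_coord j (fun w => \sum_(k <- r) f k w).
Proof.
move=> Lf; elim: r => [|k r IH].
  rewrite (_ : (fun w => _) = fun=> 0); first exact: lip_coord_cst.
  by apply/funext => w; rewrite big_nil.
rewrite (_ : (fun w => _) = fun w => f k w + \sum_(k <- r) f k w); first exact: lip_coord_add.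
by apply/funext => w; rewrite big_cons.
Qed.

Lemma lip_coord_fun a (i j : 'I_a) (psi : R -> R) (L : R) : 0 <= L ->
  (forall s t, `|psi s - psi t| <= L * `|s - t|) -> lip_coord j (fun w => psi (w 0 i)).
Proof.
move=> L0 Lpsi b; exists (`|psi 0| + L * `|b| + L) => [|w s t wb sb tb].
  by rewrite !addr_ge0// mulr_ge0.
have bnd x : `|x| <= b -> `|psi x| <= `|psi 0| + L * `|b| + L.
  move=> xb; rewrite -[psi x](subrK (psi 0)) addrC (le_trans (ler_normD _ _))//.
  rewrite -addrA lerD// (le_trans (Lpsi _ _))// subr0 ler_wpDr// ler_wpM2l//.
  exact: le_trans xb (ler_norm _).
rewrite !mxE; case: ifP => _; split.
- exact: bnd.
- by rewrite (le_trans (Lpsi _ _))// ler_wpM2r// lerDr addr_ge0// mulr_ge0.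
- by apply: bnd; exact: le_trans (norm_entry_le _ _) wb.
- by rewrite subrr normr0 mulr_ge0// !addr_ge0// mulr_ge0.
Qed.

(** Freezing coordinate [i] makes the function constant along it: the source of the regularity that
    [spline] gains. *)
Lemma lip_coord_upd_same a (i : 'I_a) (f : 'rV[R]_a -> R) t0 :
  continuous f -> lip_coord i (fun w => f (upd w i t0)).
Proof.
move=> cf b; have [K K0 H] := continuous_box_bound (`|b| + `|t0|) cf.
exists K => [|w s t wb sb tb]; first exact: ltW.
rewrite !upd_upd subrr normr0 mulr_ge0 ?(ltW K0)//; split => //; apply: H.
by apply: norm_upd_le; rewrite ?lerDr// (le_trans wb)// (le_trans (ler_norm _))// lerDl.
Qed.

Lemma lip_coord_upd_other a (i j : 'I_a) (f : 'rV[R]_a -> R) t0 : j != i ->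
  lip_coord j f -> lip_coord j (fun w => f (upd w i t0)).
Proof.
move=> ji Lf b; have [K K0 H] := Lf (`|b| + `|t0|).
have up x : `|x| <= b -> `|x| <= `|b| + `|t0|.
  by move=> xb; rewrite (le_trans xb)// (le_trans (ler_norm _))// lerDl.
exists K => // w s t wb sb tb.
have E x : upd (upd w j x) i t0 = upd (upd w i t0) j x.
  apply/rowP => k; rewrite !mxE; have [->|//] := eqVneq k i.
  by rewrite eq_sym (negbTE ji).
rewrite !E; apply: H; try exact: up.
apply: norm_upd_le; last by rewrite lerDr.
by rewrite (le_trans wb)// (le_trans (ler_norm _))// lerDl.
Qed.

Lemma Cn1_lip_coord a (j : 'I_a) (f : 'rV[R]_a -> R) : Cn 1 f -> lip_coord j f.
Proof.
move=> Cf b; have [K K0 H] := Cn1_box_lipschitz b Cf.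
have [K' K'0 H'] := continuous_box_bound b (Cn_continuous Cf).
exists (K' + K) => [|w s t wb sb tb]; first by rewrite addr_ge0// ltW.
split; first by rewrite (le_trans (H' _ _)) ?lerDl ?(ltW K0)//; exact: norm_upd_le.
rewrite (le_trans (H _ _ _ _)) ?norm_upd_le// ler_pM ?(ltW K0)// ?lerDr ?(ltW K'0)//.
apply: norm_rV_le => // k; rewrite !mxE; case: ifP => // _.
by rewrite subrr normr0.
Qed.

Lemma lip_coord_box a (f : 'rV[R]_a -> R) b :
  continuous f -> (forall j, lip_coord j f) -> lipschitz_on_box b f.
Proof.
move=> cf Lf; have [K' K'0 H'] := continuous_box_bound b cf.
have [||K K0 H] := @finite_upper_bound R 'I_a (fun j K => forall w s t, `|w| <= b -> `|s| <= b ->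
    `|t| <= b -> `|f (upd w j s) - f (upd w j t)| <= K * `|s - t|).
- by move=> j x y xy H w s t wb sb tb; rewrite (le_trans (H _ _ _ wb sb tb))// ler_wpM2r.
- by move=> j; have [K _ H] := Lf j b; exists K => w s t wb sb tb; have [] := H w s t wb sb tb.
exists (K' + K * a%:R) => [|w w' wb w'b]; first by rewrite addr_ge0 ?mulr_ge0// ltW.
split; first by rewrite (le_trans (H' _ wb))// lerDl mulr_ge0// ltW.
rewrite mulrDl ler_wpDl ?mulr_ge0 ?(ltW K'0)//.
have -> : f w - f w' = \sum_(i < a) (f (splice w' w i.+1) - f (splice w' w i)).
  rewrite -(big_mkord xpredT (fun i => f (splice w' w i.+1) - f (splice w' w i))).
  by rewrite telescope_sumr// splice_full splice0.
rewrite (le_trans (ler_norm_sum _ _ _))//.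
apply: (@le_trans _ _ (\sum_(i < a) K * `|w - w'|)); last first.
  by rewrite sumr_const card_ord -[_ *+ a]mulr_natr mulrAC.
apply: ler_sum => i _; rewrite spliceS [X in _ - f X]splice_k.
have entry (v : 'rV[R]_a) k : `|v| <= b -> `|v 0 k| <= b by move=> vb; exact: le_trans (norm_entry_le _ _) vb.
rewrite (le_trans (H _ _ _ _ _ _ _))//; try exact: entry.
  apply: norm_rV_le => [|k]; first exact: le_trans (normr_ge0 _) wb.
  by rewrite mxE; case: ifP => _; exact: entry.
by rewrite ler_wpM2l ?(ltW K0)//; have := norm_entry_le (w - w') i; rewrite !mxE.
Qed.

Section OneCoordinate.
Context {a : nat} (i : 'I_a) (b d : R) (N : nat).
Hypothesis b_gt0 : 0 < b.
Hypothesis d_gt0 : 0 < d.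
Hypothesis N_large : 2 * b / d < N.-1%:R.

Let node (j : nat) : R := - b + j%:R * d.
Let jump (f : 'rV[R]_a -> R) j w := f (upd w i (node j.+1)) - f (upd w i (node j)).

(* Approximates [f] along coordinate [i]: the partial derivatives become Lipschitz in that
   coordinate and stay Lipschitz in every coordinate in which they already were. *)
Definition spline (f : 'rV[R]_a -> R) (w : 'rV[R]_a) : R :=
  f (upd w i (node 0)) + \sum_(j < N) jump f j w * smooth_ramp ((w 0 i - node j) / d).

Let dspline (f : 'rV[R]_a -> R) (w : 'rV[R]_a) : R :=
  \sum_(j < N) jump f j w * (hat ((w 0 i - node j) / d) * d^-1).

Let rampf j : 'rV[R]_a -> R := fun w => smooth_ramp ((w 0 i - node j) / d).

Let is_derive_rampf j w l : is_derive w (delta_mx 0 l) (rampf j)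
  (if l == i then hat ((w 0 i - node j) / d) * d^-1 else 0).
Proof.
have dx : is_derive w (delta_mx 0 l) (fun w : 'rV[R]_a => (w 0 i - node j) * d^-1) ((l == i)%:R * d^-1).
  have := is_deriveM (is_deriveB (pd_coord i l w) (is_derive_cst (node j) w (delta_mx 0 l)))
     (is_derive_cst (d^-1) w (delta_mx 0 l)).
  rewrite /= [_ *: 0]mulr0 add0r subr0 => D; apply: is_derive_eq D _.
  by rewrite [_ *: _]mulrC.
have [dx1 dx2] := dx.
have [dr1 dr2] := is_derive_ramp ((w 0 i - node j) / d).
have := pd_comp dx1 dr1; rewrite dx2 derive1E dr2 => D; apply: is_derive_eq D _.
by case: eqP; rewrite ?mul1r// mul0r mulr0.
Qed.

Let derivable_upd (f : 'rV[R]_a -> R) j w l : (forall v l, derivable f v (delta_mx 0 l)) ->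
  is_derive w (delta_mx 0 l) (fun w => f (upd w i (node j)))
    (if l == i then 0 else pd l f (upd w i (node j))).
Proof.
move=> df; apply: is_derive_eq (pd_axis_comp w l (axis_map_upd i (node j)) df) _.
by case: eqP.
Qed.

Let is_derive_spline (f : 'rV[R]_a -> R) w l : (forall v l, derivable f v (delta_mx 0 l)) ->
  is_derive w (delta_mx 0 l) (spline f) (if l == i then dspline f w else spline (pd l f) w).
Proof.
move=> df.
have D : is_derive w (delta_mx 0 l)
   ((fun w => f (upd w i (node 0))) + \sum_(j < N) (fun w => jump f j w) * rampf j)
   ((if l == i then 0 else pd l f (upd w i (node 0))) +
    \sum_(j < N) (jump f j w *: (if l == i then hat ((w 0 i - node j) / d) * d^-1 else 0) +
       rampf j w *: ((if l == i then 0 else pd l f (upd w i (node j.+1))) -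
          (if l == i then 0 else pd l f (upd w i (node j)))))).
  apply: is_deriveD; first exact: derivable_upd.
  apply: is_derive_sum => j; apply: is_deriveM; last exact: is_derive_rampf.
  by apply: is_deriveB; exact: derivable_upd.
have -> : spline f = (fun w => f (upd w i (node 0))) + \sum_(j < N) (fun w => jump f j w) * rampf j.
  by apply/funext => v; rewrite fctE fct_sumE.
apply: is_derive_eq D _; rewrite /spline /dspline; case: eqP => _.
  rewrite add0r; apply: eq_bigr => j _.
  by rewrite subrr scaler0 addr0.
congr (_ + _); apply: eq_bigr => j _.
by rewrite scaler0 add0r mulrC.
Qed.

Let continuous_updf (f : 'rV[R]_a -> R) t : continuous f -> continuous (fun w => f (upd w i t)).
Proof. by move=> cf; apply: (continuous_composite (f := fun w => upd w i t) (g := f)) => //; exact: continuous_upd. Qed.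

Let continuous_jump f j : continuous f -> continuous (jump f j).
Proof.
move=> cf; apply: continuous_add; first exact: continuous_updf.
by apply: continuous_opp; exact: continuous_updf.
Qed.

Let continuous_arg j : continuous (fun w : 'rV[R]_a => (w 0 i - node j) / d).
Proof.
apply: continuous_mul; last exact: cst_continuous.
by apply: continuous_add; [exact: coord_continuous|exact: cst_continuous].
Qed.

Let continuous_spline f : continuous f -> continuous (spline f).
Proof.
move=> cf; apply: continuous_add; first exact: continuous_updf.
apply: continuous_bigsum => j; apply: continuous_mul; first exact: continuous_jump.
exact: (continuous_composite (g := smooth_ramp) (@continuous_arg j) continuous_ramp).
Qed.

Let continuous_dspline f : continuous f -> continuous (dspline f).
Proof.
move=> cf; apply: continuous_bigsum => j; apply: continuous_mul; first exact: continuous_jump.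
apply: continuous_mul; last exact: cst_continuous.
exact: (continuous_composite (g := hat) (@continuous_arg j) continuous_hat).
Qed.

Let pd_spline (f : 'rV[R]_a -> R) l : (forall v l, derivable f v (delta_mx 0 l)) ->
  pd l (spline f) = if l == i then dspline f else spline (pd l f).
Proof.
move=> df; apply/funext => w; have [_ ->] := is_derive_spline w l df.
by case: ifP.
Qed.

Lemma Cn1_spline f : Cn 1 f -> Cn 1 (spline f).
Proof.
move=> /CnS[cf df cdf]; apply: CnSI; first exact: continuous_spline.
  by move=> w l; have [] := is_derive_spline w l df.
move=> l; rewrite pd_spline//; case: ifP => _; first exact: continuous_dspline.
by apply: continuous_spline; exact: cdf.
Qed.

Let lip_ramp j l : lip_coord l (fun w => smooth_ramp ((w 0 i - node j) / d)).
Proof.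
apply: (@lip_coord_fun a i l (fun t => smooth_ramp ((t - node j) / d)) d^-1).
  by rewrite invr_ge0 ltW.
move=> s t; rewrite (le_trans (ramp_lipschitz _ _))// -mulrBl opprB addrA subrK.
by rewrite normrM [X in _ * X]gtr0_norm ?invr_gt0// mulrC.
Qed.

Let lip_hat j l : lip_coord l (fun w => hat ((w 0 i - node j) / d)).
Proof.
apply: (@lip_coord_fun a i l (fun t => hat ((t - node j) / d)) (4 * d^-1)).
  by rewrite mulr_ge0// invr_ge0 ltW.
move=> s t; rewrite (le_trans (hat_lipschitz _ _))// -mulrBl opprB addrA subrK.
by rewrite normrM [`|d^-1|]gtr0_norm ?invr_gt0// mulrAC mulrA.
Qed.

Let lip_jump f j l : (forall t, lip_coord l (fun w => f (upd w i t))) -> lip_coord l (jump f j).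
Proof.
move=> H; rewrite (_ : jump f j = fun w => f (upd w i (node j.+1)) + (-1) * f (upd w i (node j))).
  by apply: lip_coord_add => //; apply: lip_coord_mul => //; exact: lip_coord_cst.
by apply/funext => w; rewrite mulN1r.
Qed.

Let lip_spline f l : (forall t, lip_coord l (fun w => f (upd w i t))) -> lip_coord l (spline f).
Proof.
move=> H; apply: lip_coord_add => //; apply: lip_coord_sum => j.
by apply: lip_coord_mul; [exact: lip_jump|exact: lip_ramp].
Qed.

(** All values of [f] and [pd l f] that occur are taken with coordinate [i] frozen; the dependence
    on that coordinate is carried by [hat] or [smooth_ramp], both Lipschitz. *)
Lemma spline_lip_new f l : Cn 1 f -> lip_coord i (pd l (spline f)).
Proof.
move=> Cf; have /CnS[cf df cdf] := Cf; rewrite pd_spline//; case: ifP => _; last first.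
  by apply: lip_spline => t; exact: (lip_coord_upd_same (f := pd l f) i t (cdf l)).
apply: lip_coord_sum => j; apply: lip_coord_mul.
  by apply: lip_jump => t; exact: lip_coord_upd_same.
by apply: lip_coord_mul; [exact: lip_hat|exact: lip_coord_cst].
Qed.

(** For [l = i] the jumps contain values of [f], Lipschitz since [f] is C^1; for other [l] the
    operator [spline] commutes with [pd l] and the hypothesis applies. *)
Lemma spline_lip_old f j l : Cn 1 f -> (forall l, lip_coord j (pd l f)) ->
  lip_coord j (pd l (spline f)).
Proof.
move=> Cf Lf; have [->|ji] := eqVneq j i; first exact: spline_lip_new.
have /CnS[cf df cdf] := Cf; rewrite pd_spline//; case: ifP => _; last first.
  by apply: lip_spline => t; exact: (lip_coord_upd_other (f := pd l f) t ji (Lf l)).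
apply: lip_coord_sum => k; apply: lip_coord_mul.
  by apply: lip_jump => t; apply: lip_coord_upd_other => //; exact: Cn1_lip_coord.
by apply: lip_coord_mul; [exact: lip_hat|exact: lip_coord_cst].
Qed.

(** The ramps at nodes [k] and [k.+1] are both in transition at [w], so both indices must be below
    [N]; this is the reason for [N.-1] in [N_large]. *)
Let cell (w : 'rV[R]_a) : `|w| <= b -> exists k, [/\ (k.+1 < N)%N, node k <= w 0 i & w 0 i < node k + d].
Proof.
move=> wb; have /(le_trans (norm_entry_le w i)) := wb; rewrite ler_norml => /andP[h1 h2].
have h0 : 0 <= (w 0 i + b) / d by rewrite divr_ge0 ?(ltW d_gt0)//; lra.
have /andP[] := truncn_itv h0; set k := Num.truncn _ => h3 h4.
exists k; split.
- have : (k < N.-1)%N.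
    rewrite -(ltr_nat R) (le_lt_trans h3)// (le_lt_trans _ N_large)//.
    by rewrite ler_pM2r ?invr_gt0//; lra.
  by rewrite ltn_predRL.
- by rewrite /node; move: h3; rewrite ler_pdivlMr//; lra.
- by rewrite /node; move: h4; rewrite ltr_pdivrMr// -natr1 mulrDl mul1r; lra.
Qed.

Let nodeS k : node k.+1 = node k + d.
Proof. by rewrite /node -natr1 mulrDl mul1r addrA. Qed.

Let ratio_le j k (t : R) : (j < k)%N -> node k <= t -> 1 <= (t - node j) / d.
Proof.
move=> jk; rewrite ler_pdivlMr// mul1r => kt.
have : node j.+1 <= node k by rewrite lerD2l ler_pM2r// ler_nat.
by rewrite nodeS; lra.
Qed.

Let ratio_ge j k (t : R) : (k.+1 < j)%N -> t < node k + d -> (t - node j) / d <= -1.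
Proof.
move=> jk tk; rewrite ler_pdivrMr// mulN1r.
have : node k.+2 <= node j by rewrite lerD2l ler_pM2r// ler_nat.
by rewrite !nodeS; lra.
Qed.

(** The spline is the value at node [k] plus fractions of two jumps, and nodes [k] to [k.+2] lie
    within [2 * d] of [w]: [5 * e] is [e] plus [2 * e] for each jump. *)
Lemma spline_close (f : 'rV[R]_a -> R) w e : `|w| <= b -> (forall v, `|v - w| <= 2 * d -> `|f v - f w| <= e) ->
  `|spline f w - f w| <= 5 * e.
Proof.
move=> wb He; have [k [kN h1 h2]] := cell wb.
have upd_close t : `|t - w 0 i| <= 2 * d -> `|f (upd w i t) - f w| <= e.
  by move=> td; apply: He; exact: norm_updB_le.
have E : spline f w = f (upd w i (node k)) + jump f k w * smooth_ramp ((w 0 i - node k) / d)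
     + jump f k.+1 w * smooth_ramp ((w 0 i - node k.+1) / d).
  rewrite /spline (window_sum (k := k) (fun j => jump f j w)
    (h := fun j => smooth_ramp ((w 0 i - node j) / d)) (e := 1) kN).
  - rewrite mul1r /jump -(big_mkord xpredT (fun j => f (upd w i (node j.+1)) - f (upd w i (node j)))).
    by rewrite telescope_sumr//; ring.
  - by move=> j jk; apply: ramp_ge; exact: ratio_le jk h1.
  - by move=> j jk; apply: ramp_le; exact: ratio_ge jk h2.
have := d_gt0 => d0.
have c0 : `|f (upd w i (node k)) - f w| <= e.
  by apply: upd_close; rewrite ler_norml; apply/andP; split; lra.
have c1 : `|f (upd w i (node k.+1)) - f w| <= e.
  by apply: upd_close; rewrite nodeS ler_norml; apply/andP; split; lra.
have c2 : `|f (upd w i (node k.+2)) - f w| <= e.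
  by apply: upd_close; rewrite !nodeS ler_norml; apply/andP; split; lra.
have /andP[r1 r2] := ramp_itv ((w 0 i - node k) / d).
have /andP[r3 r4] := ramp_itv ((w 0 i - node k.+1) / d).
have J0 : `|jump f k w * smooth_ramp ((w 0 i - node k) / d)| <= 2 * e.
  rewrite normrM -[leRHS]mulr1 ler_pM// ?[X in X <= 1]ger0_norm//.
  have -> : jump f k w = (f (upd w i (node k.+1)) - f w) - (f (upd w i (node k)) - f w) by rewrite /jump; ring.
  by rewrite (le_trans (ler_normB _ _))// mulr_natl mulr2n lerD.
have J1 : `|jump f k.+1 w * smooth_ramp ((w 0 i - node k.+1) / d)| <= 2 * e.
  rewrite normrM -[leRHS]mulr1 ler_pM// ?[X in X <= 1]ger0_norm//.
  have -> : jump f k.+1 w = (f (upd w i (node k.+2)) - f w) - (f (upd w i (node k.+1)) - f w) by rewrite /jump; ring.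
  by rewrite (le_trans (ler_normB _ _))// mulr_natl mulr2n lerD.
rewrite E -2!addrA addrC -addrA (_ : 5 * e = 2 * e + (2 * e + e)); last by ring.
rewrite (addrC _ (- f w)) -!addrA.
rewrite (_ : _ + _ = jump f k w * smooth_ramp ((w 0 i - node k) / d) +
   (jump f k.+1 w * smooth_ramp ((w 0 i - node k.+1) / d) + (f (upd w i (node k)) - f w))); last by ring.
by rewrite (le_trans (ler_normD _ _))// lerD// (le_trans (ler_normD _ _))// lerD.
Qed.

(** Along [i] the two active hats add up to 1, so the derivative is a convex combination of two
    chord slopes, each a value of [pd i f] near [w] by the mean value theorem. *)
Lemma spline_pd_close (f : 'rV[R]_a -> R) w l e : Cn 1 f -> `|w| <= b ->
  (forall v, `|v - w| <= 2 * d -> `|pd l f v - pd l f w| <= e) ->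
  `|pd l (spline f) w - pd l f w| <= 5 * e.
Proof.
move=> /CnS[cf df cdf] wb He; have [_ ->] := is_derive_spline w l df.
case: eqP => [E|_]; last exact: spline_close.
rewrite {}E in He *; have [k [kN h1 h2]] := cell wb.
have e0 : 0 <= e.
  by apply: le_trans (He w _); rewrite ?subrr ?normr0// mulr_ge0// ltW.
have hk j : jump f j w * (hat ((w 0 i - node j) / d) * d^-1) =
    (jump f j w / d) * hat ((w 0 i - node j) / d) by rewrite mulrA mulrAC.
have E : dspline f w = jump f k w / d * hat ((w 0 i - node k) / d)
     + jump f k.+1 w / d * hat ((w 0 i - node k.+1) / d).
  rewrite /dspline; under eq_bigr do rewrite hk.
  rewrite (window_sum (k := k) (fun j => jump f j w / d)
    (h := fun j => hat ((w 0 i - node j) / d)) (e := 0) kN) ?mul0r ?add0r//.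
  - by move=> j jk; apply: hat_ge; exact: ratio_le jk h1.
  - by move=> j jk; apply: hat_le; exact: ratio_ge jk h2.
have := d_gt0 => d0.
have slope j : node k <= node j -> node j <= node k.+1 -> `|jump f j w / d - pd i f w| <= e.
  move=> kj jk; have [c cb] := mvt_upd w (node j) (node j.+1) (fun v => df v i).
  rewrite /jump => ->; rewrite nodeS addrAC subrr add0r mulfK ?gt_eqF//.
  apply: He; apply: norm_updB_le; move: cb; rewrite /between nodeS.
  rewrite min_l ?lerDl ?(ltW d0)// max_r ?lerDl ?(ltW d0)// => /andP[h3 h4].
  by rewrite nodeS in jk; rewrite ler_norml; apply/andP; split; lra.
have s0 := slope k; have s1 := slope k.+1; rewrite !nodeS in s0 s1.
have {}s0 : `|jump f k w / d - pd i f w| <= e by apply: s0; lra.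
have {}s1 : `|jump f k.+1 w / d - pd i f w| <= e by apply: s1; lra.
have H1 : hat ((w 0 i - node k) / d) + hat ((w 0 i - node k.+1) / d) = 1.
  have -> : (w 0 i - node k.+1) / d = (w 0 i - node k) / d - 1.
    by rewrite nodeS; field; rewrite gt_eqF.
  by apply: hat_sum; rewrite divr_ge0 ?ler_pdivrMr ?(ltW d0)//; lra.
have /andP[r1 r2] := hat_itv ((w 0 i - node k) / d).
have /andP[r3 r4] := hat_itv ((w 0 i - node k.+1) / d).
rewrite E; clear E; move: (pd i f w : R) s0 s1 => t s0 s1.
set x := hat _ in H1 r1 r2 *; set y := hat _ in H1 r3 r4 *.
have -> : jump f k w / d * x + jump f k.+1 w / d * y - t =
    (jump f k w / d - t) * x + (jump f k.+1 w / d - t) * y.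
  by rewrite -[t in LHS]mulr1 -H1; ring.
rewrite (le_trans (ler_normD _ _))// (@le_trans _ _ (e * 1 + e * 1))//; last by lra.
by rewrite lerD// normrM ler_pM// ger0_norm.
Qed.

End OneCoordinate.

Lemma smooth_coordinates a (S : seq 'I_a) (f : 'rV[R]_a -> R) (b t : R) :
  Cn 1 f -> 0 < b -> 0 < t -> exists2 g, Cn 1 g &
    (forall w, `|w| <= b -> `|g w - f w| <= t /\ forall l, `|pd l g w - pd l f w| <= t) /\
    forall j l, j \in S -> lip_coord j (pd l g).
Proof.
move=> Cf b0; elim: S t => [|i S IH] t t0.
  by exists f => //; split=> // w _; split=> [|l]; rewrite subrr normr0 ltW.
have t20 : 0 < t / 2 by rewrite divr_gt0.
have [f1 Cf1 [close lipf1]] := IH _ t20.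
(* Half of the tolerance is left to the coordinates treated earlier; 5 is the factor lost in
   [spline_close]. *)
have e0 : 0 < t / 2 / 5 by rewrite divr_gt0.
have [d0 d00 H0] := continuous_box_unif b (Cn_continuous Cf1) e0.
have /CnS[_ _ cdf1] := Cf1.
have [||D D0 HD] := @finite_upper_bound R 'I_a (fun l D => 0 < D /\ forall w v, `|w| <= b ->
   `|v - w| <= D^-1 -> `|pd l f1 v - pd l f1 w| <= t / 2 / 5).
- move=> l x y xy [x0 H]; split=> [|w v wb vw]; first exact: lt_le_trans xy.
  by apply: H => //; apply: le_trans vw _; rewrite lef_pV2// posrE// (lt_le_trans x0).
- move=> l; have [d dd H] := continuous_box_unif b (cdf1 l) e0.
  by exists d^-1; rewrite invr_gt0 invrK.
pose d := Num.min d0 D^-1 / 2.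
have dpos : 0 < d by rewrite divr_gt0// lt_min d00 invr_gt0.
have d2 : 2 * d = Num.min d0 D^-1 by rewrite /d mulrC divfK.
pose N := (Num.truncn (2 * b / d)).+2.
have NL : 2 * b / d < N.-1%:R by exact: truncnS_gt.
exists (spline i b d N f1); first exact: Cn1_spline.
split.
- move=> w wb; have [h1 h2] := close w wb.
  have five : t = 5 * (t / 2 / 5) + t / 2 by field.
  split=> [|l]; rewrite five.
    rewrite (le_trans (ler_distD (f1 w) _ _))// lerD//.
    apply: spline_close => // v; rewrite d2 le_min => /andP[vd _]; exact: H0.
  rewrite (le_trans (ler_distD (pd l f1 w) _ _))// lerD//.
  apply: spline_pd_close => // v; rewrite d2 le_min => /andP[_ vd].
  by have [_ ] := HD l; apply.
- move=> j l; rewrite inE => /orP[/eqP ->|jS]; first exact: spline_lip_new.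
  by apply: spline_lip_old => // l'; exact: lipf1.
Qed.

Lemma smooth_approximation a (f : 'rV[R]_a -> R) (b t : R) :
  Cn 1 f -> 0 < t -> exists2 v, Cn 1 v &
    (forall mu w, (size mu <= 1)%N -> `|w| <= b -> `|partial mu v w| <= t) /\
    forall l, lipschitz_on_box b (pd l (fun w => f w + v w)).
Proof.
move=> Cf t0; have b0 : 0 < 1 + `|b| by rewrite ltr_pwDl.
have [g Cg [close lipg]] := smooth_coordinates (enum 'I_a) Cf b0 t0.
have Cv : Cn 1 (fun w => g w + - f w) by exact: CnD Cg (CnN Cf).
exists (fun w => g w + - f w) => //; split; last first.
  move=> l; rewrite (_ : (fun w => f w + _) = g); last by apply/funext => w; ring.
  have /CnS[_ _ cdg] := Cg; apply: lip_coord_box (cdg l) _ => j.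
  by apply: lipg; rewrite mem_enum.
have wb1 (w : 'rV[R]_a) : `|w| <= b -> `|w| <= 1 + `|b|.
  by move=> wb; rewrite (le_trans wb)// (le_trans (ler_norm b))// lerDr.
move=> [|l [|//]] w _ wb /=; have [h1 h2] := close w (wb1 w wb); first exact: h1.
have /CnS[_ dg _] := Cg; have /CnS[_ df _] := Cf.
by rewrite (deriveB (dg w l) (df w l)).
Qed.

End Smoothing.

(** * LIKQ and multipliers *)

Section Jacobians.
Context {R : realType}.

Lemma differentiable_row a p (F : 'rV[R]_a -> 'rV[R]_p) w :
  (forall l, Cn 1 (fun w => F w 0 l)) -> differentiable F w.
Proof.
move=> CF; have -> : F = \sum_(l < p) (fun w => F w 0 l *: delta_mx 0 l).
  by apply/funext => v; rewrite fct_sumE [LHS]row_sum_delta.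
apply: differentiable_sum => l; apply: differentiableZl.
by have /CnS[_ df cdf] := CF l; apply: differentiable_partials => // i; exact: cdf.
Qed.

Lemma Jac_entry a p (F : 'rV[R]_a -> 'rV[R]_p) w l j :
  (forall l, Cn 1 (fun w => F w 0 l)) -> Jac F w l j = pd j (fun w => F w 0 l) w.
Proof.
move=> CF; have dF := differentiable_row w CF.
have := deriveEjacobian (delta_mx 0 j) dF.
rewrite derive_mx; last exact: diff_derivable.
by move=> /rowP/(_ l); rewrite -rowE !mxE => ->.
Qed.

Context {n s : nat}.

Definition dx (f : 'rV[R]_(n + s + s) -> R) (j : 'I_n) w := pd (lshift s (lshift s j)) f w.
Definition dy (f : 'rV[R]_(n + s + s) -> R) (i : 'I_s) w := pd (lshift s (rshift n i)) f w.
Definition dz (f : 'rV[R]_(n + s + s) -> R) (i : 'I_s) w := pd (rshift (n + s) i) f w.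

Lemma D1E p (F : 'rV[R]_(n + s + s) -> 'rV[R]_p) w l j :
  (forall l, Cn 1 (fun w => F w 0 l)) -> D1 F w l j = dx (fun w => F w 0 l) j w.
Proof. by move=> CF; rewrite /dx -Jac_entry// /D1 !mxE. Qed.

Lemma D2E p (F : 'rV[R]_(n + s + s) -> 'rV[R]_p) w l j :
  (forall l, Cn 1 (fun w => F w 0 l)) -> D2 F w l j = dy (fun w => F w 0 l) j w.
Proof. by move=> CF; rewrite /dy -Jac_entry// /D2 !mxE. Qed.

Lemma D3E p (F : 'rV[R]_(n + s + s) -> 'rV[R]_p) w l j :
  (forall l, Cn 1 (fun w => F w 0 l)) -> D3 F w l j = dz (fun w => F w 0 l) j w.
Proof. by move=> CF; rewrite /dz -Jac_entry// /D3 !mxE. Qed.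

End Jacobians.

Section Selection.
Context {R : realType}.

Lemma mul_select_mx m (A : {set 'I_m}) (v : 'rV[R]_#|A|) k :
  (v *m select_mx A) 0 (enum_val k) = v 0 k.
Proof.
rewrite mxE (bigD1 k)//= big1 ?addr0 => [|k' k'k]; first by rewrite !mxE !eqxx mulr1.
rewrite !mxE eqxx /= eq_sym (inj_eq enum_val_inj) (negbTE k'k) mulr0//.
Qed.

Lemma mul_select_mx_notin m (A : {set 'I_m}) (v : 'rV[R]_#|A|) j :
  j \notin A -> (v *m select_mx A) 0 j = 0.
Proof.
move=> jA; rewrite mxE big1// => k _; rewrite !mxE eqxx /=.
case: eqVneq => [E|]; last by rewrite mulr0.
by move: jA; rewrite E enum_valP.
Qed.

Lemma select_mx_supported m (A : {set 'I_m}) (v : 'rV[R]_m) :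
  (forall j, j \notin A -> v 0 j = 0) -> (\row_k v 0 (enum_val k)) *m select_mx A = v.
Proof.
move=> H; apply/rowP => j; case jA : (j \in A); last first.
  by rewrite mul_select_mx_notin ?jA// H ?jA.
by rewrite -[j](enum_rankK_in jA jA) mul_select_mx mxE.
Qed.

Lemma row_freeP_ker m k (M : 'M[R]_(m, k)) :
  row_free M <-> forall v : 'rV_m, v *m M = 0 -> v = 0.
Proof.
rewrite -kermx_eq0; split=> [/eqP K0 v vM|H].
  by have /sub_kermxP := vM; rewrite K0 submx0 => /eqP.
apply/negPn/negP => /rowV0Pn[v /sub_kermxP/H ->]; by rewrite eqxx.
Qed.

End Selection.

Section Dual.
Context {R : realType} {n s p q : nat}.
Local Notation idx := (idx s p q).

Definition components (c : 'rV[R]_(n + s + s) -> 'rV[R]_s) (g : 'rV[R]_(n + s + s) -> 'rV[R]_p)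
    (h : 'rV[R]_(n + s + s) -> 'rV[R]_q) (l : idx) (w : 'rV[R]_(n + s + s)) : R :=
  match l with
  | inl (inl i) => c w 0 i
  | inl (inr i) => g w 0 i
  | inr i => h w 0 i
  end.

(* Linear dependence of the rows in LIKQ, with [J_z] eliminated by transposing the triangular
   system that defines it: complementarity, stationarity in [x], and the adjoint equation, which
   is multiplied by [z i] so that it is void on the kinks. *)
Definition multiplier_at (U : idx -> 'rV[R]_(n + s + s) -> R) (x : 'rV[R]_n) (z : 'rV[R]_s) (mu : idx -> R) :=
  [/\ (forall i, U (gI i) (kink x z) * mu (gI i) = 0),
      (forall j, \sum_l mu l * dx (U l) j (kink x z) = 0) &
      (forall i, z 0 i * mu (cI i) =
        \sum_l (`|z 0 i| * dy (U l) i (kink x z) + z 0 i * dz (U l) i (kink x z)) * mu l)].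

Lemma sum_idx (F : idx -> R) :
  \sum_l F l = \sum_i F (cI i) + \sum_i F (gI i) + \sum_i F (hI i).
Proof. by rewrite big_sumType /= big_sumType. Qed.

Context (c : 'rV[R]_(n + s + s) -> 'rV[R]_s) (g : 'rV[R]_(n + s + s) -> 'rV[R]_p)
    (h : 'rV[R]_(n + s + s) -> 'rV[R]_q).
Local Notation U := (components c g h).
Hypothesis CU : forall l, Cn 1 (U l).
Hypothesis triY : forall (l i : 'I_s) w, ~~ (i < l)%N -> dy (U (cI l)) i w = 0.
Hypothesis triZ : forall (l i : 'I_s) w, ~~ (i < l)%N -> dz (U (cI l)) i w = 0.

Let Cc l : Cn 1 (fun w => c w 0 l) := CU (cI l).
Let Cg l : Cn 1 (fun w => g w 0 l) := CU (gI l).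
Let Ch l : Cn 1 (fun w => h w 0 l) := CU (hI l).

(** A vector [(va, vb, mh)] of the left kernel of the LIKQ matrix corresponds to the multiplier with
    [mg = vb P_beta] and [mc T = va P_alpha + mg K g + mh K h]. This substitution turns the kernel
    equation into stationarity in [x], and since [T] is invertible it loses nothing. *)
Lemma LIKQ_multiplier x z : ~ LIKQ c g h x z <-> exists2 mu, multiplier_at U x z mu & exists l, mu l != 0.
Proof.
set w := kink x z.
pose K b (F : 'rV[R]_(n + s + s) -> 'rV[R]_b) := D2 F w *m Sigma z + D3 F w.
pose T := 1%:M - D2 c w *m Sigma z - D3 c w.
have SigmaE b (F : 'rV[R]_(n + s + s) -> 'rV[R]_b) l i : (D2 F w *m Sigma z) l i = D2 F w l i * Num.sg (z 0 i).
  by rewrite /Sigma mul_mx_diag !mxE.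
have TE l i : T l i = (l == i)%:R - D2 c w l i * Num.sg (z 0 i) - D3 c w l i.
  have subE (A B C : 'M[R]_s) : (A - B - C) l i = A l i - B l i - C l i by rewrite !mxE.
  by rewrite /T subE SigmaE mxE.
(* By [triY] and [triZ] the matrix [T] is lower triangular with unit diagonal. *)
have Tu : T \in unitmx.
  have T0 (l i : 'I_s) : (l <= i)%N -> T l i = (l == i)%:R.
    move=> li; rewrite TE D2E// D3E// (triY (l := l)) -?leqNgt// (triZ (l := l)) -?leqNgt//.
    by rewrite mul0r !subr0.
  rewrite unitmxE det_trig; last first.
    by apply/is_trig_mxP => l i li; rewrite T0 ?(ltnW li)// -val_eqE (ltn_eqF li).
  by rewrite big1 ?unitr1// => i _; rewrite T0// eqxx.
have mulT (m : 'rV[R]_s) : m *m T = m - m *m K _ c.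
  by rewrite /T /K !mulmxBr mulmx1 mulmxDr opprD addrA.
pose M := col_mx (col_mx (select_mx (alpha z) *m Jz c x z)
   (select_mx (beta g x z) *m Jred c g x z)) (Jred c h x z).
have LE : LIKQ c g h x z <-> row_free M.
  by rewrite /LIKQ /row_free; split=> [->|/eqP].
pose good (mc : 'rV[R]_s) (mg : 'rV[R]_p) (mh : 'rV[R]_q) va vb :=
  mc *m T = va *m select_mx (alpha z) + mg *m K _ g + mh *m K _ h /\
  mg = vb *m select_mx (beta g x z).
have goodE mc mg mh va vb : good mc mg mh va vb ->
    row_mx (row_mx va vb) mh *m M = mc *m D1 c w + mg *m D1 g w + mh *m D1 h w.
  move=> [HT Hg]; rewrite /M !mul_row_col !mulmxA -Hg.
  rewrite -[join3 x (absv z) z]/w -/T.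
  have JE b (F : 'rV[R]_(n + s + s) -> 'rV[R]_b) : Jred c F x z = D1 F w + K _ F *m (invmx T *m D1 c w) by [].
  rewrite !JE !mulmxDr !mulmxA.
  have -> : va *m select_mx (alpha z) = mc *m T - mg *m K _ g - mh *m K _ h.
    by rewrite HT addrAC addrK addrK.
  rewrite !mulmxBl mulmxK//.
  have cancel (V : zmodType) (X Y Z A B : V) : X - A - B + (Y + A) + (Z + B) = X + Y + Z.
    by rewrite -[X - A - B]addrA -opprD -addrA [Y + A + _]addrACA addrACA addNr addr0 addrA.
  exact: cancel.
have good0 mc mg mh va vb : good mc mg mh va vb ->
    (row_mx (row_mx va vb) mh == 0) = [&& mc == 0, mg == 0 & mh == 0].
  move=> [HT Hg]; rewrite !row_mx_eq0; apply/idP/idP.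
    move=> /andP[/andP[/eqP va0 /eqP vb0] /eqP mh0].
    rewrite Hg vb0 mh0 va0 !mul0mx !addr0 in HT; rewrite Hg vb0 mh0 mul0mx !eqxx !andbT.
    by rewrite -(mulmxK Tu mc) HT mul0mx eqxx.
  move=> /and3P[/eqP mc0 /eqP mg0 /eqP mh0].
  rewrite mc0 mg0 mh0 !mul0mx !addr0 in HT; rewrite mg0 in Hg.
  rewrite mh0 eqxx andbT; apply/andP; split; apply/eqP/rowP => k; rewrite mxE.
    by rewrite -mul_select_mx -HT mxE.
  by rewrite -mul_select_mx -Hg mxE.
pose mul mc mg mh (l : idx) : R := match l with
  | inl (inl i) => (mc : 'rV[R]_s) 0 i
  | inl (inr i) => (mg : 'rV[R]_p) 0 i
  | inr i => (mh : 'rV[R]_q) 0 i end.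
have KE b (F : 'rV[R]_(n + s + s) -> 'rV[R]_b) (m : 'rV[R]_b) i :
    (forall l, Cn 1 (fun w => F w 0 l)) -> z 0 i * (m *m K _ F) 0 i =
    \sum_l (`|z 0 i| * dy (fun w => F w 0 l) i w + z 0 i * dz (fun w => F w 0 l) i w) * m 0 l.
  move=> CF; rewrite mxE mulr_sumr; apply: eq_bigr => l _.
  have -> : K _ F l i = D2 F w l i * Num.sg (z 0 i) + D3 F w l i by rewrite -SigmaE mxE.
  rewrite D2E// D3E// normrEsg; set d2 := dy _ _ _; set d3 := dz _ _ _; ring.
have DE b (F : 'rV[R]_(n + s + s) -> 'rV[R]_b) (m : 'rV[R]_b) j :
    (forall l, Cn 1 (fun w => F w 0 l)) -> (m *m D1 F w) 0 j = \sum_l m 0 l * dx (fun w => F w 0 l) j w.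
  by move=> CF; rewrite mxE; apply: eq_bigr => l _; rewrite D1E.
(* Multiplied by [z i], the adjoint equation says that [mc T - mg K g - mh K h] is supported on the
   kinks, that is, of the form [va P_alpha]. *)
have mulE mc mg mh : multiplier_at U x z (mul mc mg mh) <->
   [/\ (forall i, g w 0 i * mg 0 i = 0), mc *m D1 c w + mg *m D1 g w + mh *m D1 h w = 0 &
    forall i, z 0 i * (mc *m T - mg *m K _ g - mh *m K _ h) 0 i = 0].
  have addE b (X Y Z : 'rV[R]_b) i : (X + Y + Z) 0 i = X 0 i + Y 0 i + Z 0 i by rewrite !mxE.
  have subE b (X Y Z V : 'rV[R]_b) i : (X - Y - Z - V) 0 i = X 0 i - (Y 0 i + Z 0 i + V 0 i).
    by rewrite !mxE !opprD !addrA.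
  have sumD j : \sum_l mul mc mg mh l * dx (U l) j w = (mc *m D1 c w + mg *m D1 g w + mh *m D1 h w) 0 j.
    by rewrite addE !DE// sum_idx.
  have sumK i : \sum_l (`|z 0 i| * dy (U l) i w + z 0 i * dz (U l) i w) * mul mc mg mh l =
      z 0 i * mul mc mg mh (cI i) - z 0 i * (mc *m T - mg *m K _ g - mh *m K _ h) 0 i.
    rewrite mulT subE mulrBr opprB addrC subrK !mulrDr !KE// sum_idx //.
  split=> [[H1 H2 H3]|[H1 H2 H3]]; split=> //.
  - by apply/rowP => j; rewrite -sumD H2 mxE.
  - by move=> i; have /eqP := H3 i; rewrite sumK -subr_eq0 opprB addrC subrK => /eqP.
  - by move=> j; rewrite sumD H2 mxE.
  - by move=> i; rewrite sumK H3 subr0.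
split.
- move=> nL; have : ~ row_free M by move=> /LE.
  rewrite row_freeP_ker => /existsNP[v /not_implyP[vM0 /eqP vn0]].
  pose mh := rsubmx v; pose va := lsubmx (lsubmx v); pose vb := rsubmx (lsubmx v).
  pose mg := vb *m select_mx (beta g x z).
  pose mc := (va *m select_mx (alpha z) + mg *m K _ g + mh *m K _ h) *m invmx T.
  have vE : v = row_mx (row_mx va vb) mh by rewrite !hsubmxK.
  have G : good mc mg mh va vb by split=> //; rewrite /mc mulmxKV.
  exists (mul mc mg mh).
    apply/mulE; split.
    + move=> i; have [gi|gi] := boolP (i \in beta g x z).
        by move: gi; rewrite inE => /eqP ->; rewrite mul0r.
      by rewrite /mg mul_select_mx_notin// mulr0.
    + by rewrite -(goodE _ _ _ _ _ G) -vE.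
    + move=> i; have -> : mc *m T - mg *m K _ g - mh *m K _ h = va *m select_mx (alpha z).
        by rewrite G.1 addrAC addrK addrK.
      have [zi|zi] := boolP (i \in alpha z).
        by move: zi; rewrite inE => /eqP ->; rewrite mul0r.
      by rewrite mul_select_mx_notin// mulr0.
  apply: contrapT => H; move/negP: vn0; apply; rewrite {1}vE (good0 _ _ _ _ _ G).
  have mu0 l : mul mc mg mh l = 0 by apply/eqP/negPn/negP => ml; apply: H; exists l.
  apply/and3P; split; apply/eqP/rowP => i; rewrite [RHS]mxE.
  + exact: (mu0 (cI i)).
  + exact: (mu0 (gI i)).
  + exact: (mu0 (hI i)).
- move=> [mu Hmu [l0 mul0]] /LE/row_freeP_ker LI.
  pose mc := \row_i mu (cI i); pose mg := \row_i mu (gI i); pose mh := \row_i mu (hI i).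
  have muE : mu = mul mc mg mh by apply/funext => -[[i|i]|i]; rewrite /= mxE.
  move: Hmu; rewrite muE => /mulE[H1 H2 H3].
  pose nu := mc *m T - mg *m K _ g - mh *m K _ h.
  pose va := \row_k nu 0 (enum_val k) : 'rV_#|alpha z|.
  pose vb := \row_k mg 0 (enum_val k) : 'rV_#|beta g x z|.
  have G : good mc mg mh va vb.
    split; last first.
      rewrite /vb select_mx_supported// => j; rewrite inE => /negbTE gj.
      by have /eqP := H1 j; rewrite mulf_eq0 gj => /eqP.
    rewrite /va select_mx_supported; first by rewrite /nu addrAC subrK subrK.
    move=> j; rewrite inE => /negbTE zj.
    by have /eqP := H3 j; rewrite mulf_eq0 zj => /eqP.
  have /LI/eqP : row_mx (row_mx va vb) mh *m M = 0 by rewrite (goodE _ _ _ _ _ G).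
  rewrite (good0 _ _ _ _ _ G) => /and3P[/eqP mc0 /eqP mg0 /eqP mh0].
  move: mul0; rewrite muE mc0 mg0 mh0; case: l0 => [[i|i]|i]; by rewrite /= mxE eqxx.
Qed.

End Dual.

(** * Coordinate structure of switching functions *)

Section Switching.
Context {R : realType} {n s : nat}.

Definition pr (i : 'I_s) (w : 'rV[R]_(n + s + s)) : 'rV[R]_(n + i + i) :=
  join3 (lsubmx (lsubmx w)) (first_coords i (rsubmx (lsubmx w))) (first_coords i (rsubmx w)).

Definition emb (i : 'I_s) (J : 'I_(n + i + i)) : 'I_(n + s + s) :=
  match fintype.split J with
  | inl J' => match fintype.split J' with
    | inl j => lshift s (lshift s j)
    | inr k => lshift s (rshift n (widen_ord (ltnW (ltn_ord i)) k))
    end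
  | inr k => rshift (n + s) (widen_ord (ltnW (ltn_ord i)) k)
  end.

Lemma prE i w J : pr i w 0 J = w 0 (emb J).
Proof.
rewrite /pr /join3 /emb mxE; case: splitP => [J' _|k _]; last by rewrite !mxE.
by rewrite mxE; case: splitP => [j _|k _]; rewrite !mxE.
Qed.

Lemma switchingE (c : forall i : 'I_s, 'rV[R]_(n + i + i) -> R) w i :
  switching c w 0 i = c i (pr i w).
Proof. by rewrite mxE. Qed.

Lemma emb_inj i : injective (@emb i).
Proof.
have widen_inj (k k' : 'I_i) : widen_ord (ltnW (ltn_ord i)) k = widen_ord (ltnW (ltn_ord i)) k' -> k = k'.
  by move=> /(congr1 val) /= /val_inj.
move=> J1 J2; rewrite /emb.
case: (split_ordP J1) => [J1' ->|k1 ->]; case: (split_ordP J2) => [J2' ->|k2 ->].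
- case: (split_ordP J1') => [j1 ->|k1 ->]; case: (split_ordP J2') => [j2 ->|k2 ->].
  + by move=> /lshift_inj/lshift_inj ->.
  + by move=> /lshift_inj/eqP; rewrite eq_lrshift.
  + by move=> /lshift_inj/eqP; rewrite eq_rlshift.
  + by move=> /lshift_inj/rshift_inj/widen_inj ->.
- by case: (split_ordP J1') => [j3 ->|k3 ->] /eqP; rewrite eq_lrshift.
- by case: (split_ordP J2') => [j3 ->|k3 ->] /eqP; rewrite eq_rlshift.
- by move=> /rshift_inj/widen_inj ->.
Qed.

Definition emb_inv (i : 'I_s) (l : 'I_(n + s + s)) : option 'I_(n + i + i) :=
  [pick J | emb J == l].

Lemma axis_map_pr (i : 'I_s) : axis_map (emb_inv i) (pr i).
Proof.
split.
  apply/continuous_rowP => J; rewrite (_ : (fun w => _) = fun w : 'rV[R]_(n + s + s) => w 0 (emb J)).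
    exact: coord_continuous.
  by apply/funext => w; rewrite prE.
move=> l w h; apply/rowP => J; rewrite prE [RHS]mxE prE !mxE eqxx /=.
congr (_ + _); rewrite /emb_inv; case: pickP => [J' /eqP <-|noJ].
  by rewrite !mxE eqxx (inj_eq (@emb_inj i)).
by rewrite noJ mulr0 mxE.
Qed.

Lemma norm_pr_le (i : 'I_s) w b : `|w| <= b -> `|pr i w| <= b.
Proof.
move=> wb; apply: norm_rV_le => [|J]; first exact: le_trans (normr_ge0 _) wb.
by rewrite prE; exact: le_trans (norm_entry_le _ _) wb.
Qed.

(** The origin of strict triangularity: component [i'] sees only the entries of [y] with index below
    [i']. *)
Lemma emb_inv_y (i' i : 'I_s) : ~~ (i < i')%N -> emb_inv i' (lshift s (rshift n i)) = None.
Proof.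
move=> ii; rewrite /emb_inv; case: pickP => // J /eqP; rewrite /emb.
case: fintype.split => [J'|k /eqP]; last by rewrite eq_rlshift.
case: fintype.split => [j /lshift_inj/eqP|k /lshift_inj/rshift_inj E]; first by rewrite eq_lrshift.
by move: ii; rewrite -E /= ltn_ord.
Qed.

Lemma emb_inv_z (i' i : 'I_s) : ~~ (i < i')%N -> emb_inv i' (rshift (n + s) i) = None.
Proof.
move=> ii; rewrite /emb_inv; case: pickP => // J /eqP; rewrite /emb.
case: fintype.split => [J'|k /rshift_inj E]; last by move: ii; rewrite -E /= ltn_ord.
by case: fintype.split => [j /eqP|k /eqP]; rewrite eq_lrshift.
Qed.

Lemma dy_pr (i' i : 'I_s) (f : 'rV[R]_(n + i' + i') -> R) w :
  Cn 1 f -> ~~ (i < i')%N -> dy (fun w => f (pr i' w)) i w = 0.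
Proof.
move=> /CnS[_ df _] ii; have [_ E] := pd_axis_comp w (lshift s (rshift n i)) (axis_map_pr i') df.
by rewrite /dy E emb_inv_y.
Qed.

Lemma dz_pr (i' i : 'I_s) (f : 'rV[R]_(n + i' + i') -> R) w :
  Cn 1 f -> ~~ (i < i')%N -> dz (fun w => f (pr i' w)) i w = 0.
Proof.
move=> /CnS[_ df _] ii; have [_ E] := pd_axis_comp w (rshift (n + s) i) (axis_map_pr i') df.
by rewrite /dz E emb_inv_z.
Qed.

Lemma pd_pr_lipschitz (i : 'I_s) (f : 'rV[R]_(n + i + i) -> R) b l :
  (forall v J, derivable f v (delta_mx 0 J)) ->
  (forall J, lipschitz_on_box b (pd J f)) ->
  lipschitz_on_box b (pd l (fun w => f (pr i w))).
Proof.
move=> df Lf.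
have E w : pd l (fun w => f (pr i w)) w = if emb_inv i l is Some J then pd J f (pr i w) else 0.
  by have [_ ->] := pd_axis_comp w l (axis_map_pr i) df.
case El : (emb_inv i l) => [J|]; last first.
  exists 0 => // w w' _ _; rewrite !E El subrr normr0 mul0r//.
have [K K0 H] := Lf J; exists K => // w w' wb w'b; rewrite !E El.
have [h1 h2] := H _ _ (norm_pr_le i wb) (norm_pr_le i w'b); split=> //.
rewrite (le_trans h2)// ler_wpM2l//; apply: norm_rV_le => // k.
have subE a (u v : 'rV[R]_a) j : (u - v) 0 j = u 0 j - v 0 j by rewrite !mxE.
by rewrite subE !prE -subE; exact: norm_entry_le.
Qed.

(** Induction on the index: [z 0 i] is, up to 1, a continuous function of [x] and of earlier entries
    already bounded. The slack 1 lets one bound serve all switching functions near [c]. *)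
Lemma feasible_bound (c : forall i : 'I_s, 'rV[R]_(n + i + i) -> R) (B : R) :
  (forall i, continuous (c i)) -> exists2 M, 0 < M & forall (x : 'rV[R]_n) (z : 'rV[R]_s), `|x| <= B ->
    (forall i, `|z 0 i - c i (pr i (kink x z))| <= 1) -> `|z| <= M.
Proof.
move=> cc.
have main (m : nat) : (m <= s)%N -> exists2 M, 0 < M & forall (x : 'rV[R]_n) (z : 'rV[R]_s), `|x| <= B ->
    (forall i, `|z 0 i - c i (pr i (kink x z))| <= 1) -> forall i : 'I_s, (i < m)%N -> `|z 0 i| <= M.
  elim: m => [|m IH] ms; first by exists 1.
  have [M M0 H] := IH (ltnW ms).
  have [K K0 HK] := continuous_box_bound (`|B| + M) (cc (Ordinal ms)).
  exists (M + (K + 1)); first by rewrite !addr_gt0.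
  move=> x z xB zc i; rewrite ltnS leq_eqVlt => /orP[/eqP im|im]; last first.
    by apply: le_trans (H x z xB zc i im) _; rewrite lerDl addr_ge0// ltW.
  have -> : i = Ordinal ms by exact: val_inj.
  have prb : `|pr (Ordinal ms) (kink x z)| <= `|B| + M.
    have xB' : `|x| <= `|B| + M.
      by rewrite (le_trans xB)// (le_trans (ler_norm _))// lerDl ltW.
    apply: norm_rV_le => [|J]; first by rewrite addr_ge0// ltW.
    have zb (k : 'I_m) : `|z 0 (widen_ord (ltnW ms) k)| <= `|B| + M.
      by rewrite (le_trans (H x z xB zc _ _)) ?lerDr//=.
    rewrite /pr /kink /join3 !mxE; case: splitP => [J' _|k _].
      rewrite mxE; case: splitP => [j _|k _].
        by rewrite row_mxKl row_mxKl; exact: le_trans (norm_entry_le _ _) xB'.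
      rewrite row_mxKl row_mxKr !mxE normr_id.
      by rewrite (_ : widen_ord _ _ = widen_ord (ltnW ms) k); [exact: zb|exact: val_inj].
    rewrite row_mxKr mxE.
    by rewrite (_ : widen_ord _ _ = widen_ord (ltnW ms) k); [exact: zb|exact: val_inj].
  have := zc (Ordinal ms); have := HK _ prb; set y := c _ _ => h1 h2.
  rewrite -[z 0 _](subrK y) (le_trans (ler_normD _ _))// addrC.
  by rewrite (le_trans (lerD h1 h2))// lerDr ltW.
have [M M0 H] := main s (leqnn s); exists M => // x z xB zc.
by apply: norm_rV_le => [|i]; [exact: ltW|exact: (H x z xB zc i (ltn_ord i))].
Qed.

End Switching.

(** * Stability on compact shells *)

Section Stability.
Context {R : realType} {n s p q : nat}.
Local Notation idx := (idx s p q).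
Implicit Types U V : idx -> 'rV[R]_(n + s + s) -> R.

Definition feasible_at U (x : 'rV[R]_n) (z : 'rV[R]_s) :=
  [/\ forall i, z 0 i = U (cI i) (kink x z), forall i, 0 <= U (gI i) (kink x z) &
      forall i, U (hI i) (kink x z) = 0].

Definition defect U x z := feasible_at U x z /\ exists2 mu, multiplier_at U x z mu & exists l, mu l != 0.

Let point := ('rV[R]_n * 'rV[R]_s * 'rV[R]_#|{: idx}|)%type.
Let muof (e : point) (l : idx) : R := e.2 0 (enum_rank l).
Let kinkof (e : point) := kink e.1.1 e.1.2.
Let T := ('I_s + 'I_q + 'I_p + 'I_p + 'I_n + 'I_s)%type.

(* The sign condition [0 <= g] is encoded by [`|g| - g = 0], so that a defect becomes a zero of
   continuous functions. *)
Definition residual U (e : point) (t : T) : R :=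
  match t with
  | inl (inl (inl (inl (inl i)))) => e.1.2 0 i - U (cI i) (kinkof e)
  | inl (inl (inl (inl (inr i)))) => U (hI i) (kinkof e)
  | inl (inl (inl (inr i))) => `|U (gI i) (kinkof e)| - U (gI i) (kinkof e)
  | inl (inl (inr i)) => U (gI i) (kinkof e) * muof e (gI i)
  | inl (inr j) => \sum_l muof e l * dx (U l) j (kinkof e)
  | inr i => e.1.2 0 i * muof e (cI i) - \sum_l (`|e.1.2 0 i| * dy (U l) i (kinkof e)
       + e.1.2 0 i * dz (U l) i (kinkof e)) * muof e l
  end.

Lemma residual_defect U e : (forall t, residual U e t = 0) -> e.2 != 0 -> defect U e.1.1 e.1.2.
Proof.
move=> H e0; split.
  split=> i.
  - by apply/eqP; rewrite -subr_eq0; apply/eqP; exact: (H (inl (inl (inl (inl (inl i)))))).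
  - have /= /eqP := H (inl (inl (inl (inr i)))); rewrite subr_eq0 => /eqP; by rewrite /kinkof => <-.
  - exact: (H (inl (inl (inl (inl (inr i)))))).
exists (muof e).
  split=> i.
  - exact: (H (inl (inl (inr i)))).
  - exact: (H (inl (inr i))).
  - by apply/eqP; rewrite -subr_eq0; apply/eqP; exact: (H (inr i)).
apply: contrapT => K; move/eqP: e0; apply; apply/rowP => k; rewrite mxE.
apply: contrapT => /eqP ek; apply: K; exists (enum_val k).
by rewrite /muof enum_valK.
Qed.

(** The conditions on the multiplier are homogeneous, so it may be scaled to the unit sphere, which
    is compact and avoids 0. *)
Lemma defect_residual U x z : defect U x z -> exists2 m, `|m| = 1 & forall t, residual U (x, z, m) t = 0.
Proof.
move=> [[z1 g1 h1] [mu [m1 m2 m3] [l mul]]].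
pose m0 : 'rV[R]_#|{: idx}| := \row_k mu (enum_val k).
have m0n : `|m0| != 0.
  rewrite normr_eq0; apply/eqP => /rowP/(_ (enum_rank l)); rewrite !mxE enum_rankK => E.
  by rewrite E eqxx in mul.
pose k := `|m0|^-1; exists (k *: m0).
  by rewrite normrZ /k normfV normr_id mulVf.
have muE l' : muof (x, z, k *: m0) l' = k * mu l' by rewrite /muof !mxE enum_rankK.
have kE : kinkof (x, z, k *: m0) = kink x z by [].
move=> [[[[[i|i]|i]|i]|j]|i] /=; rewrite ?kE ?muE.
- by rewrite -z1 subrr.
- exact: h1.
- by rewrite ger0_norm ?subrr.
- by rewrite mulrCA m1 mulr0.
- by rewrite -[RHS](mulr0 k) -[in RHS](m2 j) mulr_sumr; apply: eq_bigr => l' _; rewrite muE mulrA.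
- rewrite mulrCA m3 mulr_sumr -sumrB big1// => l' _; rewrite muE; ring.
Qed.

Let continuous_x j : continuous (fun e : point => e.1.1 0 j).
Proof.
have c1 : continuous (fun e : point => e.1.1).
  by move=> e; apply: (@continuous_comp _ _ _ fst fst); exact: cvg_fst.
exact: (continuous_composite (g := fun v : 'rV[R]_n => v 0 j) c1 (@coord_continuous _ _ _ _ _)).
Qed.

Let continuous_z j : continuous (fun e : point => e.1.2 0 j).
Proof.
have c1 : continuous (fun e : point => e.1.2).
  by move=> e; apply: (@continuous_comp _ _ _ fst snd); [exact: cvg_fst|exact: cvg_snd].
exact: (continuous_composite (g := fun v : 'rV[R]_s => v 0 j) c1 (@coord_continuous _ _ _ _ _)).
Qed.

Let continuous_mu l : continuous (fun e : point => muof e l).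
Proof.
have c1 : continuous (fun e : point => e.2) by move=> e; exact: cvg_snd.
exact: (continuous_composite (g := fun v : 'rV[R]_#|{: idx}| => v 0 (enum_rank l)) c1 (@coord_continuous _ _ _ _ _)).
Qed.

Let continuous_kink : continuous kinkof.
Proof.
apply/continuous_rowP => J; rewrite /kinkof /kink /join3.
case: (split_ordP J) => [J' ->|i ->]; last first.
  rewrite (_ : (fun e => _) = fun e : point => e.1.2 0 i); first exact: continuous_z.
  by apply/funext => e; rewrite row_mxEr.
case: (split_ordP J') => [j ->|i ->].
  rewrite (_ : (fun e => _) = fun e : point => e.1.1 0 j); first exact: continuous_x.
  by apply/funext => e; rewrite row_mxEl row_mxEl.
rewrite (_ : (fun e => _) = fun e : point => `|e.1.2 0 i|); first exact/continuous_norm/continuous_z.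
by apply/funext => e; rewrite row_mxEl row_mxEr mxE.
Qed.

Let continuous_residual U t : (forall l, Cn 1 (U l)) -> continuous (fun e => residual U e t).
Proof.
move=> CU.
have cU l : continuous (fun e => U l (kinkof e)).
  exact: (continuous_composite continuous_kink (Cn_continuous (CU l))).
have cD l J : continuous (fun e => pd J (U l) (kinkof e)).
  have /CnS[_ _ cd] := CU l.
  exact: (continuous_composite (g := pd J (U l)) continuous_kink (cd J)).
case: t => [[[[[i|i]|i]|i]|j]|i] /=.
- by apply: continuous_add; [exact: continuous_z|apply: continuous_opp; exact: cU].
- exact: cU.
- by apply: continuous_add; [apply: continuous_norm; exact: cU|apply: continuous_opp; exact: cU].
- by apply: continuous_mul; [exact: cU|exact: continuous_mu].
- by apply: continuous_bigsum => l; apply: continuous_mul; [exact: continuous_mu|exact: cD].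
- apply: continuous_add; first by apply: continuous_mul; [exact: continuous_z|exact: continuous_mu].
  apply: continuous_opp; apply: continuous_bigsum => l; apply: continuous_mul; last exact: continuous_mu.
  apply: continuous_add; apply: continuous_mul; try exact: cD; last exact: continuous_z.
  by apply: continuous_norm; exact: continuous_z.
Qed.

Definition close_at eta U V w := forall l : idx,
  `|U l w - V l w| <= eta /\ forall J, `|pd J (U l) w - pd J (V l) w| <= eta.

(** The 2 comes from [|g| - g], and [2 * b] from a summand of the adjoint equation, in which two
    derivatives are multiplied by an entry of [z]. *)
Lemma residual_close U V x z m b eta : 1 <= b -> 0 <= eta -> `|x| <= b -> `|z| <= b -> `|m| <= 1 ->
  close_at eta U V (kink x z) -> forall t,
  `|residual U (x, z, m) t - residual V (x, z, m) t| <= (2 + 2 * b * #|{: idx}|%:R) * eta.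
Proof.
move=> b1 eta0 xb zb mb H.
have b0 : 0 <= b by exact: le_trans b1.
have [H1 H2] := all_and2 H.
have mub l : `|muof (x, z, m) l| <= 1 by exact: le_trans (norm_entry_le _ _) mb.
have zbi i : `|z 0 i| <= b by exact: le_trans (norm_entry_le _ _) zb.
have B0 : 0 <= 2 * b * #|{: idx}|%:R * eta by rewrite !mulr_ge0.
have term_close (y d d' e e' k : R) : `|y| <= b -> `|k| <= 1 -> `|d - d'| <= eta -> `|e - e'| <= eta ->
    `|(`|y| * d + y * e) * k - (`|y| * d' + y * e') * k| <= 2 * b * eta.
  move=> yb kb dd ee; rewrite -mulrBl opprD addrACA -!mulrBr normrM -[leRHS]mulr1 ler_pM//.
  rewrite (le_trans (ler_normD _ _))// !normrM normr_id.
  by rewrite (_ : 2 * b * eta = b * eta + b * eta); [rewrite lerD// ler_pM|ring].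
have to2 (y : R) : `|y| <= 2 * eta -> `|y| <= (2 + 2 * b * #|{: idx}|%:R) * eta.
  by move=> /le_trans; apply; rewrite [leRHS]mulrDl lerDl.
have to1 (y : R) : `|y| <= eta -> `|y| <= (2 + 2 * b * #|{: idx}|%:R) * eta.
  by move=> h; apply: to2; rewrite (le_trans h)// mulr_natl mulr2n lerDl.
have tosum (F : idx -> R) : (forall l, `|F l| <= 2 * b * eta) ->
    `|\sum_l F l| <= (2 + 2 * b * #|{: idx}|%:R) * eta.
  move=> HF; rewrite (le_trans (ler_norm_sum _ _ _))//.
  rewrite (le_trans (ler_sum _ (fun l _ => HF l)))// sumr_const -[_ *+ _]mulr_natr.
  by rewrite [leRHS]mulrDl [leLHS]mulrAC lerDr mulr_ge0.
move=> [[[[[i|i]|i]|i]|j]|i] /=; rewrite -/(kinkof _) /kinkof /=.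
- by apply: to1; rewrite opprD addrACA subrr add0r opprK addrC distrC; exact: H1.
- by apply: to1; exact: H1.
- apply: to2; rewrite opprD addrACA opprK (le_trans (ler_normD _ _))// mulr_natl mulr2n lerD//.
    by rewrite (le_trans (ler_dist_dist _ _))//; exact: H1.
  by rewrite addrC distrC; exact: H1.
- by apply: to1; rewrite -mulrBl normrM -[leRHS]mulr1 ler_pM//; exact: H1.
- rewrite -sumrB; apply: tosum => l; rewrite -mulrBr normrM ler_pM//; last exact: H2.
  by rewrite (le_trans (mub l))//; nra.
- rewrite opprD addrACA subrr add0r opprK addrC -sumrB -normrN -sumrN; apply: tosum => l.
  by rewrite normrN; apply: term_close; [exact: zbi|exact: mub|rewrite distrC; exact: H2|rewrite distrC; exact: H2].
Qed.

Lemma stability U (lo hi M : R) : (forall l, Cn 1 (U l)) ->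
  (forall x z, lo <= `|x| <= hi -> `|z| <= M -> ~ defect U x z) ->
  exists2 eta : R, 0 < eta & forall V x z, lo <= `|x| <= hi -> `|z| <= M ->
    close_at eta U V (kink x z) -> ~ defect V x z.
Proof.
move=> CU HU.
pose A := [set x : 'rV[R]_n | lo <= `|x| <= hi].
pose B := [set z : 'rV[R]_s | `|z| <= M].
pose S := [set m : 'rV[R]_#|{: idx}| | `|m| = 1].
have normc a : continuous (fun v : 'rV[R]_a => `|v|) by exact: norm_continuous.
have cA : compact A.
  apply: (subclosed_compact _ (@compact_box R n hi)); last by move=> x /andP[].
  rewrite (_ : A = ((fun v : 'rV[R]_n => `|v|) @^-1` [set y | lo <= y]) `&`
     ((fun v : 'rV[R]_n => `|v|) @^-1` [set y | y <= hi])).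
    by apply: closedI; apply: closed_comp; move=> *; try exact: normc; [exact: closed_ge|exact: closed_le].
  by apply/seteqP; split=> x /= => [/andP|] [h1 h2] //; rewrite /A /= h1 h2.
have cB : compact B by exact: compact_box.
have cS : compact S.
  apply: (subclosed_compact _ (@compact_box R _ 1)); last by move=> x /= ->.
  apply: (@closed_comp _ _ (fun v : 'rV[R]_#|{: idx}| => `|v|) [set y | y = 1]) => [v _|]; first exact: normc.
  exact: closed_eq.
have cK : compact (A `*` B `*` S) by apply: compact_setX => //; exact: compact_setX.
pose Psi (e : point) := \sum_t `|residual U e t|.
have cPsi : continuous Psi.
  by apply: continuous_bigsum => t; apply: continuous_norm; exact: continuous_residual.
(* The compact set can be empty, for instance when there are no components at all; then no defect is
   possible and any [eta] will do. *)
have [K0|/set0P/negP/negPn/eqP K0] := pselect (A `*` B `*` S !=set0); last first.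
  exists 1 => // V x z xA zB _ /defect_residual[m m1 _].
  have : (A `*` B `*` S) (x, z, m) by [].
  by rewrite K0.
have [e eK emin] := compact_EVT_min K0 cK (continuous_subspaceT cPsi).
have Psi0 : 0 < Psi e.
  rewrite lt_neqAle sumr_ge0// andbT eq_sym; apply/negP => /eqP P0.
  rewrite inE in eK; case: eK => -[/= eA eB] eS.
  apply: (HU e.1.1 e.1.2) => //; apply: residual_defect.
    move=> t; apply/eqP; rewrite -normr_le0.
    move: P0; rewrite /Psi (bigD1 t)//= => P0.
    by rewrite -P0 lerDl sumr_ge0.
  by rewrite -normr_eq0 eS oner_eq0.
pose b := 1 + `|hi| + `|M|.
have b1 : 1 <= b by rewrite /b -addrA lerDl addr_ge0.
pose C := (2 + 2 * b * #|{: idx}|%:R) * (1 + #|{: T}|%:R).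
have C0 : 0 < C.
  rewrite mulr_gt0// ?ltr_pwDl// mulr_ge0// mulr_ge0//; exact: le_trans b1.
(* A perturbation of size [eta] moves the sum of residuals by at most [C * eta], here half of its
   minimum. *)
exists (Psi e / (2 * C)) => [|V x z xA zB HV]; first by rewrite divr_gt0// mulr_gt0.
move=> /defect_residual[m m1 Vm].
have /emin : (x, z, m) \in A `*` B `*` S by rewrite inE.
rewrite leNgt => /negP; apply.
have eta0 : 0 <= Psi e / (2 * C) by rewrite divr_ge0// ltW// mulr_gt0.
have xb : `|x| <= b.
  by have /andP[_ h] := xA; rewrite (le_trans h)// (le_trans (ler_norm _))// /b addrAC lerDr addr_ge0.
have zb : `|z| <= b by rewrite (le_trans zB)// (le_trans (ler_norm _))// /b lerDr addr_ge0.
have mle : `|m| <= 1 by rewrite m1.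
have rc := residual_close b1 eta0 xb zb mle HV.
apply: (@le_lt_trans _ _ (C * (Psi e / (2 * C)))); last first.
  rewrite (_ : _ * _ = Psi e / 2); first by rewrite ltr_pdivrMr// ltr_pMr// ltr1n.
  by field; rewrite gt_eqF.
apply: (@le_trans _ _ (\sum_(t : T) (2 + 2 * b * #|{: idx}|%:R) * (Psi e / (2 * C)))).
  by apply: ler_sum => t _; have := rc t; rewrite Vm subr0.
rewrite sumr_const -[_ *+ _]mulr_natr /C mulrAC ler_wpM2r// ler_wpM2l// ?lerDr//.
by rewrite addr_ge0// mulr_ge0// mulr_ge0//; exact: le_trans b1.
Qed.

End Stability.

(** * Neighbourhoods in the Whitney topology *)

Definition whitney_order (k : option nat) (m : nat) : Prop := if k is Some j then m = j else True.

Section WhitneyTopology.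
Context {R : realType} {k : option nat} {a : nat} {W : normedModType R}.
Implicit Types u v : Ck_fun R k a W.

(** One tolerance for each integer part of the norm replaces a continuous error function; no
    continuity has to be arranged when a perturbation is built. *)
Definition whitney_close (m : nat) (tau : nat -> R) u v :=
  forall w mu, (size mu <= m)%N -> `|partial mu u w - partial mu v w| < tau (Num.truncn `|w|).

Lemma nbhs_whitney_nbhd u (m : nat) (eps : 'rV[R]_a -> R) :
  whitney_order k m -> continuous eps -> (forall w, 0 < eps w) ->
  nbhs u (whitney_nbhd m u eps).
Proof.
move=> mk ceps eps0; set B := whitney_nbhd _ _ _.
exists B; split=> //; last by move=> w mu _; rewrite subrr normr0.
exists [set B]; last by rewrite predeqE => v; split=> [[_ ->]|Bv] //; exists B.
by move=> _ ->; apply: (finI_from1 id); exists m, u, eps.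
Qed.

(** Because this is a filter, comparing it with the neighbourhoods of [u] reduces to subbasic
    sets. *)
Definition whitney_filter u : set_system (Ck_fun R k a W) :=
  [set V | exists m tau, [/\ leq_order m k, forall N, 0 < tau N &
    forall v, whitney_close m tau u v -> V v]].

Lemma whitney_close_le m m' tau tau' u v : (m <= m')%N -> (forall N, tau' N <= tau N) ->
  whitney_close m' tau' u v -> whitney_close m tau u v.
Proof.
by move=> mm' tt' H w mu smu; apply: lt_le_trans (tt' _); apply: H; exact: leq_trans mm'.
Qed.

Lemma leq_order_max m m' : leq_order m k -> leq_order m' k -> leq_order (maxn m m') k.
Proof. by case: k => //= j; rewrite geq_max => -> ->. Qed.

#[global] Instance whitney_filter_filter u : Filter (whitney_filter u).
Proof.
split.
- by exists 0%N, (fun=> 1); split=> //; case: k.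
- move=> P Q [m [t [mk t0 HP]]] [m' [t' [mk' t'0 HQ]]].
  exists (maxn m m'), (fun N => Num.min (t N) (t' N)); split=> [|N|v H].
  + exact: leq_order_max.
  + by rewrite lt_min t0 t'0.
  + split; [apply: HP|apply: HQ]; apply: whitney_close_le H => [|N].
    * exact: leq_maxl.
    * by rewrite ge_min lexx.
    * exact: leq_maxr.
    * by rewrite ge_min lexx orbT.
- by move=> P Q PQ [m [t [mk t0 HP]]]; exists m, t; split=> // v /HP/PQ.
Qed.

(** The centre [phi] differs from [u], but the slack [eps w] minus the distance of the derivatives
    at [w] is continuous and positive, hence bounded below on every ball. *)
Lemma whitney_filter_nbhd u (m : nat) (phi : Ck_fun R k a W) (eps : 'rV[R]_a -> R) :
  whitney_order k m -> continuous eps ->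
  whitney_nbhd m phi eps u -> whitney_filter u (whitney_nbhd m phi eps).
Proof.
move=> mk ceps Hu.
have mk' : leq_order m k by case: k mk => //= j ->.
have cont (mu : seq 'I_a) : (size mu <= m)%N -> continuous (fun w => eps w - `|partial mu phi w - partial mu u w|).
  move=> smu; have smu' : leq_order (size mu) k by exact: leq_order_trans mk'.
  have [c1 _] := Ck_valP phi; have [c2 _] := Ck_valP u.
  apply: continuous_add => //; apply: continuous_opp; apply: continuous_norm.
  by apply: continuous_add; [exact: c1|apply: continuous_opp; exact: c2].
have step (N : nat) : exists2 t : R, 0 < t & forall w mu, (size mu <= m)%N -> `|w| <= N.+1%:R ->
    t <= eps w - `|partial mu phi w - partial mu u w|.
  (* Lists of length at most [m], presented as a finite type. *)
  have [||K K0 HK] := @finite_upper_bound R {i : 'I_m.+1 & i.-tuple 'I_a}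
    (fun mu K => 0 < K /\ forall w : 'rV[R]_a, `|w| <= N.+1%:R ->
      K^-1 <= eps w - `|partial (tagged mu) phi w - partial (tagged mu) u w|).
  - move=> mu x y xy [x0 H]; split=> [|w wN]; first exact: lt_le_trans xy.
    by apply: le_trans (H w wN); rewrite lef_pV2// posrE// (lt_le_trans x0).
  - move=> [i mu]; have smu : (size mu <= m)%N by rewrite size_tuple -ltnS.
    have [|t t0 H] := continuous_box_min N.+1%:R (cont _ smu).
      by move=> w; rewrite subr_gt0; exact: Hu.
    by exists t^-1; rewrite invr_gt0 invrK; split.
  exists K^-1 => [|w mu smu wN]; first by rewrite invr_gt0.
  have [_] := HK (Tagged (fun i : 'I_m.+1 => i.-tuple 'I_a) (in_tuple mu : (Ordinal (smu : (size mu < m.+1)%N)).-tuple 'I_a)).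
  by apply.
have /choice[tau Htau] : forall N, exists t : R, 0 < t /\ forall w mu, (size mu <= m)%N -> `|w| <= N.+1%:R ->
    t <= eps w - `|partial mu phi w - partial mu u w|.
  by move=> N; have [t t0 H] := step N; exists t.
exists m, tau; split=> // [N|v Hv w mu smu]; first by have [] := Htau N.
have [_ H] := Htau (Num.truncn `|w|).
have wN : `|w| <= (Num.truncn `|w|).+1%:R.
  by have /andP[_ /ltW] := truncn_itv (normr_ge0 w).
have := H w mu smu wN; rewrite lerBrDr => h.
rewrite (le_lt_trans (ler_distD (partial mu u w) _ _))//.
by apply: lt_le_trans h; rewrite addrC ltrD2r; exact: Hv.
Qed.

Lemma nbhs_whitney_filter u V : nbhs u V -> whitney_filter u V.
Proof.
move=> [_ [[B sB <-] [C BC Ct] sUBA]].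
apply: filterS sUBA _; apply: (@filterS _ _ _ C).
  by move=> ? ?; exists C.
have /sB [D sD IDeC] := BC; rewrite -IDeC; apply: filter_bigI => E DE.
have Eu : E u by move: Ct; rewrite -IDeC => /(_ _ DE).
have /sD := DE; rewrite inE => -[m [phi [eps [mk ceps _ EE]]]].
by rewrite EE in Eu *; exact: whitney_filter_nbhd.
Qed.

End WhitneyTopology.

(** * Tuples of functions and the product topology *)

Section Families.
Context {R : realType} (n s p q : nat) (k : option nat).
Local Notation idx := (idx s p q).

Definition tuples := (prod_topology (fun i : 'I_s => Ck_fun R k (n + i + i) R)
            * Ck_fun R k (n + s + s) 'rV[R]_p
            * Ck_fun R k (n + s + s) 'rV[R]_q)%type.

Definition dm (l : idx) : nat := match l with inl (inl i) => i | _ => s end.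
Definition domain (l : idx) := 'rV[R]_(n + dm l + dm l).

(** Splits [g] and [h] into real components, so that all constituents of a tuple are treated alike,
    each on its own domain. *)
Definition scalars (u : tuples) (l : idx) : domain l -> R :=
  match l return domain l -> R with
  | inl (inl i) => u.1.1 i
  | inl (inr j) => fun w => u.1.2 w 0 j
  | inr j => fun w => u.2 w 0 j
  end.

Definition family_close (m : nat) (tau : nat -> R) (u v : tuples) :=
  forall l w mu, (size mu <= m)%N ->
    `|partial mu (scalars u (l := l)) w - partial mu (scalars v (l := l)) w| < tau (Num.truncn `|w|).

Lemma partial_row_close a r (f g : Ck_fun R k a 'rV[R]_r) m (e : R) w mu :
  leq_order m k -> (size mu <= m)%N -> 0 < e ->
  (forall j, `|partial mu (fun w => f w 0 j) w - partial mu (fun w => g w 0 j) w| < e) <->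
  `|partial mu f w - partial mu g w| < e.
Proof.
move=> mk smu e0.
have Cf : Cn m f by exact: (CkP k f).1 (Ck_valP f) m mk.
have Cg : Cn m g by exact: (CkP k g).1 (Ck_valP g) m mk.
have E j : (partial mu f w - partial mu g w) 0 j =
  partial mu (fun w => f w 0 j) w - partial mu (fun w => g w 0 j) w.
  by rewrite !mxE (partial_row _ _ Cf smu) (partial_row _ _ Cg smu).
split=> [H|H j]; first by apply: norm_rV_lt => // j; rewrite E.
by rewrite -E; apply: le_lt_trans H; exact: norm_entry_le.
Qed.

(** Over the finitely many factors, orders combine by maximum and tolerances by minimum. This is the
    form in which density is tested. *)
Lemma nbhs_family_close (u : tuples) (V : set tuples) : nbhs u V ->
  exists m tau, [/\ leq_order m k, forall N, 0 < tau N & forall v, family_close m tau u v -> V v].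
Proof.
case: u => -[uc ug] uh [[/= B D] [[[/= A E] [nA nE] AEB] nD] BDV].
have [mg [tg [mgk tg0 Hg]]] := nbhs_whitney_filter nE.
have [mh [th [mhk th0 Hh]]] := nbhs_whitney_filter nD.
pose F : set_system (prod_topology (fun i : 'I_s => Ck_fun R k (n + i + i) R)) :=
  [set P | exists m tau, [/\ leq_order m k, forall N, 0 < tau N &
    forall v, (forall i, whitney_close m tau (uc i) (v i)) -> P v]].
have FF : Filter F.
  split.
  - by exists 0%N, (fun=> 1); split=> //; case: k.
  - move=> P Q [m [t [mk t0 HP]]] [m' [t' [mk' t'0 HQ]]].
    exists (maxn m m'), (fun N => Num.min (t N) (t' N)); split=> [|N|v H].
    + exact: leq_order_max.
    + by rewrite lt_min t0 t'0.
    + split; [apply: HP|apply: HQ] => i; apply: whitney_close_le (H i) => [|N].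
      * exact: leq_maxl.
      * by rewrite ge_min lexx.
      * exact: leq_maxr.
      * by rewrite ge_min lexx orbT.
  - by move=> P Q PQ [m [t [mk t0 HP]]]; exists m, t; split=> // v /HP/PQ.
have [mc [tc [mck tc0 Hc]]] : F A.
  (* The product topology is a supremum of initial topologies, so convergence is checked one
     projection at a time. *)
  suff cF : F --> (uc : prod_topology (fun i : 'I_s => Ck_fun R k (n + i + i) R)) by exact: cF.
  apply/cvg_sup => i P [_ [[B' oB' <-] Bu] BP].
  have /nbhs_whitney_filter[m [t [mk t0 H]]] : nbhs (uc i) B' by exact: open_nbhs_nbhs.
  by exists m, t; split=> // v Hv; apply: BP; apply: H; exact: Hv.
pose m := maxn (maxn mc mg) mh.
pose t N := Num.min (Num.min (tc N) (tg N)) (th N).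
exists m, t; split=> [|N|[[vc vg] vh] Hv].
- by apply: leq_order_max => //; exact: leq_order_max.
- by rewrite !lt_min tc0 tg0 th0.
have mk : leq_order m k by apply: leq_order_max => //; exact: leq_order_max.
have t0 N : 0 < t N by rewrite !lt_min tc0 tg0 th0.
apply: BDV; split=> /=; first (apply: AEB; split=> /=).
- apply: Hc => i; apply: (@whitney_close_le _ _ _ _ _ m _ t) => [|N|].
  + by rewrite /m -maxnA leq_maxl.
  + by rewrite !ge_min lexx.
  + by move=> w mu smu; exact: (Hv (cI i) w mu smu).
- apply: Hg; apply: (@whitney_close_le _ _ _ _ _ m _ t) => [|N|].
  + by rewrite /m maxnAC leq_maxr.
  + by rewrite !ge_min lexx orbT.
  + move=> w mu smu; apply/(partial_row_close _ _ _ mk smu) => // j.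
    exact: (Hv (gI j) w mu smu).
- apply: Hh; apply: (@whitney_close_le _ _ _ _ _ m _ t) => [|N|].
  + exact: leq_maxr.
  + by rewrite ge_min lexx orbT.
  + move=> w mu smu; apply/(partial_row_close _ _ _ mk smu) => // j.
    exact: (Hv (hI j) w mu smu).
Qed.

Definition xpart (l : idx) (w : domain l) : 'rV[R]_n := lsubmx (lsubmx w).

Lemma continuous_lsubmx a b : continuous (fun w : 'rV[R]_(a + b) => lsubmx w).
Proof.
apply/continuous_rowP => j; rewrite (_ : (fun w => _) = fun w : 'rV[R]_(a + b) => w 0 (lshift b j)).
  exact: coord_continuous.
by apply/funext => w; rewrite mxE.
Qed.

Lemma continuous_norm_xpart a b : continuous (fun w : 'rV[R]_(n + a + b) => `|lsubmx (lsubmx w)|).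
Proof.
have c : continuous (fun w : 'rV[R]_(n + a + b) => lsubmx (lsubmx w)).
  exact: (continuous_composite (g := fun v : 'rV[R]_(n + a) => lsubmx v) (@continuous_lsubmx _ _) (@continuous_lsubmx _ _)).
exact: continuous_norm.
Qed.

Lemma nbhs_family_near (u : tuples) (E : R -> R) : leq_order 1 k -> continuous E -> (forall t, 0 < E t) ->
  nbhs u [set v : tuples | forall l w mu, (size mu <= 1)%N ->
    `|partial mu (scalars u (l := l)) w - partial mu (scalars v (l := l)) w| < E `|xpart w|].
Proof.
move=> k1 cE E0; pose m := if k is Some j then j else 1%N.
have mk : whitney_order k m by rewrite /m; case: k.
have m1 : (1 <= m)%N by rewrite /m; case: k k1.
have mk' : leq_order m k by rewrite /m; case: k k1 => //=.
have cEx a b : continuous (fun w : 'rV[R]_(n + a + b) => E `|lsubmx (lsubmx w)|).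
  exact: (continuous_composite (@continuous_norm_xpart a b) cE).
case: u => -[uc ug] uh.
pose eps a := fun w : 'rV[R]_(n + a + a) => E `|lsubmx (lsubmx w)|.
have nA : nbhs (uc : prod_topology (fun i : 'I_s => Ck_fun R k (n + i + i) R))
    [set v | forall i, whitney_nbhd m (uc i) (eps i) (v i)].
  suff H i : nbhs (uc : prod_topology (fun i : 'I_s => Ck_fun R k (n + i + i) R))
      [set v | whitney_nbhd m (uc i) (eps i) (v i)].
    have HH := filter_forall (F := nbhs (uc : prod_topology (fun i : 'I_s => Ck_fun R k (n + i + i) R))) _ H.
    exact: HH.
  have nB : nbhs (uc i) (whitney_nbhd m (uc i) (eps i)).
    by apply: nbhs_whitney_nbhd => [||w]; [exact: mk|exact: (cEx i i)|exact: E0].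
  exact: (@proj_continuous _ (fun i : 'I_s => Ck_fun R k (n + i + i) R) i uc _ nB).
have nB : nbhs ug (whitney_nbhd m ug (eps s)).
  by apply: nbhs_whitney_nbhd => [||w]; [exact: mk|exact: (cEx s s)|exact: E0].
have nD : nbhs uh (whitney_nbhd m uh (eps s)).
  by apply: nbhs_whitney_nbhd => [||w]; [exact: mk|exact: (cEx s s)|exact: E0].
exists ([set v | (forall i, whitney_nbhd m (uc i) (eps i) (v.1 i)) /\ whitney_nbhd m ug (eps s) v.2],
  whitney_nbhd m uh (eps s)).
  split=> //=; exists ([set v | forall i, whitney_nbhd m (uc i) (eps i) (v i)], whitney_nbhd m ug (eps s)).
    by split.
  by case=> v1 v2 [].
move=> [[vc vg] vh] /= [[Hc Hg] Hh] [[i|j]|j] w nu snu /=; have snu' := leq_trans snu m1.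
- exact: (Hc i w nu snu').
- by have /(partial_row_close _ _ _ mk' snu' (E0 _))/(_ j) := Hg w nu snu'.
- by have /(partial_row_close _ _ _ mk' snu' (E0 _))/(_ j) := Hh w nu snu'.
Qed.

End Families.

Section Minorant.
Context {R : realType}.

Lemma continuous_minorant (r theta : nat -> R) : (forall i, i%:R <= r i) -> (forall i, 0 < theta i) ->
  exists E : R -> R, [/\ continuous E, forall t, 0 < E t &
    forall i t, r i <= t <= r i + 1 -> E t <= theta i].
Proof.
move=> r_ge theta0.
pose g i t := Num.max (theta i) (`|t - r i| - 1).
pose V t := [set g i t | i in [set: nat]].
have g0 i t : 0 <= g i t by rewrite le_max (ltW (theta0 i)).
have lbV t : has_lbound (V t) by exists 0 => _ [i _ <-].
have Vn0 t : V t !=set0 by exists (g 0%N t), 0%N.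
have Eg i t : inf (V t) <= g i t by apply: inf_lbound => //; exists i.
have glip i s t : g i s <= g i t + `|s - t|.
  rewrite ge_max; apply/andP; split.
    by rewrite -[theta i]addr0 lerD// le_max lexx.
  rewrite (@le_trans _ _ (`|t - r i| - 1 + `|s - t|))//; last by rewrite lerD2r le_max lexx orbT.
  have := ler_distD t s (r i); lra.
have Elip s t : inf (V s) - `|s - t| <= inf (V t).
  by apply: lb_le_inf => // _ [i _ <-]; rewrite lerBlDr (le_trans (Eg i s)).
exists (fun t => inf (V t)); split.
- move=> t; apply/cvgrPdist_le => e e0; apply/nbhs_ballP; exists e => // s; rewrite /ball /= => ts.
  rewrite ler_norml; have := Elip s t; have := Elip t s; rewrite (distrC s t) => h1 h2.
  by apply/andP; split; lra.
- move=> t.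
  pose N := (Num.truncn (`|t| + 2)).+1.
  have [||K K0 HK] := @finite_upper_bound R 'I_N (fun i K => 0 < K /\ K^-1 <= theta i).
  + move=> i x y xy [x0 h]; have y0 := lt_le_trans x0 xy.
    by split=> //; apply: le_trans h; rewrite lef_pV2.
  + by move=> i; exists (theta i)^-1; rewrite invr_gt0 invrK.
  apply: (@lt_le_trans _ _ (Num.min 1 K^-1)); first by rewrite lt_min ltr01 invr_gt0.
  apply: lb_le_inf => // _ [i _ <-]; have [iN|Ni] := ltnP i N.
    by rewrite le_max ge_min; have [_ ->] := HK (Ordinal iN); rewrite orbT.
  rewrite le_max; apply/orP; right; rewrite ge_min; apply/orP; left.
  have h1 : `|t| + 2 < i%:R by apply: lt_le_trans (truncnS_gt _) _; rewrite ler_nat.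
  have h2 := r_ge i; have h3 := ler_norm (r i - t); have h4 := ler_norm t.
  by rewrite distrC; lra.
- move=> i t /andP[h1 h2]; rewrite (le_trans (Eg i t))// ge_max lexx /=.
  by rewrite ger0_norm ?subr_ge0//; have := theta0 i; lra.
Qed.

End Minorant.

(** * Density *)

Section LocalPerturbations.
Context {R : realType}.

Lemma partial_cst_le a (W : normedModType R) (c : W) (mu : seq 'I_a) (w : 'rV[R]_a) :
  `|partial mu (fun=> c) w| <= `|c|.
Proof.
elim/last_ind: mu c => [//|mu i IH] c; rewrite partial_rcons.
rewrite (_ : pd i _ = fun=> 0); last by apply/funext => v; exact: derive_cst.
by rewrite (le_trans (IH 0))// normr0.
Qed.

Lemma partial_sum a m (I : Type) (r : seq I) (F : I -> 'rV[R]_a -> R) mu w :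
  (forall i, Cn m (F i)) -> (size mu <= m)%N ->
  partial mu (fun w => \sum_(i <- r) F i w) w = \sum_(i <- r) partial mu (F i) w.
Proof.
move=> CF smu; elim: r => [|i r IH].
  rewrite big_nil (_ : (fun w => _) = fun=> 0); last by apply/funext => v; rewrite big_nil.
  by apply/eqP; rewrite -normr_le0 (le_trans (partial_cst_le _ _ _))// normr0.
rewrite big_cons -IH -(partialD w (CF i) _ smu); last exact: Cn_sum.
by congr (partial _ _ _); apply/funext => v; rewrite big_cons.
Qed.

Definition affine {n m : nat} (M : option 'I_n -> R) (w : 'rV[R]_(n + m + m)) : R :=
  M None + \sum_j M (Some j) * w 0 (lshift m (lshift m j)).

Let mono {n m : nat} (o : option 'I_n) (w : 'rV[R]_(n + m + m)) : R :=
  if o is Some j then w 0 (lshift m (lshift m j)) else 1.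

Let affineE {n m : nat} (M : option 'I_n -> R) :
  affine (m := m) M = fun w => \sum_(o <- index_enum {: option 'I_n}) mono o w *: M o.
Proof.
apply/funext => w; rewrite /affine (bigD1 None)//= [1 *: _]mul1r; congr (_ + _).
rewrite (reindex_omap Some id) //=; last by case.
by apply: eq_big => [j|j _]; rewrite ?eqxx// mulrC.
Qed.

Let Cn_mono {n m : nat} k (o : option 'I_n) : Cn k (mono (m := m) o).
Proof. by case: o => [j|]; [exact: Cn_coord|exact: Cn_cst]. Qed.

Lemma Cn_affine n m k (M : option 'I_n -> R) : Cn k (affine (m := m) M).
Proof. by rewrite affineE; apply: Cn_sum => o; apply: CnZ; [exact: Cn_mono|exact: Cn_cst]. Qed.

Lemma affine_small n m k b (t : R) : 0 < t -> exists2 rho, 0 < rho & forall M : option 'I_n -> R,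
  (forall o, `|M o| <= rho) -> forall mu w, (size mu <= k)%N -> `|w| <= b ->
    `|partial mu (affine (m := m) M) w| <= t.
Proof.
move=> t0.
have [||K K0 HK] := @finite_upper_bound R {: option 'I_n} (fun o K => forall (c : R) mu (w : 'rV[R]_(n + m + m)),
    (size mu <= k)%N -> `|w| <= b -> `|partial mu (fun w => mono o w *: c) w| <= K * `|c|).
- move=> o x y xy H c mu w smu wb; rewrite (le_trans (H c mu w smu wb))// ler_wpM2r//.
- move=> o; have [K _ H] := partialM_box_bound b (Cn_mono (m := m) k o).
  exists K => c mu w smu wb; apply: (H _ (fun=> c)) => //; first exact: Cn_cst.
  by move=> nu v _ _; exact: partial_cst_le.
pose N := #|{: option 'I_n}|.
have N0 : 0 < N%:R :> R by rewrite ltr0n; apply/card_gt0P; exists None.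
exists (t / (K * N%:R)) => [|M HM mu w smu wb]; first by rewrite divr_gt0// mulr_gt0.
rewrite affineE (partial_sum _ _ _ smu); last by move=> o; apply: CnZ; [exact: Cn_mono|exact: Cn_cst].
rewrite (le_trans (ler_norm_sum _ _ _))//.
apply: (@le_trans _ _ (\sum_(o : option 'I_n) K * (t / (K * N%:R)))).
  apply: ler_sum => o _; rewrite (le_trans (HK o _ _ _ smu wb))// ler_wpM2l//.
  exact: ltW.
rewrite (_ : \sum_o _ = K * (t / (K * N%:R)) * N%:R).
  by rewrite mulrAC mulrCA divff ?mulr1// mulf_neq0// gt_eqF.
rewrite sumr_const [RHS]mulr_natr; congr (_ *+ _); exact: eq_card.
Qed.

Lemma lipschitz_partials (k : option nat) a (f : 'rV[R]_a -> R) m (b t : R) :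
  leq_order 1 k -> leq_order m k -> Ck k f -> 0 < t -> exists2 v, Ck k v &
    (forall mu w, (size mu <= m)%N -> `|w| <= b -> `|partial mu v w| <= t) /\
    forall l, lipschitz_on_box b (pd l (fun w => f w + v w)).
Proof.
move=> k1 mk Cf t0.
have [k2|k2] := boolP (leq_order 2 k).
  exists (fun=> 0); first by apply/CkP => j _; exact: Cn_cst.
  split=> [mu w _ _|l].
    by rewrite (le_trans (partial_cst_le _ _ _))// normr0 ltW.
  have -> : (fun w => f w + (fun=> 0) w) = f by apply/funext => w; rewrite /= addr0.
  have /CkP/(_ _ k2)/CnS[_ _ /(_ l) Cdf] := Cf.
  have [K K0 HK] := Cn1_box_lipschitz b Cdf.
  have [K' K'0 HK'] := continuous_box_bound b (Cn_continuous Cdf).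
  exists (K' + K) => [|w w' wb w'b]; first by rewrite addr_ge0// ltW.
  split; first by rewrite (le_trans (HK' _ wb))// lerDl ltW.
  by rewrite (le_trans (HK _ _ w'b wb))// ler_wpM2r// lerDr ltW.
have kE : k = Some 1%N by case: k k1 k2 {mk Cf} => [[|[|]]|].
have Cf1 : Cn 1 f by apply/Ck_Some; rewrite -kE.
have [v Cv [Hv Lv]] := smooth_approximation b Cf1 t0.
exists v; first by rewrite kE; apply/Ck_Some.
split=> // mu w smu wb; apply: Hv => //; apply: leq_trans smu _.
by move: mk; rewrite kE.
Qed.

End LocalPerturbations.

Section Shells.
Context {R : realType} {n m : nat}.

Definition is_x (J : 'I_(n + m + m)) : bool := (J < n)%N.

Definition shell_cutoff (rho B : R) (w : 'rV[R]_(n + m + m)) : R :=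
  box_bump is_x (rho + 2) w * (if rho <= 1 then 1 else 1 - box_bump is_x (rho - 2) w) * box_bump xpredT B w.

Lemma Cn_shell_cutoff k rho B : Cn k (shell_cutoff rho B).
Proof.
apply: CnM; last exact: Cn_box_bump.
apply: CnM; first exact: Cn_box_bump.
case: (rho <= 1); first exact: Cn_cst.
by apply: CnD; [exact: Cn_cst|apply: CnN; exact: Cn_box_bump].
Qed.

Local Notation xp w := (lsubmx (lsubmx w)).

Lemma xpart_entry (w : 'rV[R]_(n + m + m)) j : xp w 0 j = w 0 (lshift m (lshift m j)).
Proof. by rewrite !mxE. Qed.

Lemma is_xP (J : 'I_(n + m + m)) : is_x J -> exists j, J = lshift m (lshift m j).
Proof. by move=> Jn; exists (Ordinal Jn); exact: val_inj. Qed.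

Lemma norm_attained a (v : 'rV[R]_a) (r : R) : 0 < r -> r <= `|v| -> exists j, r <= `|v 0 j|.
Proof.
move=> r0 rv; apply: contrapT => H; move: rv; rewrite leNgt => /negP; apply.
apply: norm_rV_lt => // j; rewrite ltNge; apply/negP => rj; apply: H; by exists j.
Qed.

Lemma shell_cutoff1 rho B w : 0 <= rho -> rho - 1 <= `|xp w| <= rho + 2 -> `|w| <= B ->
  shell_cutoff rho B w = 1.
Proof.
move=> rho0 /andP[h1 h2] wB; rewrite /shell_cutoff.
rewrite [box_bump xpredT _ _]box_bump1 ?mulr1; last first.
  by move=> j _; exact: le_trans (norm_entry_le _ _) wB.
rewrite [box_bump _ (rho + 2) _]box_bump1 ?mul1r; last first.
  by move=> _ /is_xP[j ->]; rewrite -xpart_entry (le_trans (norm_entry_le _ _)).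
case: ifPn => //; rewrite -ltNge => rho1.
have [||j wj] := @norm_attained _ (xp w) (rho - 1); [by rewrite subr_gt0|by []|].
rewrite (box_bump0 (j := lshift m (lshift m j))) ?subr0//.
  by rewrite /is_x /=.
by rewrite -xpart_entry (le_trans _ wj)//; lra.
Qed.

Lemma shell_cutoff_x0 rho B w : 0 <= rho -> `|xp w| <= rho - 2 \/ rho + 3 <= `|xp w| ->
  shell_cutoff rho B w = 0.
Proof.
move=> rho0 [h|h]; rewrite /shell_cutoff.
  have := normr_ge0 (xp w) => h0.
  rewrite ifF; last by apply/negbTE; rewrite -ltNge; lra.
  rewrite [box_bump _ (rho - 2) _]box_bump1 ?subrr ?mulr0 ?mul0r//.
  by move=> _ /is_xP[j ->]; rewrite -xpart_entry (le_trans (norm_entry_le _ _)).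
have [||j wj] := @norm_attained _ (xp w) (rho + 3); [by rewrite ltr_wpDl|by []|].
rewrite (box_bump0 (j := lshift m (lshift m j))) ?mul0r//.
  by rewrite /is_x /=.
by rewrite -xpart_entry (le_trans _ wj)//; lra.
Qed.

Lemma shell_cutoff_far0 rho B w : 0 <= B -> B + 1 <= `|w| -> shell_cutoff rho B w = 0.
Proof.
move=> B0 h; have [||j wj] := @norm_attained _ w (B + 1); [by rewrite ltr_wpDl|by []|].
by rewrite /shell_cutoff [box_bump xpredT _ _](box_bump0 (j := j)) ?mulr0.
Qed.

End Shells.

Section Cells.
Context {R : realType}.

(* The unit shells [r <= |x| <= r + 1] are sorted into 8 colours, so that shells of one colour
   are at distance 7 and leave room for the transition zones of the cutoffs. *)
Definition shell_radius (c i : nat) : R := (8 * i + c)%:R.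

Definition cell_index (c : nat) (t : R) : nat := (Num.truncn t + 4 - c) %/ 8.

Lemma shell_radius_ge c i : i%:R <= shell_radius c i.
Proof. by rewrite ler_nat (leq_trans _ (leq_addr _ _))// leq_pmull. Qed.

Lemma shell_radius_sep c i j : (i < j)%N -> shell_radius c i + 8 <= shell_radius c j.
Proof.
by move=> ij; rewrite /shell_radius -[8]/(8%:R) -natrD ler_nat; lia.
Qed.

Lemma shell_cover (t : R) : 0 <= t -> exists2 c, (c < 8)%N & exists i, shell_radius c i <= t <= shell_radius c i + 1.
Proof.
move=> t0; exists (Num.truncn t %% 8)%N; first by rewrite ltn_mod.
exists (Num.truncn t %/ 8)%N; rewrite /shell_radius mulnC -divn_eq.
by have /andP[h1 h2] := truncn_itv t0; rewrite h1 natr1 ltW.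
Qed.

Lemma cell_index_lt c t : 0 <= t -> (c < 8)%N -> t < shell_radius c (cell_index c t) + 4.
Proof.
move=> t0 c8; have /andP[_ h] := truncn_itv t0; apply: lt_le_trans h _.
rewrite /shell_radius -[4]/(4%:R) -natrD ler_nat.
rewrite /cell_index; lia.
Qed.

Lemma cell_index_ge c t : 0 <= t -> (0 < cell_index c t)%N -> shell_radius c (cell_index c t) - 4 <= t.
Proof.
move=> t0 i0; have /andP[h _] := truncn_itv t0; apply: le_trans h.
rewrite lerBlDr /shell_radius -[4]/(4%:R) -natrD ler_nat.
by move: i0; rewrite /cell_index; lia.
Qed.

End Cells.

Section Composite.
Context {R : realType} {n s p q : nat}.
Local Notation idx := (idx s p q).
Local Notation domain l := (@domain R n s p q l).

Definition prl (l : idx) : 'rV[R]_(n + s + s) -> domain l :=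
  match l return 'rV[R]_(n + s + s) -> domain l with
  | inl (inl i) => pr i
  | _ => id
  end.

Definition composite (f : forall l, domain l -> R) (l : idx) (w : 'rV[R]_(n + s + s)) : R := f l (prl l w).

Lemma axis_map_prl (l : idx) : exists sg, axis_map sg (prl l).
Proof.
case: l => [[i|j]|j]; first by exists (emb_inv i); exact: axis_map_pr.
all: exists Some; split=> // w; exact: cvg_id.
Qed.

Lemma norm_prl_le (l : idx) w b : `|w| <= b -> `|prl l w| <= b.
Proof. by case: l => [[i|j]|j] //=; exact: norm_pr_le. Qed.

Lemma xpart_prl (l : idx) w : xpart (prl l w) = lsubmx (lsubmx w).
Proof. by case: l => [[i|j]|j] //=; rewrite /xpart /pr /join3 !row_mxKl. Qed.

Lemma xpart_kink (x : 'rV[R]_n) (z : 'rV[R]_s) : lsubmx (lsubmx (kink x z)) = x.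
Proof. by rewrite /kink /join3 !row_mxKl. Qed.

Lemma Cn_composite m (f : forall l, domain l -> R) l : Cn m (f l) -> Cn m (composite f l).
Proof. by move=> Cf; have [sg ax] := axis_map_prl l; exact: (Cn_axis_comp (f := f l) ax). Qed.

Lemma composite_triY (f : forall l, domain l -> R) (i' i : 'I_s) w : Cn 1 (f (cI i')) -> ~~ (i < i')%N ->
  dy (composite f (cI i')) i w = 0.
Proof. by move=> C ii; exact: (dy_pr w C ii). Qed.

Lemma composite_triZ (f : forall l, domain l -> R) (i' i : 'I_s) w : Cn 1 (f (cI i')) -> ~~ (i < i')%N ->
  dz (composite f (cI i')) i w = 0.
Proof. by move=> C ii; exact: (dz_pr w C ii). Qed.

Lemma composite_lipschitz (f : forall l, domain l -> R) l b J : Cn 1 (f l) -> (forall J, lipschitz_on_box b (pd J (f l))) ->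
  lipschitz_on_box b (pd J (composite f l)).
Proof.
case: l J => [[i|j]|j] J /CnS[_ df _] Lf.
- exact: pd_pr_lipschitz.
- exact: (Lf J).
- exact: (Lf J).
Qed.

Lemma Cn1_lipschitz_on_box a (f : 'rV[R]_a -> R) b : Cn 1 f -> lipschitz_on_box b f.
Proof.
move=> Cf; have [K K0 HK] := Cn1_box_lipschitz b Cf.
have [K' K'0 HK'] := continuous_box_bound b (Cn_continuous Cf).
exists (K' + K) => [|w w' wb w'b]; first by rewrite addr_ge0// ltW.
split; first by rewrite (le_trans (HK' _ wb))// lerDl ltW.
by rewrite (le_trans (HK _ _ w'b wb))// ler_wpM2r// lerDr ltW.
Qed.

Lemma affine_prl (M : option 'I_n -> R) l w :
  affine (m := dm l) M (prl l w) = affine (m := s) M w.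
Proof.
rewrite /affine; congr (_ + _); apply: eq_bigr => j _; congr (_ * _).
by rewrite -!xpart_entry -/(xpart (prl l w)) xpart_prl.
Qed.

Lemma affine_kink (M : option 'I_n -> R) x (z : 'rV[R]_s) :
  affine M (kink x z) = M None + \sum_j M (Some j) * x 0 j.
Proof.
by rewrite /affine; congr (_ + _); apply: eq_bigr => j _; rewrite -xpart_entry xpart_kink.
Qed.

Lemma is_derive_affine (M : option 'I_n -> R) (w : 'rV[R]_(n + s + s)) l :
  is_derive w (delta_mx 0 l) (affine M) (\sum_j M (Some j) * (l == lshift s (lshift s j))%:R).
Proof.
have D : is_derive w (delta_mx 0 l) (cst (M None) +
   \sum_(j < n) (cst (M (Some j)) * (fun w : 'rV[R]_(n + s + s) => w 0 (lshift s (lshift s j)))))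
   (0 + \sum_(j < n) (M (Some j) *: ((l == lshift s (lshift s j))%:R : R) +
        w 0 (lshift s (lshift s j)) *: (0 : R))).
  apply: is_deriveD; apply: is_derive_sum => j; apply: is_deriveM.
  exact: pd_coord.
rewrite (_ : affine M = cst (M None) +
   \sum_(j < n) (cst (M (Some j)) * (fun w : 'rV[R]_(n + s + s) => w 0 (lshift s (lshift s j))))).
  apply: is_derive_eq D _; rewrite add0r; apply: eq_bigr => j _.
  by rewrite scaler0 addr0.
by apply/funext => v; rewrite /affine fctE fct_sumE.
Qed.

Lemma dx_affine (M : option 'I_n -> R) (w : 'rV[R]_(n + s + s)) j : dx (affine M) j w = M (Some j).
Proof.
rewrite /dx; have [_ ->] := is_derive_affine M w (lshift s (lshift s j)).
rewrite (bigD1 j)//= eqxx mulr1 big1 ?addr0// => i ij.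
by rewrite !eq_lshift eq_sym (negbTE ij) mulr0.
Qed.

Lemma dy_affine (M : option 'I_n -> R) (w : 'rV[R]_(n + s + s)) i : dy (affine M) i w = 0.
Proof.
rewrite /dy; have [_ ->] := is_derive_affine M w (lshift s (rshift n i)).
by rewrite big1// => j _; rewrite eq_lshift eq_rlshift mulr0.
Qed.

Lemma dz_affine (M : option 'I_n -> R) (w : 'rV[R]_(n + s + s)) i : dz (affine M) i w = 0.
Proof.
rewrite /dz; have [_ ->] := is_derive_affine M w (rshift (n + s) i).
by rewrite big1// => j _; rewrite eq_rlshift mulr0.
Qed.

Lemma defect_near (U V : idx -> 'rV[R]_(n + s + s) -> R) x z :
  (forall l, \forall w \near kink x z, U l w = V l w) -> defect U x z -> defect V x z.
Proof.
move=> UV; have E l : U l (kink x z) = V l (kink x z) by exact: nbhs_singleton (UV l).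
have dE l J : pd J (U l) (kink x z) = pd J (V l) (kink x z) by exact: near_eq_derive.
move=> [[h1 h2 h3] [mu [m1 m2 m3] mu0]]; split; first split=> i.
- by rewrite h1 E.
- by rewrite -E.
- by rewrite -E.
exists mu => //; split=> i.
- by rewrite -E.
- by rewrite -[RHS](m2 i); apply: eq_bigr => l _; rewrite /dx dE.
- by rewrite m3; apply: eq_bigr => l _; rewrite /dy /dz !dE.
Qed.

End Composite.

Section LocalGenericity.
Context {R : realType} {n s p q : nat} (k : option nat).
Local Notation idx := (idx s p q).
Local Notation domain l := (@domain R n s p q l).
Hypothesis k1 : leq_order 1 k.

Lemma Ck_Cn1 a (f : 'rV[R]_a -> R) : Ck k f -> Cn 1 f.
Proof. by move=> /CkP; apply. Qed.

Lemma generic_perturbation (f : forall l, domain l -> R) (chi : forall l, domain l -> R) m (b t : R) :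
  leq_order m k -> (forall l, Ck k (f l)) -> (forall l j, Cn j (chi l)) -> 0 < t ->
  exists v : forall l, domain l -> R, [/\ forall l, Ck k (v l),
    forall l mu w, (size mu <= m)%N -> `|w| <= b -> `|partial mu (fun w => chi l w *: v l w) w| <= t &
    forall x z, `|x| <= b -> `|z| <= b -> ~ defect (composite (fun l w => f l w + v l w)) x z].
Proof.
move=> mk Cf Cchi t0.
have [||K K0 HK] := @finite_upper_bound R {: idx} (fun l K => forall (v : domain l -> R) eta, Cn m v ->
    (forall mu w, (size mu <= m)%N -> `|w| <= b -> `|partial mu v w| <= eta) ->
    forall mu w, (size mu <= m)%N -> `|w| <= b -> `|partial mu (fun w => chi l w *: v w) w| <= K * eta).
- move=> l x y xy H v eta Cv vb mu w smu wb.
  rewrite (le_trans (H v eta Cv vb mu w smu wb))// ler_wpM2r//.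
  exact: le_trans (normr_ge0 _) (vb [::] w isT wb).
- by move=> l; have [K _ H] := partialM_box_bound b (Cchi l m); exists K => v; exact: H.
pose eta := t / K.
have eta0 : 0 < eta by rewrite divr_gt0.
have eta20 : 0 < eta / 2 by rewrite divr_gt0.
have Hv0 (l : idx) : exists v : domain l -> R, [/\ Ck k v,
    forall mu w, (size mu <= m)%N -> `|w| <= b -> `|partial mu v w| <= eta / 2 &
    forall J, lipschitz_on_box b (pd J (fun w => f l w + v w))].
  by have [v Cv [H1 H2]] := lipschitz_partials b k1 mk (Cf l) eta20; exists v.
pose v0 l := sval (cid (Hv0 l)).
have v0P l := svalP (cid (Hv0 l)).
pose f0 l w := f l w + v0 l w.
have Cf0 l : Cn 1 (f0 l).
  by apply: CnD; apply: Ck_Cn1 => //; have [] := v0P l.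
have [||rK rK0 Hrho] := @finite_upper_bound R {: idx} (fun l K => 0 < K /\ forall M : option 'I_n -> R,
    (forall o, `|M o| <= K^-1) -> forall mu (w : domain l), (size mu <= m)%N -> `|w| <= b ->
    `|partial mu (affine (m := dm l) M) w| <= eta / 2).
- move=> l x y xy [x0 H]; have y0 := lt_le_trans x0 xy; split=> // M HM; apply: H => o.
  by apply: le_trans (HM o) _; rewrite lef_pV2.
- move=> l; have [rho rho0 H] := @affine_small R n (dm l) m b (eta / 2) eta20.
  by exists rho^-1; rewrite invr_gt0 invrK.
have rho0 : 0 < rK^-1 by rewrite invr_gt0.
have [M HM sing] := @generic_parameter R n s p q (composite f0)
  (fun l => dx (composite f0 l)) (fun l => dy (composite f0 l)) (fun l => dz (composite f0 l)) b rK^-1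
  (fun l => Cn1_lipschitz_on_box b (Cn_composite (Cf0 l)))
  (fun l j => composite_lipschitz _ (Cf0 l) (let: And3 _ _ h := v0P l in h))
  (fun l j => composite_lipschitz _ (Cf0 l) (let: And3 _ _ h := v0P l in h))
  (fun l j => composite_lipschitz _ (Cf0 l) (let: And3 _ _ h := v0P l in h))
  (fun i' i w => composite_triY w (Cf0 _)) (fun i' i w => composite_triZ w (Cf0 _)) rho0.
pose aff l : domain l -> R := affine (m := dm l) (fun o => M (l, o)).
have Cv l : Ck k (fun w => v0 l w + aff l w).
  apply/CkP => j jk; apply: CnD; last exact: Cn_affine.
  by have [/CkP C _ _] := v0P l; exact: C.
exists (fun l w => v0 l w + aff l w); split=> //.
- move=> l mu w smu wb; rewrite (_ : t = K * eta); last by rewrite /eta mulrC divfK// gt_eqF.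
  apply: HK => //; first by have /CkP := Cv l; apply.
  move=> nu x snu xb; have [/CkP C H _] := v0P l.
  rewrite (partialD x (C m mk) _ snu); last exact: Cn_affine.
  rewrite (le_trans (ler_normD _ _))// [leRHS](splitr eta) lerD//; first exact: H.
  by have [_] := Hrho l; apply.
- move=> x z xb zb [[h1 h2 h3] [mu [m1 m2 m3] mu0]].
  set U1 := composite _ in h1 h2 h3 m1 m2 m3.
  have U1E l : U1 l = fun w => composite f0 l w + affine (fun o => M (l, o)) w.
    apply/funext => w; rewrite /U1 /composite /= /f0 -addrA; congr (_ + _).
    by rewrite /aff affine_prl.
  have dE l J w : pd J (U1 l) w = pd J (composite f0 l) w + pd J (affine (fun o => M (l, o))) w.
    rewrite U1E; apply: deriveD.
      by have /CnS[_ d _] := Cn_composite (Cf0 l).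
    by have /CnS[_ d _] := Cn_affine s 1 (fun o => M (l, o)).
  have sh l : shifted (composite f0) M l x z = U1 l (kink x z).
    by rewrite U1E /shifted affine_kink.
  apply: (sing x z mu xb zb); split=> //.
  + by split=> i; rewrite sh.
  + by move=> i; rewrite sh.
  + move=> j; rewrite -[RHS](m2 j); apply: eq_bigr => l _; congr (_ * _).
    by rewrite [RHS]dE -[X in _ = _ + X]/(dx _ j _) dx_affine.
  + move=> i; rewrite m3; apply: eq_bigr => l _; congr ((_ * _ + _ * _) * _).
      by rewrite [LHS]dE -[X in _ + X]/(dy _ i _) dy_affine addr0.
    by rewrite [LHS]dE -[X in _ + X]/(dz _ i _) dz_affine addr0.
Qed.

End LocalGenericity.

Section Shellwise.
Context {R : realType} {n s p q : nat} (k : option nat).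
Hypothesis k1 : leq_order 1 k.
Local Notation idx := (idx s p q).
Local Notation domain l := (@domain R n s p q l).
Local Notation tuples := (@tuples R n s p q k).
Implicit Types f g : forall l : idx, domain l -> R.

Lemma feasible_composite_bound f B : (forall l, Cn 1 (f l)) -> exists2 M, 0 < M &
  forall g x z, `|x| <= B -> (forall l w, xpart w = x -> `|f l w - g l w| <= 1) ->
    feasible_at (composite g) x z -> `|z| <= M.
Proof.
move=> Cf; have [M M0 H] := feasible_bound B (fun i => Cn_continuous (Cf (cI i))).
exists M => // g x z xB fg [zE _ _]; apply: (H x z xB) => i.
rewrite zE distrC; apply: (fg (cI i) (prl (cI i) (kink x z))).
by rewrite xpart_prl xpart_kink.
Qed.

Lemma close_composite f g w eta : 0 <= eta -> (forall l, Cn 1 (f l)) -> (forall l, Cn 1 (g l)) ->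
  (forall l mu, (size mu <= 1)%N ->
     `|partial mu (f l) (prl l w) - partial mu (g l) (prl l w)| <= eta) ->
  close_at eta (composite f) (composite g) w.
Proof.
move=> eta0 Cf Cg H l; split=> [|J]; first exact: (H l [::]).
have [sg ax] := @axis_map_prl R n s p q l.
have /CnS[_ df _] := Cf l; have /CnS[_ dg _] := Cg l.
have [_ E1] := pd_axis_comp (f := f l) w J ax (fun v i => df v i).
have [_ E2] := pd_axis_comp (f := g l) w J ax (fun v i => dg v i).
have -> : pd J (composite f l) w = if sg J is Some J' then pd J' (f l) (prl l w) else 0 by exact: E1.
have -> : pd J (composite g l) w = if sg J is Some J' then pd J' (g l) (prl l w) else 0 by exact: E2.
by case: (sg J) => [J'|]; [exact: (H l [:: J'])|rewrite subrr normr0].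
Qed.

Lemma near_xpart_norm (l : idx) (w0 : domain l) (lo hi : R) : lo < `|xpart w0| < hi ->
  \forall w \near w0, lo < `|xpart w| < hi.
Proof.
move=> /andP[h1 h2].
have c := @continuous_norm_xpart R n (dm l) (dm l).
have n1 : \forall w \near w0, lo < `|xpart w| by exact: (cvgr_gt `|xpart w0| (c w0)).
have n2 : \forall w \near w0, `|xpart w| < hi by exact: (cvgr_lt `|xpart w0| (c w0)).
by apply: filterS2 n1 n2 => w -> ->.
Qed.

Lemma local_perturbation f rho m (tau : nat -> R) : 0 <= rho -> leq_order m k ->
  (forall N, 0 < tau N) -> (forall l, Ck k (f l)) ->
  exists P : forall l : idx, domain l -> R, [/\ forall l, Ck k (P l),
    forall l mu w, (size mu <= m)%N -> `|partial mu (P l) w| < tau (Num.truncn `|w|),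
    forall l w, `|xpart w| <= rho - 2 \/ rho + 3 <= `|xpart w| -> P l w = 0 &
    forall g x z, rho <= `|x| <= rho + 1 -> (forall l w, `|f l w - g l w| <= 1) ->
      (forall l w, rho - 1 < `|xpart w| < rho + 2 -> g l w = f l w + P l w) ->
      ~ defect (composite g) x z].
Proof.
move=> rho0 mk tau0 Cf.
have Cf1 l : Cn 1 (f l) := Ck_Cn1 k1 (Cf l).
have [M M0 HM] := feasible_composite_bound (rho + 1) Cf1.
pose B := M + rho + 3; pose b := B + 1.
have B0 : 0 <= B by rewrite !addr_ge0// ltW.
have [||K K0 HK] := @finite_upper_bound R 'I_(Num.truncn b).+1 (fun i K => 0 < K /\ K^-1 <= tau i).
- move=> i x y xy [x0 h]; have y0 := lt_le_trans x0 xy.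
  by split=> //; apply: le_trans h; rewrite lef_pV2.
- by move=> i; exists (tau i)^-1; rewrite invr_gt0 invrK.
have t0 : 0 < K^-1 / 2 by rewrite divr_gt0// invr_gt0.
have [v [Cv Hv Dv]] := generic_perturbation k1 b (chi := fun l => shell_cutoff (m := dm l) rho B)
   mk Cf (fun l j => Cn_shell_cutoff j rho B) t0.
exists (fun l w => shell_cutoff rho B w *: v l w); split.
- move=> l; apply/CkP => j jk; apply: CnZ; first exact: Cn_shell_cutoff.
  by have /CkP := Cv l; apply.
- move=> l mu w smu; have [wb|bw] := leP `|w| b.
    rewrite (le_lt_trans (Hv l mu w smu wb))//.
    have wN : (Num.truncn `|w| < (Num.truncn b).+1)%N by rewrite ltnS le_truncn.
    have [_ /= h] := HK (Ordinal wN).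
    by apply: lt_le_trans h; rewrite ltr_pdivrMr ?ltr_pMr ?ltr1n ?invr_gt0.
  have -> : partial mu (fun w => shell_cutoff rho B w *: v l w) w = partial mu (fun=> (0 : R)) w.
    apply: partial_near.
    have : \forall w' \near w, b < `|w'| by exact: (cvgr_gt `|w| (@norm_continuous _ _ w)).
    by apply: filterS => w' /ltW bw'; rewrite shell_cutoff_far0// scale0r.
  by rewrite (le_lt_trans (partial_cst_le _ _ _))// normr0.
- by move=> l w h; rewrite shell_cutoff_x0// scale0r.
- move=> g x z xs fg gE D; have /andP[x1 x2] := xs.
  have zM : `|z| <= M.
    by case: (D) => F _; apply: HM F => // l w _; exact: fg.
  apply: (Dv x z); last apply: defect_near D => l.
  + by rewrite (le_trans x2)// /b /B; lra.
  + by rewrite (le_trans zM)// /b /B; lra.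
  have [sg [cpi _]] := @axis_map_prl R n s p q l.
  have nx : \forall w \near prl l (kink x z), rho - 1 < `|xpart w| < rho + 2.
    by apply: near_xpart_norm; rewrite xpart_prl xpart_kink; apply/andP; split; lra.
  have nb : \forall w \near prl l (kink x z), `|w| < B.
    apply: (cvgr_lt `|prl l (kink x z)| (@norm_continuous _ _ (prl l (kink x z)))).
    apply: (@le_lt_trans _ _ (M + rho + 1)); last by rewrite /B; lra.
    by apply: norm_prl_le; apply: norm_kink_le; [rewrite (le_trans x2)//; lra|rewrite (le_trans zM)//; lra].
  have nn : \forall w \near prl l (kink x z), g l w = f l w + v l w.
    apply: filterS2 nx nb => w wx wB; rewrite gE// shell_cutoff1// ?scale1r//.
      by have /andP[h1 h2] := wx; rewrite !ltW.
    exact: ltW.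
  exact: (cpi (kink x z) _ nn).
Qed.

Lemma glued_perturbation f c m (tau : nat -> R) : (c < 8)%N -> leq_order m k ->
  (forall N, 0 < tau N) -> (forall l, Ck k (f l)) ->
  exists g, [/\ forall l, Ck k (g l),
    forall l mu w, (size mu <= m)%N -> `|partial mu (f l) w - partial mu (g l) w| < tau (Num.truncn `|w|) &
    forall i x z, shell_radius c i <= `|x| <= shell_radius c i + 1 -> ~ defect (composite g) x z].
Proof.
move=> c8 mk tau0 Cf.
pose tau' N := Num.min (tau N) 1.
have tau'0 N : 0 < tau' N by rewrite lt_min tau0 ltr01.
pose rho i : R := shell_radius c i.
have rho0 i : 0 <= rho i by rewrite /rho /shell_radius.
have /choice[P HP] := fun i => local_perturbation (rho0 i) mk tau'0 Cf.
pose cell l (w : domain l) := cell_index c `|xpart w|.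
pose g l w := f l w + P (cell l w) l w.
have far (l : idx) (w w' : domain l) : `| `|xpart w| - `|xpart w'| | < 1 -> (cell l w < cell l w')%N ->
    [/\ rho (cell l w) + 3 <= `|xpart w|, rho (cell l w) + 3 <= `|xpart w'|,
        `|xpart w| <= rho (cell l w') - 2 & `|xpart w'| <= rho (cell l w') - 2].
  move=> dw ij; have := cell_index_lt (normr_ge0 (xpart w)) c8.
  have := cell_index_ge (normr_ge0 (xpart w')) (leq_ltn_trans (leq0n _) ij).
  have := shell_radius_sep (R := R) c ij; rewrite -/(cell l w) -/(cell l w') -/(rho _) -/(rho _).
  move: dw; rewrite ltr_norml => /andP[]; move: (`|xpart w|) (`|xpart w'|) (rho _) (rho _) => t t' r r'.
  by move=> ? ? ? ? ?; split; lra.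
have vanish l w i : `|xpart w| <= rho i - 2 \/ rho i + 3 <= `|xpart w| -> P i l w = 0.
  by have [_ _ + _] := HP i; apply.
have gE l w0 : \forall w \near w0, g l w = f l w + P (cell l w0) l w.
  have : \forall w \near w0, `|xpart w0| - 1 < `|xpart w| < `|xpart w0| + 1.
    by apply: near_xpart_norm; apply/andP; split; lra.
  apply: filterS => w /andP[w1 w2]; rewrite /g; congr (_ + _).
  have [ww|ww|-> //] := ltngtP (cell l w) (cell l w0).
  - have [|h1 h2 h3 h4] := far l w w0 _ ww; first by rewrite ltr_norml; apply/andP; split; lra.
    by rewrite !(vanish l w); [|left|right].
  - have [|h1 h2 h3 h4] := far l w0 w _ ww; first by rewrite ltr_norml; apply/andP; split; lra.
    by rewrite !(vanish l w); [|right|left].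
have Cf' j l : leq_order j k -> Cn j (f l) by have /CkP := Cf l; apply.
have CP i j l : leq_order j k -> Cn j (P i l) by have [/(_ l)/CkP + _ _ _] := HP i; apply.
have close l mu w : (size mu <= m)%N -> `|partial mu (f l) w - partial mu (g l) w| < tau' (Num.truncn `|w|).
  move=> smu; rewrite (partial_near mu (gE l w)) (partialD w (Cf' _ _ mk) (CP _ _ _ mk) smu).
  by rewrite opprD addNKr normrN; have [_ h _ _] := HP (cell l w); exact: h.
exists g; split.
- move=> l; apply/CkP => j jk; apply: Cn_near => w0; exists (fun w => f l w + P (cell l w0) l w) => //.
  by apply: CnD; [exact: Cf'|exact: CP].
- by move=> l mu w smu; rewrite (lt_le_trans (close l mu w smu))// ge_min lexx.
- move=> i x z xs; have [_ _ _ H] := HP i; apply: (H g x z xs).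
    by move=> l w; rewrite (le_trans (ltW (close l [::] w isT)))// ge_min lexx orbT.
  move=> l w /andP[w1 w2]; congr (_ + _); rewrite (_ : cell l w = i)//.
  have h1 := cell_index_lt (normr_ge0 (xpart w)) c8.
  have [ji|ij|//] := ltngtP (cell l w) i.
    have := shell_radius_sep (R := R) c ji; move: h1 w1; rewrite -/(cell l w) /rho.
    by move=> *; exfalso; lra.
  have := cell_index_ge (normr_ge0 (xpart w)) (leq_ltn_trans (leq0n _) ij).
  have := shell_radius_sep (R := R) c ij; move: w2; rewrite -/(cell l w) /rho.
  by move=> *; exfalso; lra.
Qed.

Lemma Ck_scalars (u : tuples) l : Ck k (scalars u (l := l)).
Proof.
case: l => [[i|j]|j]; first exact: Ck_valP.
all: apply/CkP => m mk.
- exact: ((Cn_rowP m _).1 ((CkP k _).1 (Ck_valP u.1.2) m mk)).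
- exact: ((Cn_rowP m _).1 ((CkP k _).1 (Ck_valP u.2) m mk)).
Qed.

Lemma scalars_surj f : (forall l, Ck k (f l)) -> exists u : tuples, forall l, scalars u (l := l) = f l.
Proof.
move=> Cf.
have Crow r (F : 'I_r -> 'rV[R]_(n + s + s) -> R) : (forall j, Ck k (F j)) -> Ck k (fun w => \row_j F j w).
  move=> CF; apply/CkP => m mk; apply/Cn_rowP => j.
  by apply: (Cn_eq (f := F j)) => [w|]; [rewrite mxE|have /CkP := CF j; apply].
exists ((fun i => CkFun (Cf (cI i))), CkFun (Crow p (fun j => f (gI j)) (fun j => Cf (gI j))),
  CkFun (Crow q (fun j => f (hI j)) (fun j => Cf (hI j)))).
by case=> [[i|j]|j] //=; apply/funext => w; rewrite mxE.
Qed.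

Definition defect_free (c : nat) : set tuples := [set u | forall i x z,
  shell_radius c i <= `|x| <= shell_radius c i + 1 -> ~ defect (composite (fun l => scalars u (l := l))) x z].

Lemma dense_defect_free c : (c < 8)%N -> dense (defect_free c).
Proof.
move=> c8 O [u Ou] oO.
have [m [tau [mk tau0 Htau]]] := nbhs_family_close (open_nbhs_nbhs (conj oO Ou)).
have [g [Cg fg Dg]] := glued_perturbation c8 mk tau0 (Ck_scalars u).
have [v vE] := scalars_surj Cg; exists v; split.
  by apply: Htau => l w mu smu; rewrite vE; exact: fg.
by rewrite /defect_free /= (_ : (fun l => scalars v (l := l)) = g)//; apply: functional_extensionality_dep.
Qed.

Lemma open_defect_free c : open (defect_free c).
Proof.
rewrite openE => u Hu; pose f l := scalars u (l := l).
have Cf l : Cn 1 (f l) by apply: (Ck_Cn1 k1); exact: Ck_scalars.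
have /choice[theta Htheta] i : exists theta : R, 0 < theta /\ forall g, (forall l, Cn 1 (g l)) ->
    (forall l w mu, (size mu <= 1)%N -> shell_radius c i <= `|xpart w| <= shell_radius c i + 1 ->
       `|partial mu (f l) w - partial mu (g l) w| <= theta) ->
    forall x z, shell_radius c i <= `|x| <= shell_radius c i + 1 -> ~ defect (composite g) x z.
  have [M M0 HM] := feasible_composite_bound (shell_radius c i + 1) Cf.
  have [|eta eta0 Heta] := @stability _ _ _ _ _ (composite f) (shell_radius c i) (shell_radius c i + 1) M
     (fun l => Cn_composite (Cf l)).
    by move=> x z xs _; exact: Hu xs.
  exists (Num.min eta 1); split=> [|g Cg Hg x z xs D]; first by rewrite lt_min eta0 ltr01.
  have Hx l w mu : (size mu <= 1)%N -> xpart w = x ->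
      `|partial mu (f l) w - partial mu (g l) w| <= Num.min eta 1.
    by move=> smu wx; apply: Hg => //; rewrite wx.
  apply: (Heta (composite g) x z xs _ _ D).
    case: (D) => F _; apply: HM F; first by case/andP: xs.
    by move=> l w wx; rewrite (le_trans (Hx l w [::] isT wx))// ge_min lexx orbT.
  apply: close_composite => //; first exact: ltW.
  move=> l mu smu; rewrite (le_trans (Hx l _ mu smu _)) ?ge_min ?lexx//.
  by rewrite xpart_prl xpart_kink.
have [E [cE E0 HE]] := continuous_minorant (shell_radius_ge (R := R) c) (fun i => (Htheta i).1).
apply: filterS (nbhs_family_near u k1 cE E0) => v Hv i x z xs.
apply: (Htheta i).2 xs => [l|l w mu smu ws]; first by apply: (Ck_Cn1 k1); exact: Ck_scalars.
by rewrite (le_trans (ltW (Hv l w mu smu)))//; exact: HE.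
Qed.

End Shellwise.

Section Qualification.
Context {R : realType} {n s p q : nat} (k : option nat).
Hypothesis k1 : leq_order 1 k.
Local Notation tuples := (@tuples R n s p q k).

Lemma composite_scalars (u : tuples) :
  composite (fun l => scalars u (l := l)) = components (switching (fun i : 'I_s => u.1.1 i)) u.1.2 u.2.
Proof.
apply: functional_extensionality_dep => -[[i|j]|j]; apply/funext => w //.
by rewrite /components switchingE.
Qed.

Lemma LIKQ_defect_free (u : tuples) :
  (forall (x : 'rV[R]_n) (z : 'rV[R]_s), feasible (switching (fun i : 'I_s => u.1.1 i)) u.1.2 u.2 (x, z) ->
     LIKQ (switching (fun i : 'I_s => u.1.1 i)) u.1.2 u.2 x z) <->
  forall c : 'I_8, defect_free c u.
Proof.
have Cu l : Cn 1 (scalars u (l := l)) by apply: (Ck_Cn1 k1); exact: Ck_scalars.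
have CU l : Cn 1 (components (switching (fun i : 'I_s => u.1.1 i)) u.1.2 u.2 l).
  by rewrite -composite_scalars; apply: Cn_composite; exact: Cu.
have key x z : defect (composite (fun l => scalars u (l := l))) x z <->
  feasible (switching (fun i : 'I_s => u.1.1 i)) u.1.2 u.2 (x, z) /\
  ~ LIKQ (switching (fun i : 'I_s => u.1.1 i)) u.1.2 u.2 x z.
  rewrite (LIKQ_multiplier CU); last 2 first.
  - by move=> i' i w ii; rewrite -composite_scalars; apply: composite_triY => //; exact: Cu.
  - by move=> i' i w ii; rewrite -composite_scalars; apply: composite_triZ => //; exact: Cu.
  rewrite /defect composite_scalars; split=> -[[h1 h2 h3] H]; split=> //; split=> //=.
  - by apply/rowP => i; exact: h1.
  - by apply/rowP => i; rewrite mxE; exact: h3.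
  - by move=> i; move/rowP: h1 => /(_ i).
  - by move=> i; move/rowP: h3 => /(_ i); rewrite mxE.
split=> [H c i x z _ /key[F]|H x z F]; first by apply; exact: H.
apply: contrapT => L; have [c c8 [i xi]] := shell_cover (normr_ge0 x).
by apply: (H (Ordinal c8) i x z xi); apply/key.
Qed.

End Qualification.

Theorem theorem16 (R : realType) (n s p q : nat) (k : option nat)
    (k_ge1 : leq_order 1 k) (k_ge_nq : leq_order (n - q) k) :
  let C := (prod_topology (fun i : 'I_s => Ck_fun R k (n + i + i) R)
            * Ck_fun R k (n + s + s) 'rV[R]_p
            * Ck_fun R k (n + s + s) 'rV[R]_q)%type in
  let G : set C :=
    [set u : C | let c := switching (fun i : 'I_s => u.1.1 i) in
                 let g := u.1.2 in
                 let h := u.2 in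
                 forall (x : 'rV[R]_n) (z : 'rV[R]_s),
                   feasible c g h (x, z) -> LIKQ c g h x z] in
  open G /\ dense G.
Proof.
move=> C G.
have GE : G = \big[setI/setT]_(c < 8) (defect_free c : set C).
  rewrite -bigcap_mkord; apply/seteqP; split=> u.
    by move=> /(LIKQ_defect_free k_ge1) H c /= c8; exact: (H (Ordinal c8)).
  by move=> H; apply/(LIKQ_defect_free k_ge1) => c; apply: H => /=.
rewrite GE; have [] : open (\big[setI/setT]_(c < 8) (defect_free c : set C)) /\
   dense (\big[setI/setT]_(c < 8) (defect_free c : set C)); last by [].
apply: (big_ind (fun A : set C => open A /\ dense A)).
- by split; [exact: openT|move=> O [u Ou] _; exists u].
- by move=> A B [oA dA] [oB dB]; split; [exact: openI|exact: denseI].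
- by move=> c _; split; [exact: open_defect_free|exact: dense_defect_free].
Qed.
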